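(* Let $\Sigma\subset\mathbb{T}^2$ be a real analytic curve which is not a geodesic. There is $E_\Sigma$ such that for every $E\ge E_\Sigma$ and every eigenfunction $\varphi_E$ with eigenvalue $E$ and nodal set $N$, $$ c_\varepsilon E^{\frac12-\varepsilon}<\#(N\cap\Sigma)<C\,E^{\frac12}\quad\text{for all }\varepsilon>0, $$ where $C$ depends on $\Sigma$ and $c_\varepsilon>0$ depends on $\varepsilon$ and $\Sigma$.
   Context: $\mathbb{T}^2=\mathbb{R}^2/\mathbb{Z}^2$. An eigenfunction with eigenvalue $E\in\mathbb{Z}_{>0}$ is a non-zero real-valued function of the form $\varphi_E(x)=\sum_{\xi\in\mathbb{Z}^2,\,|\xi|^2=E}\hat\varphi(\xi)e^{2\pi i x\cdot\xi}$ (so $-\Delta\varphi_E=4\pi^2E\varphi_E$). Its nodal set is $N=\{x:\varphi_E(x)=0\}$. A geodesic of $\mathbb{T}^2$ is (the image of) a straight line segment. *)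

(* Defs.v *)
From Stdlib Require Import Reals Lra ZArith List.
From Coquelicot Require Import Coquelicot.
Import ListNotations.
Open Scope R_scope.

(** * The torus T^2 = R^2 / Z^2.
    A point of T^2 is represented by its canonical representative in [0,1)^2. *)
Definition red (x : R * R) : R * R := (frac_part (fst x), frac_part (snd x)).

Definition real_analytic_at (f : R -> R) (t0 : R) : Prop :=
  exists (c : nat -> R) (r : R), 0 < r /\
    forall t, Rabs (t - t0) < r -> is_pseries c (t - t0) (f t).

Definition analytic_regular_curve (a b : R) (g1 g2 : R -> R) : Prop :=
  a < b /\
  (forall t, a <= t <= b -> real_analytic_at g1 t /\ real_analytic_at g2 t) /\
  (forall t, a <= t <= b -> exists d1 d2,
       is_derive g1 t d1 /\ is_derive g2 t d2 /\ (d1 <> 0 \/ d2 <> 0)).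

Definition in_Sigma (a b : R) (g1 g2 : R -> R) (p : R * R) : Prop :=
  exists t, a <= t <= b /\ red (g1 t, g2 t) = p.

Definition is_geodesic (S : R * R -> Prop) : Prop :=
  exists P V : R * R, forall q,
    S q <-> exists s, 0 <= s <= 1 /\
              red (fst P + s * fst V, snd P + s * snd V) = q.

Definition zrange (E : nat) : list Z :=
  map (fun k => (Z.of_nat k - Z.of_nat E)%Z) (seq 0 (2 * E + 1)).

(** The lattice points xi in Z^2 with |xi|^2 = E (every such point has
    coordinates in [-E, E]). *)
Definition lattice_pts (E : nat) : list (Z * Z) :=
  filter (fun xi => Z.eqb (fst xi * fst xi + snd xi * snd xi)%Z (Z.of_nat E))
         (list_prod (zrange E) (zrange E)).

Definition cexpi (th : R) : C := (cos th, sin th).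

Definition eigen_sum (E : nat) (c : Z * Z -> C) (x : R * R) : C :=
  fold_right Cplus (RtoC 0)
    (map (fun xi => Cmult (c xi)
            (cexpi (2 * PI * (fst x * IZR (fst xi) + snd x * IZR (snd xi)))))
         (lattice_pts E)).

Definition is_eigenfunction (E : nat) (c : Z * Z -> C) : Prop :=
  (forall x, Im (eigen_sum E c x) = 0) /\
  (exists x, eigen_sum E c x <> RtoC 0).

Definition phi (E : nat) (c : Z * Z -> C) (x : R * R) : R := Re (eigen_sum E c x).

(* Main.v *)
(** Write f for the restriction of the eigenfunction to the curve, a sum of waves
    cos (2 pi xi.gamma + phase) over the N lattice points xi on the circle |xi|^2 = E.

    Key estimate: on every curved arc J the integral of f^2 is at least a constant times the sum of
    |c_xi|^2, once E is large.  Expanding the square, a pair xi <> eta contributes an oscillatory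
    integral of frequency xi - eta.  These decay like |xi - eta|^(-1/3), and N = O(E^eps), so the pairs
    with |xi - eta| >= E^(1/6) are harmless; Jarnik's determinant argument shows that every xi has at
    most one closer neighbour, and for that one it suffices that the oscillatory integral is smaller than
    |J| by a fixed factor.

    Upper bound: around each point f is a power series with coefficients O(exp (C sqrt E) r^(-k)).
    Dividing out n zeros makes f as small as exp (C sqrt E) 2^(-n) on an interval of fixed length,
    which contradicts the key estimate on a curved arc inside this interval unless n = O(sqrt E).  Such
    an arc exists in every interval: otherwise the curve would be straight somewhere, hence everywhere
    by analyticity.

    Lower bound: cut J into about E^(1/2 - 3 d) pieces.  On a piece without zeros the integral of f^2 is
    at most sup |f| times the modulus of the integral of f, and the sum of these moduli over all pieces
    is O(E^(-d)) sup |f| since each wave oscillates with frequency sqrt E away from its stationary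
    point.  Hence the pieces containing a zero must account for the key estimate.

    For N = O(E^eps): two primitive representations z, z' of n with
    gcd (n, det (z, z0)) = gcd (n, det (z', z0)) satisfy n | det (z, z'), which forces z' = i^k z; thus
    N is at most 4 times the square of the number of divisors of E. *)

From Stdlib Require Import Reals List Lra.
From mathcomp Require all_boot.
Open Scope R_scope.

(** The coefficients are arbitrary, so all the mass may sit on two frequencies at bounded distance,
    whose interaction integral does not shrink as E grows. It is separated from the diagonal value
    |J| by strictness in the triangle inequality, one difference vector at a time; decay leaves only
    finitely many vectors to treat in this way, so one factor below 1 serves for all.

    Sup norms meet the mean square through the l^1 norm of the coefficients, at the price of a
    factor N. The upper bound absorbs any power of E in exp (C sqrt E), but the lower bound needs N
    below every power of E, whence the divisor bound.

    The counting of zeros stays on the real line: Taylor coefficients of cos and sin of a power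
    series, bounded through their differential equation, stand in for a holomorphic extension and
    Jensen's formula.

    The threshold E_Sigma has to be fixed before eps. The lower bound at eps = 1/2 already gives one
    zero beyond a fixed threshold, and this single zero covers the finitely many E below the
    threshold that goes with a given eps, once c_eps is small. *)

(* Coquelicot declares its own canonical eqType on nat, so this module precedes its import. *)
Module DivisorBound.
Import all_boot.
Delimit Scope R_scope with Re.
Local Open Scope nat_scope.

(** * The divisor bound d(n) = O(n^delta) *)

Lemma size_divisors_mul (m n : nat) : 0 < m -> 0 < n ->
  size (divisors (m * n)) <= size (divisors m) * size (divisors n).
Proof.
move=> m0 n0; rewrite -(size_allpairs muln).
apply: uniq_leq_size; first exact: divisors_uniq.
move=> d; rewrite -dvdn_divisors ?muln_gt0 ?m0 // => dmn.
have [g0 gd] : 0 < gcdn d m /\ gcdn d m %| d by rewrite gcdn_gt0 m0 orbT dvdn_gcdl.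
(* A divisor d of m n splits into gcd(d, m), which divides m, and its cofactor, which is coprime to
   m / gcd(d, m) and hence divides n by Gauss. *)
apply/allpairsP; exists (gcdn d m, d %/ gcdn d m) => /=; split.
- by rewrite -dvdn_divisors // dvdn_gcdr.
- rewrite -dvdn_divisors // -(@Gauss_dvdr _ (m %/ gcdn d m)).
    rewrite -(@dvdn_pmul2l (gcdn d m)) // [gcdn d m * (d %/ _)]mulnC divnK //.
    by rewrite mulnA [gcdn d m * _]mulnC divnK ?dvdn_gcdr.
  by rewrite /coprime -(eqn_pmul2l g0) muln_gcdr ![gcdn d m * (_ %/ _)]mulnC !divnK ?dvdn_gcdr // muln1.
- by rewrite mulnC divnK.
Qed.

Lemma size_divisors_pow (p k : nat) : prime p -> size (divisors (p ^ k)) <= k.+1.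
Proof.
move=> pp; rewrite -[k.+1](size_iota 0) -(size_map (fun i => p ^ i) (iota 0 _)).
apply: uniq_leq_size; first exact: divisors_uniq.
move=> d; rewrite -dvdn_divisors ?expn_gt0 ?prime_gt0 // => /(dvdn_pfactor _ _ pp) [i ik ->].
by apply/mapP; exists i; rewrite // mem_iota add0n ltnS.
Qed.

Lemma coprime_decomposition (p n : nat) : prime p -> 0 < n ->
  exists k m, [/\ n = m * p ^ k, 0 < m & ~~ (p %| m)].
Proof.
move=> pp n0; have [m cpm nE] := pfactor_coprime pp n0.
exists (logn p n), m; split=> //; last by rewrite -prime_coprime.
by move: n0; rewrite {1}nE muln_gt0 => /andP[].
Qed.

Section Bound.
Variables (delta : R) (P : nat) (K : R).
Hypothesis delta0 : (0 < delta)%Re.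
Hypothesis large : forall p, P <= p -> (2 <= Rpower (INR p) delta)%Re.
Hypothesis K1 : (1 <= K)%Re.
Hypothesis small : forall p k, 2 <= p -> (INR k.+1 <= K * Rpower (INR (p ^ k)) delta)%Re.

(** Removing one prime factor p at most halves the number of divisors, and divides n^delta by
    p^delta >= 2; large primes therefore cost no constant. *)
Lemma divisor_bound_rough (n : nat) : 0 < n ->
  (forall p, prime p -> p %| n -> P <= p) ->
  (INR (size (divisors n)) <= Rpower (INR n) delta)%Re.
Proof.
elim/ltn_ind: n => n IH n0 Hn.
case: (leqP n 1) => n1.
  have -> : n = 1 by apply/eqP; rewrite eqn_leq n1 n0.
  rewrite /= /Rpower ln_1 Rmult_0_r exp_0; exact: Rle_refl.
have pp := pdiv_prime n1; have pn := pdiv_dvd n.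
set p := pdiv n in pp pn; set m := n %/ p.
have nE : n = p * m by rewrite mulnC divnK.
have m0 : 0 < m by move: n0; rewrite nE muln_gt0 => /andP[].
have mn : m < n by rewrite nE ltn_Pmull // prime_gt1.
have Hm := IH m mn m0 (fun q pq qm => Hn q pq (dvdn_trans qm (dvdn_div pn))).
have Hp := large p (Hn p pp pn).
have dp : size (divisors p) <= 2 by have := size_divisors_pow p 1 pp; rewrite expn1.
have d1 : size (divisors n) <= 2 * size (divisors m).
  by rewrite {1}nE; apply: leq_trans (size_divisors_mul _ _ (prime_gt0 pp) m0) _; rewrite leq_mul2r dp orbT.
apply: Rle_trans (le_INR _ _ (leP d1)) _.
rewrite nE -multE !mult_INR -Rpower_mult_distr; try by apply: lt_0_INR; apply/ltP; first [exact: m0 | exact: prime_gt0].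
exact: (Rmult_le_compat (INR 2) _ _ _ (pos_INR 2) (pos_INR _) Hp Hm).
Qed.

(** The primes below P are stripped one at a time. Each costs one factor K whatever its exponent k,
    because k + 1 <= K p^(k delta). At j = P the condition on prime divisors becomes empty. *)
Lemma divisor_bound_step (j n : nat) : j <= P -> 0 < n ->
  (forall p, prime p -> p %| n -> P - j <= p) ->
  (INR (size (divisors n)) <= K ^ j * Rpower (INR n) delta)%Re.
Proof.
elim: j n => [|j IH] n jP n0 Hn.
  by rewrite pow_O Rmult_1_l; apply: divisor_bound_rough => // p pp pn; have := Hn p pp pn; rewrite subn0.
set q := P - j.+1 in Hn.
have qS : P - j = q.+1 by rewrite /q -subSn.
have Rp0 x : (0 < Rpower x delta)%Re by apply: exp_pos.
have Kj : (1 <= K ^ j)%Re by apply: pow_R1_Rle.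
case: (boolP (prime q && (q %| n))) => [/andP [pq qn]|Hq].
  have [k [m [nE m0 qm]]] := coprime_decomposition q n pq n0.
  have Hm : (INR (size (divisors m)) <= K ^ j * Rpower (INR m) delta)%Re.
    apply: IH => //; first exact: ltnW.
    move=> p pp pm; rewrite qS ltn_neqAle; apply/andP; split.
      by apply: contra qm => /eqP ->.
    by apply: Hn => //; rewrite nE dvdn_mulr.
  have d1 : size (divisors n) <= size (divisors m) * k.+1.
    rewrite {1}nE; apply: leq_trans (size_divisors_mul _ _ m0 _) _; first by rewrite expn_gt0 prime_gt0.
    by rewrite leq_mul2l size_divisors_pow ?orbT.
  apply: Rle_trans (le_INR _ _ (leP d1)) _.
  rewrite nE -multE !mult_INR -Rpower_mult_distr; try by apply: lt_0_INR; apply/ltP; first [exact: m0 | rewrite expn_gt0 prime_gt0].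
  have := small q k (prime_gt1 pq) => Hk.
  apply: Rle_trans (Rmult_le_compat _ _ _ _ (pos_INR _) (pos_INR _) Hm Hk) _.
  by rewrite -tech_pow_Rmult; apply: Req_le; ring.
apply: (Rle_trans _ (K ^ j * Rpower (INR n) delta)).
  apply: IH => //; first exact: ltnW.
  move=> p pp pn; rewrite qS ltn_neqAle (Hn p pp pn) andbT.
  by apply: contra Hq => /eqP ->; rewrite pp pn.
have KR : (0 <= K ^ j * Rpower (INR n) delta)%Re.
  by apply: Rmult_le_pos; [lra | exact: Rlt_le (Rp0 _)].
rewrite -tech_pow_Rmult Rmult_assoc -{1}[(K ^ j * _)%Re]Rmult_1_l.
exact: Rmult_le_compat_r.
Qed.
End Bound.

Lemma divisor_bound (delta : R) : (0 < delta)%Re -> exists C : R, (0 < C)%Re /\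
  forall n : nat, 0 < n -> (INR (size (divisors n)) <= C * Rpower (INR n) delta)%Re.
Proof.
move=> d0.
have l2 : (0 < ln 2)%Re by have := ln_lt_2; lra.
(* Chosen so that K (1 + k delta ln 2) >= 1 + k, while p^(k delta) >= 1 + k delta ln 2 for p >=
   2. *)
set K := (1 + / (delta * ln 2))%Re.
have dl0 : (0 < delta * ln 2)%Re by nra.
have K1 : (1 <= K)%Re by have := Rinv_0_lt_compat _ dl0; rewrite /K; lra.
have [P HP] : exists P : nat, (Rpower 2 (/ delta) <= INR P)%Re.
  by have [P HP] := INR_unbounded (Rpower 2 (/ delta)); exists P; lra.
have large p : P <= p -> (2 <= Rpower (INR p) delta)%Re.
  move=> /leP /le_INR Pp.
  have e2 : (Rpower (Rpower 2 (/ delta)) delta = 2)%Re.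
    by rewrite Rpower_mult Rinv_l ?Rpower_1; lra.
  rewrite -{1}e2; apply: Rle_Rpower_l; first lra.
  by split; [exact: exp_pos | lra].
have small p k : 2 <= p -> (INR k.+1 <= K * Rpower (INR (p ^ k)) delta)%Re.
  move=> p2.
  have p2' : (2 <= INR p)%Re by rewrite -[2%Re]/(INR 2); apply: le_INR; apply/leP.
  have -> : INR (p ^ k) = (pow (INR p) k).
    by elim: k => [|k IH] //; rewrite expnS -multE mult_INR IH.
  rewrite -Rpower_pow; last lra.
  rewrite Rpower_mult.
  have : (1 + INR k * delta * ln 2 <= Rpower (INR p) (INR k * delta))%Re.
    apply: Rle_trans (exp_ineq1_le _) _; rewrite /Rpower.
    have : (ln 2 <= ln (INR p))%Re by case: p2' => [H|<-]; [apply: Rlt_le; apply: ln_increasing; lra | exact: Rle_refl].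
    have := pos_INR k => k0 lp.
    have kd : (0 <= INR k * delta)%Re by nra.
    have : (INR k * delta * ln 2 <= INR k * delta * ln (INR p))%Re by nra.
    move=> [/exp_increasing|->]; lra.
  rewrite S_INR => H.
  have := pos_INR k => k0.
  have E : (K * (1 + INR k * delta * ln 2) = 1 + INR k * delta * ln 2 + / (delta * ln 2) + INR k)%Re.
    by rewrite /K; field; split; lra.
  have : (K * (1 + INR k * delta * ln 2) <= K * Rpower (INR p) (INR k * delta))%Re by apply: Rmult_le_compat_l; lra.
  have := Rinv_0_lt_compat _ dl0; have : (0 <= INR k * delta * ln 2)%Re by nra.
  lra.
exists (K ^ P)%Re; split; first by apply: pow_lt; lra.
by move=> n n0; apply: (divisor_bound_step delta P K) => // p _ _; rewrite subnn.
Qed.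

(** The interface to the rest of the proof, phrased with plain lists and an explicit cofactor: a
    duplicate-free list of divisors of n is no longer than [divisors n]. *)
Lemma length_divisors_bound (delta : R) : (0 < delta)%Re -> exists C : R, (0 < C)%Re /\
  forall (n : nat) (L : list nat), n <> 0 -> NoDup L ->
    (forall d, In d L -> exists k, n = k * d) ->
    (INR (length L) <= C * Rpower (INR n) delta)%Re.
Proof.
move=> d0; have [C [C0 HC]] := divisor_bound delta d0.
exists C; split=> // n L /eqP; rewrite -lt0n => n0 ndL HL.
apply: Rle_trans _ (HC n n0); apply: le_INR.
apply: NoDup_incl_length => // d /HL [k nE].
have : d \in divisors n by rewrite -dvdn_divisors // nE dvdn_mull.
elim: (divisors n) => // x s IH; rewrite inE => /orP [/eqP ->|/IH]; [by left|by right].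
Qed.

End DivisorBound.

Require Import Defs.
From Stdlib Require Import Lia Psatz ZArith Factorial FinFun Ranalysis5.
From Stdlib Require Import Classical ClassicalEpsilon.
From Coquelicot Require Import Coquelicot.

(** * Lattice points on a circle *)

Section Circle.
Local Open Scope Z_scope.

Lemma divides_one_of_divides_norm (a b n : Z) : a * a + b * b = n -> Z.gcd a b = 1 ->
  forall h, (h | n) -> (h | a) -> (h | 1).
Proof.
  intros En G h hn ha.
  assert (hb : (h | b * b)).
  { replace (b * b) with (n - a * a) by lia.
    apply Z.divide_sub_r; [exact hn|]. now apply Z.divide_mul_l. }
  assert (G1 : Z.gcd h b = 1).
  { apply Z.bezout_1_gcd. apply Z.gcd_bezout in G as [u [v Huv]].
    destruct ha as [k ->]. exists (u * k), v. lia. }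
  apply Z.gauss in hb; [|exact G1].
  rewrite <- G1. apply Z.gcd_greatest; [apply Z.divide_refl|exact hb].
Qed.

Lemma divides_right_of_coprime_left (h a b : Z) : (forall k, (k | h) -> (k | a) -> (k | 1)) ->
  (h | a * b) -> (h | b).
Proof.
  intros H D. apply (Z.gauss h a b D).
  assert (L : (Z.gcd h a | 1)) by (apply H; [apply Z.gcd_divide_l|apply Z.gcd_divide_r]).
  apply Z.divide_1_r_nonneg in L; [exact L|apply Z.gcd_nonneg].
Qed.

Lemma divide_by_coprime_pair (d a b x : Z) : Z.gcd a b = 1 -> (d | a * x) -> (d | b * x) -> (d | x).
Proof.
  intros G Ha Hb. apply Z.gcd_bezout in G as [u [v Huv]].
  replace x with (u * (a * x) + v * (b * x)).
  { apply Z.divide_add_r; now apply Z.divide_mul_r. }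
  replace (u * (a * x) + v * (b * x)) with ((u * a + v * b) * x) by ring.
  rewrite Huv. ring.
Qed.

(** On the circle, (x y0 - y x0)(x y0 + y x0) = n (x^2 - x0^2). With d the common gcd and n = e d,
    the first factor vanishes mod d and the second mod e, for both points alike. Eliminating the
    reference point modulo d and modulo e gives the determinant 0 modulo each, and d, e are
    coprime. *)
Lemma det_divides_of_gcd_eq (n x y x' y' x0 y0 : Z) : 0 < n ->
  x * x + y * y = n -> x' * x' + y' * y' = n -> x0 * x0 + y0 * y0 = n ->
  Z.gcd x y = 1 -> Z.gcd x0 y0 = 1 ->
  Z.gcd n (x * y0 - y * x0) = Z.gcd n (x' * y0 - y' * x0) ->
  (n | x * y' - y * x').
Proof.
  intros n0 E E' E0 G G0 K.
  set (d := Z.gcd n (x * y0 - y * x0)) in *.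
  assert (dn : (d | n)) by apply Z.gcd_divide_l.
  assert (d0 : 0 < d).
  { assert (0 <= d) by apply Z.gcd_nonneg. destruct (Z.eq_dec d 0) as [e|]; [|lia].
    destruct dn as [q Hq]. rewrite e in Hq. lia. }
  destruct dn as [e en].
  assert (cof : forall u v, u * u + v * v = n -> d = Z.gcd n (u * y0 - v * x0) ->
            (d | u * y0 - v * x0) /\ (e | u * y0 + v * x0)).
  { intros u v Euv Kuv.
    assert (D1 : (d | u * y0 - v * x0)) by (rewrite Kuv; apply Z.gcd_divide_r).
    split; [exact D1|]. destruct D1 as [q Hq].
    assert (ge : Z.gcd e q = 1).
    { apply (Z.mul_reg_l _ _ d); [lia|]. rewrite <- Z.gcd_mul_mono_l_nonneg by lia.
      rewrite Z.mul_1_r. rewrite (Z.mul_comm d e), (Z.mul_comm d q), <- en, <- Hq. now symmetry. }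
    apply (Z.gauss e q); [|exact ge].
    exists (u * u - x0 * x0). apply (Z.mul_reg_l _ _ d); [lia|].
    transitivity ((u * y0 - v * x0) * (u * y0 + v * x0)); [rewrite Hq; ring|].
    transitivity (u * u * (y0 * y0) - v * v * (x0 * x0)); [ring|].
    replace (y0 * y0) with (n - x0 * x0) by lia. replace (v * v) with (n - u * u) by lia.
    rewrite en. ring. }
  destruct (cof x y E eq_refl) as [Dd De].
  destruct (cof x' y' E' K) as [Dd' De'].
  assert (dd : (d | x * y' - y * x')).
  { apply (divide_by_coprime_pair d x0 y0); [exact G0| |].
    - replace (x0 * (x * y' - y * x')) with (x' * (x * y0 - y * x0) - x * (x' * y0 - y' * x0)) by ring.
      apply Z.divide_sub_r; now apply Z.divide_mul_r.
    - replace (y0 * (x * y' - y * x')) with (y' * (x * y0 - y * x0) - y * (x' * y0 - y' * x0)) by ring.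
      apply Z.divide_sub_r; now apply Z.divide_mul_r. }
  assert (de : (e | x * y' - y * x')).
  { apply (divide_by_coprime_pair e x0 y0); [exact G0| |].
    - replace (x0 * (x * y' - y * x')) with (x * (x' * y0 + y' * x0) - x' * (x * y0 + y * x0)) by ring.
      apply Z.divide_sub_r; now apply Z.divide_mul_r.
    - replace (y0 * (x * y' - y * x')) with (y' * (x * y0 + y * x0) - y * (x' * y0 + y' * x0)) by ring.
      apply Z.divide_sub_r; now apply Z.divide_mul_r. }
  (* A common divisor of e and d divides 2 x y0, hence 2, since x and y0 are coprime to n. If it
     were 2, then 4 would divide n = x^2 + y^2, impossible for coprime x, y. *)
  assert (cop : Z.gcd e d = 1).
  { set (h := Z.gcd e d).
    assert (he : (h | e)) by apply Z.gcd_divide_l.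
    assert (hd : (h | d)) by apply Z.gcd_divide_r.
    assert (hn : (h | n)) by (rewrite en; now apply Z.divide_mul_l).
    assert (h2 : (h | 2)).
    { assert (H1 : (h | x * (y0 * 2))).
      { replace (x * (y0 * 2)) with ((x * y0 - y * x0) + (x * y0 + y * x0)) by ring.
        apply Z.divide_add_r; [exact (Z.divide_trans _ _ _ hd Dd)|exact (Z.divide_trans _ _ _ he De)]. }
      apply divides_right_of_coprime_left in H1.
      2:{ intros k kh kx. apply (divides_one_of_divides_norm x y n E G); [exact (Z.divide_trans _ _ _ kh hn)|exact kx]. }
      apply divides_right_of_coprime_left in H1; [exact H1|].
      intros k kh ky. apply (divides_one_of_divides_norm y0 x0 n); [lia|now rewrite Z.gcd_comm| |exact ky].
      exact (Z.divide_trans _ _ _ kh hn). }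
    assert (h0 : 0 <= h) by apply Z.gcd_nonneg.
    assert (hle : h <= 2) by (apply Z.divide_pos_le; [lia|exact h2]).
    destruct (Z.eq_dec h 1) as [|h1]; [assumption|exfalso].
    assert (h = 2).
    { destruct (Z.eq_dec h 0) as [z|]; [|lia]. rewrite z in h2. destruct h2; lia. }
    assert (n4 : (4 | n)).
    { destruct he as [p hp], hd as [q hq]. exists (p * q). rewrite en, hp, hq, H. ring. }
    destruct n4 as [w hw].
    destruct (Z.Even_or_Odd x) as [[i Hi]|[i Hi]], (Z.Even_or_Odd y) as [[j Hj]|[j Hj]]; subst x y.
    - assert ((2 | Z.gcd (2 * i) (2 * j))).
      { apply Z.gcd_greatest; [exists i|exists j]; ring. }
      rewrite G in H0. destruct H0; lia.
    - lia.
    - lia.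
    - lia. }
  destruct dd as [q Hq]. rewrite Hq in de |- *. rewrite Z.mul_comm in de.
  apply Z.gauss in de; [|exact cop].
  destruct de as [w ->]. exists w. rewrite en. ring.
Qed.

(** By Lagrange's identity det^2 + dot^2 = n^2. A determinant k n thus forces k in {-1, 0, 1}, and
    the pair (det, dot) determines the second point as a unit multiple i^j of the first. *)
Lemma four_neighbours (n x y x' y' : Z) : 0 < n ->
  x * x + y * y = n -> x' * x' + y' * y' = n -> (n | x * y' - y * x') ->
  In (x', y') ((x, y) :: (- x, - y) :: (- y, x) :: (y, - x) :: nil).
Proof.
  intros n0 E E' [k Hk].
  assert (S : (k * n) * (k * n) + (x * x' + y * y') * (x * x' + y * y') = n * n).
  { rewrite <- Hk. rewrite <- E at 1. rewrite <- E'. ring. }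
  set (t := x * x' + y * y') in *.
  assert (Hx : n * x' = x * t - y * (k * n)) by (rewrite <- Hk; unfold t; rewrite <- E; ring).
  assert (Hy : n * y' = y * t + x * (k * n)) by (rewrite <- Hk; unfold t; rewrite <- E; ring).
  assert (Hk2 : k * k <= 1) by nia.
  assert (k = 0 \/ k = 1 \/ k = -1) as Hk3 by nia; destruct Hk3 as [ -> | [-> | ->]].
  - assert ((t - n) * (t + n) = 0) as T by lia.
    apply Z.mul_eq_0 in T as [T|T].
    + left. f_equal; apply (Z.mul_reg_l _ _ n); try lia; replace t with n in * by lia; lia.
    + right; left. f_equal; apply (Z.mul_reg_l _ _ n); try lia; replace t with (- n) in * by lia; lia.
  - assert (t = 0) by nia.
    right; right; left. f_equal; apply (Z.mul_reg_l _ _ n); try lia; rewrite H in *; lia.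
  - assert (t = 0) by nia.
    right; right; right; left. f_equal; apply (Z.mul_reg_l _ _ n); try lia; rewrite H in *; lia.
Qed.

(** Dividing all three points by their common content g reduces to primitive representations of E /
    g^2; both gcds with the determinants scale by g^2. *)
Lemma fibre_four (E g x y x' y' x0 y0 : Z) : 0 < E ->
  x * x + y * y = E -> x' * x' + y' * y' = E -> x0 * x0 + y0 * y0 = E ->
  Z.gcd x y = g -> Z.gcd x' y' = g -> Z.gcd x0 y0 = g ->
  Z.gcd E (x * y0 - y * x0) = Z.gcd E (x' * y0 - y' * x0) ->
  In (x', y') ((x, y) :: (- x, - y) :: (- y, x) :: (y, - x) :: nil).
Proof.
  intros E0 N N' N0 G G' G0 K.
  apply (four_neighbours E); try assumption.
  assert (g0 : 0 < g).
  { assert (0 <= g) by (rewrite <- G; apply Z.gcd_nonneg).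
    destruct (Z.eq_dec g 0) as [z|]; [|lia].
    rewrite z in G. apply Z.gcd_eq_0 in G as [-> ->]. lia. }
  assert (dec : forall a b, Z.gcd a b = g -> exists a1 b1, a = g * a1 /\ b = g * b1 /\ Z.gcd a1 b1 = 1).
  { intros a b Gab.
    destruct (Z.gcd_divide_l a b) as [a1 Ha], (Z.gcd_divide_r a b) as [b1 Hb].
    rewrite Gab in Ha, Hb. exists a1, b1. repeat split; try lia.
    apply (Z.mul_reg_l _ _ g); [lia|]. rewrite <- Z.gcd_mul_mono_l_nonneg by lia.
    rewrite (Z.mul_comm g a1), (Z.mul_comm g b1), <- Ha, <- Hb. lia. }
  destruct (dec _ _ G) as [a [b [-> [-> P]]]].
  destruct (dec _ _ G') as [a' [b' [-> [-> P']]]].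
  destruct (dec _ _ G0) as [c [d [-> [-> P0]]]].
  set (n := a * a + b * b).
  assert (En : E = g * g * n) by (unfold n; rewrite <- N; ring).
  assert (n0 : 0 < n) by (unfold n in *; nia).
  assert (n | a * b' - b * a') as [q Hq].
  { apply (det_divides_of_gcd_eq n a b a' b' c d); try assumption; try reflexivity.
    - apply (Z.mul_reg_l _ _ (g * g)); [nia|]. rewrite <- En, <- N'. ring.
    - apply (Z.mul_reg_l _ _ (g * g)); [nia|]. rewrite <- En, <- N0. ring.
    - apply (Z.mul_reg_l _ _ (g * g)); [nia|]. rewrite <- !Z.gcd_mul_mono_l_nonneg by nia.
      rewrite <- En.
      replace (g * g * (a * d - b * c)) with (g * a * (g * d) - g * b * (g * c)) by ring.
      replace (g * g * (a' * d - b' * c)) with (g * a' * (g * d) - g * b' * (g * c)) by ring.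
      exact K. }
  exists q. rewrite En. transitivity (g * g * (a * b' - b * a')); [ring|]. rewrite Hq. ring.
Qed.

(* The rotated vector |w|^2 u - |u|^2 w is orthogonal to the radius, so the circumradius
   formula 4 E det(u,w)^2 = |u|^2 |w|^2 |u-w|^2 holds; the determinant is a nonzero integer. *)
Lemma close_points_on_circle (E x y u1 u2 w1 w2 : Z) : 0 < E ->
  x * x + y * y = E ->
  (x + u1) * (x + u1) + (y + u2) * (y + u2) = E ->
  (x + w1) * (x + w1) + (y + w2) * (y + w2) = E ->
  0 < u1 * u1 + u2 * u2 -> 0 < w1 * w1 + w2 * w2 ->
  (u1 * u1 + u2 * u2) ^ 3 < E -> (w1 * w1 + w2 * w2) ^ 3 < E ->
  u1 = w1 /\ u2 = w2.
Proof.
  intros E0 N Nu Nw U0 W0 HU HW.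
  set (U := u1 * u1 + u2 * u2) in *. set (W := w1 * w1 + w2 * w2) in *.
  set (V := (u1 - w1) * (u1 - w1) + (u2 - w2) * (u2 - w2)).
  set (D := u1 * w2 - u2 * w1).
  assert (EU : U = - 2 * (x * u1 + y * u2)) by (unfold U; lia).
  assert (EW : W = - 2 * (x * w1 + y * w2)) by (unfold W; lia).
  assert (H1 : W * u2 - U * w2 = 2 * x * D) by (rewrite EU, EW; unfold D; ring).
  assert (H2 : W * u1 - U * w1 = - 2 * y * D) by (rewrite EU, EW; unfold D; ring).
  assert (F : 4 * E * (D * D) = U * W * V).
  { transitivity ((W * u2 - U * w2) * (W * u2 - U * w2) + (W * u1 - U * w1) * (W * u1 - U * w1)).
    - rewrite H1, H2, <- N. ring.
    - unfold V, U, W. ring. }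
  assert (Veq : V = 2 * U + 2 * W - ((u1 + w1) * (u1 + w1) + (u2 + w2) * (u2 + w2))) by (unfold V, U, W; ring).
  pose proof (Z.square_nonneg (u1 + w1)) as Q1. pose proof (Z.square_nonneg (u2 + w2)) as Q2.
  pose proof (Z.square_nonneg (u1 - w1)) as Q3. pose proof (Z.square_nonneg (u2 - w2)) as Q4.
  assert (V0 : 0 <= V) by (unfold V; lia).
  assert (Vz : V = 0 -> u1 = w1 /\ u2 = w2).
  { intros z. assert (z1 : (u1 - w1) * (u1 - w1) = 0) by (unfold V in z; lia).
    assert (z2 : (u2 - w2) * (u2 - w2) = 0) by (unfold V in z; lia).
    apply Z.mul_eq_0 in z1, z2. lia. }
  assert (Vle : V <= 2 * U + 2 * W) by lia.
  apply Vz. clear Vz Veq Q1 Q2 Q3 Q4 H1 H2 EU EW N Nu Nw. clearbody U V W D.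
  (* By the parallelogram law V <= 2 (U + W), so the product is at most 4 max(U, W)^3. This is what
     fixes the range |u| < E^(1/6). *)
  assert (U * W * V < 4 * E).
  { replace (U ^ 3) with (U * U * U) in HU by ring. replace (W ^ 3) with (W * W * W) in HW by ring.
    apply Z.le_lt_trans with (U * W * (2 * U + 2 * W)); [apply Z.mul_le_mono_nonneg_l; nia|].
    destruct (Z.le_ge_cases U W).
    - assert (U * W * (2 * U + 2 * W) <= W * W * (4 * W)) by (apply Z.mul_le_mono_nonneg; nia). lia.
    - assert (U * W * (2 * U + 2 * W) <= U * U * (4 * U)) by (apply Z.mul_le_mono_nonneg; nia). lia. }
  assert (DD : D * D < 1) by nia. pose proof (Z.square_nonneg D) as D0.
  replace (D * D) with 0 in F by lia. rewrite Z.mul_0_r in F. symmetry in F.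
  apply Z.mul_eq_0 in F as [F|F]; [|assumption]. apply Z.mul_eq_0 in F. lia.
Qed.

End Circle.

(** * Counting the lattice points by divisor-valued keys *)

Lemma length_le_fibres {A : Type} (key : A -> nat) (m : nat) (D : list nat) : forall l : list A,
  (forall x, In x l -> In (key x) D) ->
  (forall k, (length (filter (fun x => Nat.eqb (key x) k) l) <= m)%nat) ->
  (length l <= m * length D)%nat.
Proof.
  induction D as [|k D IH]; intros l HD Hm.
  - destruct l as [|x l]; [simpl; lia|]. destruct (HD x (or_introl eq_refl)).
  - rewrite <- (filter_length (fun x => Nat.eqb (key x) k) l).
    assert (length (filter (fun x => negb (Nat.eqb (key x) k)) l) <= m * length D)%nat.
    { apply IH.
      - intros x Hx. apply filter_In in Hx as [Hx Hk].
        apply Bool.negb_true_iff, Nat.eqb_neq in Hk. destruct (HD x Hx) as [e|]; [congruence|assumption].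
      - intros j. etransitivity; [|apply (Hm j)].
        generalize l. intros l'. induction l' as [|x l' IHl]; [simpl; lia|].
        cbn [filter]. destruct (Nat.eqb (key x) k); cbn [negb filter];
          destruct (Nat.eqb (key x) j); cbn [length]; lia. }
    specialize (Hm k). simpl length. lia.
Qed.

Lemma zrange_NoDup (E : nat) : NoDup (zrange E).
Proof.
  unfold zrange. apply Injective_map_NoDup; [|apply seq_NoDup].
  intros a b H. lia.
Qed.

Lemma list_prod_NoDup {A B : Type} (l : list A) (m : list B) :
  NoDup l -> NoDup m -> NoDup (list_prod l m).
Proof.
  intros Hl Hm. induction Hl as [|a l Ha Hl IH]; simpl; [constructor|].
  apply NoDup_app.
  - apply Injective_map_NoDup; [|assumption]. intros ? ? H; now inversion H.
  - exact IH.
  - intros p Hp. apply in_map_iff in Hp as [y [<- Hy]]. intros Hin. apply in_prod_iff in Hin. tauto.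
Qed.

Lemma lattice_pts_NoDup (E : nat) : NoDup (lattice_pts E).
Proof. apply NoDup_filter, list_prod_NoDup; apply zrange_NoDup. Qed.

Lemma lattice_pts_norm (E : nat) (x y : Z) : In (x, y) (lattice_pts E) ->
  (x * x + y * y = Z.of_nat E)%Z.
Proof. intros H. apply filter_In in H as [_ H]. now apply Z.eqb_eq in H. Qed.

Definition divisor_list (E : nat) : list nat :=
  filter (fun d => Nat.eqb (E mod d) 0) (seq 1 E).

Lemma divisor_list_spec (E : nat) (d : Z) : (0 < E)%nat -> (0 <= d)%Z -> (d | Z.of_nat E)%Z ->
  In (Z.to_nat d) (divisor_list E).
Proof.
  intros E0 d0 [k Hk].
  assert (d <> 0%Z) by (intros ->; lia).
  assert (k0 : (0 <= k)%Z) by nia.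
  assert (e : E = (Z.to_nat k * Z.to_nat d)%nat) by nia.
  apply filter_In. split.
  - apply in_seq. assert (Z.to_nat k <> 0)%nat by (intros z; rewrite z in e; lia). nia.
  - apply Nat.eqb_eq. rewrite e at 1. apply Nat.Div0.mod_mul.
Qed.

(** One factor counts the contents gcd(x, y), the other the values gcd(E, det) against a reference
    point of the same content. Both keys divide E, and the 4 counts the units of Z[i]. *)
Lemma length_lattice_pts_le (E : nat) : (0 < E)%nat ->
  (length (lattice_pts E) <= 4 * length (divisor_list E) * length (divisor_list E))%nat.
Proof.
  intros E0.
  apply (length_le_fibres (fun z => Z.to_nat (Z.gcd (fst z) (snd z)))).
  { intros [x y] H. apply lattice_pts_norm in H. apply divisor_list_spec; [assumption|apply Z.gcd_nonneg|].
    rewrite <- H. simpl. apply Z.divide_add_r; apply Z.divide_mul_l; [apply Z.gcd_divide_l|apply Z.gcd_divide_r]. }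
  intros k. set (l := filter _ _).
  destruct l as [|z0 l0] eqn:El; [simpl; lia|]. rewrite <- El.
  assert (Hl : forall x y, In (x, y) l -> (x * x + y * y = Z.of_nat E)%Z /\ Z.gcd x y = Z.of_nat k).
  { intros x y H. apply filter_In in H as [H1 H2]. split; [now apply lattice_pts_norm|].
    apply Nat.eqb_eq in H2. simpl in H2. rewrite <- H2, Z2Nat.id; [reflexivity|apply Z.gcd_nonneg]. }
  assert (H0 : In z0 l) by (rewrite El; now left).
  destruct z0 as [x0 y0]. apply Hl in H0 as [N0 G0].
  apply (length_le_fibres (fun z => Z.to_nat (Z.gcd (Z.of_nat E) (fst z * y0 - snd z * x0)))).
  { intros [x y] _. apply divisor_list_spec; [assumption|apply Z.gcd_nonneg|apply Z.gcd_divide_l]. }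
  intros j. set (m := filter _ _).
  assert (ndm : NoDup m) by (apply NoDup_filter; apply NoDup_filter; apply lattice_pts_NoDup).
  assert (Hm : forall x y, In (x, y) m -> In (x, y) l /\ Z.gcd (Z.of_nat E) (x * y0 - y * x0) = Z.of_nat j).
  { intros x y H. apply filter_In in H as [H1 H2]. split; [assumption|].
    apply Nat.eqb_eq in H2. simpl in H2. rewrite <- H2, Z2Nat.id; [reflexivity|apply Z.gcd_nonneg]. }
  destruct m as [|[x y] m0] eqn:Em; [simpl; lia|]. rewrite <- Em in *.
  assert (Hxy : In (x, y) m) by (rewrite Em; now left).
  apply Hm in Hxy as [Hxy K]. apply Hl in Hxy as [N G].
  change 4%nat with (length ((x, y) :: (- x, - y) :: (- y, x) :: (y, - x) :: nil)%Z).
  apply NoDup_incl_length; [assumption|].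
  intros [x' y'] H'. apply Hm in H' as [H' K']. apply Hl in H' as [N' G'].
  apply (fibre_four (Z.of_nat E) (Z.of_nat k) x y x' y' x0 y0); try assumption; [lia|congruence].
Qed.

Lemma lattice_pts_bound (delta : R) : 0 < delta -> exists C : R, 0 < C /\
  forall E : nat, (0 < E)%nat -> INR (length (lattice_pts E)) <= C * Rpower (INR E) delta.
Proof.
  intros d0. destruct (DivisorBound.length_divisors_bound (delta / 2)) as [C [C0 HC]]; [lra|].
  exists (4 * (C * C)). split; [nra|]. intros E E0.
  assert (H : INR (length (divisor_list E)) <= C * Rpower (INR E) (delta / 2)).
  { apply HC; [lia|apply NoDup_filter; apply seq_NoDup|].
    intros d Hd. apply filter_In in Hd as [Hd1 Hd2]. apply Nat.eqb_eq in Hd2.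
    exists (E / d)%nat. apply in_seq in Hd1. pose proof (Nat.div_mod_eq E d). rewrite Hd2 in H.
    rewrite Nat.mul_comm. change (E = (d * (E / d))%nat). lia. }
  apply Rle_trans with (1 := le_INR _ _ (length_lattice_pts_le E E0)).
  rewrite !mult_INR. replace delta with (delta / 2 + delta / 2) at 1 by field. rewrite Rpower_plus.
  set (r := Rpower (INR E) (delta / 2)) in *. set (L := INR (length (divisor_list E))) in *.
  assert (0 <= L) by apply pos_INR. simpl INR. nra.
Qed.

(** * Zeros of power series *)

Lemma geometric_bound_cv (a : nat -> R) (A r h : R) : 0 < r -> Rabs h < r ->
  (forall k, Rabs (a k) <= A / r ^ k) -> Rbar_lt (Finite (Rabs h)) (CV_radius a).
Proof.
  intros r0 hr Ha.
  apply Rbar_lt_le_trans with (Finite ((Rabs h + r) / 2)); [simpl; lra|].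
  assert (q0 : 0 <= (Rabs h + r) / 2 / r < 1).
  { split.
    - apply Rmult_le_pos; [pose proof (Rabs_pos h); lra|left; now apply Rinv_0_lt_compat].
    - apply (Rmult_lt_reg_r r); [lra|]. unfold Rdiv at 1. rewrite Rmult_assoc, Rinv_l; lra. }
  apply CV_radius_bounded. exists (Rabs A). intros n.
  rewrite Rabs_mult. rewrite <- RPow_abs.
  apply Rle_trans with (A / r ^ n * Rabs ((Rabs h + r) / 2) ^ n).
  { apply Rmult_le_compat_r; [apply pow_le, Rabs_pos|apply Ha]. }
  rewrite (Rabs_pos_eq ((Rabs h + r) / 2)); [|pose proof (Rabs_pos h); lra].
  replace (A / r ^ n * ((Rabs h + r) / 2) ^ n) with (A * ((Rabs h + r) / 2 / r) ^ n).
  2:{ generalize ((Rabs h + r) / 2). intros x. unfold Rdiv. rewrite Rpow_mult_distr, pow_inv. ring. }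
  apply Rle_trans with (Rabs A * ((Rabs h + r) / 2 / r) ^ n).
  { apply Rmult_le_compat_r; [apply pow_le; lra|apply Rle_abs]. }
  rewrite <- (Rmult_1_r (Rabs A)) at 2. apply Rmult_le_compat_l; [apply Rabs_pos|].
  rewrite <- (pow1 n). apply pow_incr. lra.
Qed.

Lemma geometric_bound_PSeries (a : nat -> R) (A r rho h : R) : 0 < rho < r -> Rabs h <= rho ->
  (forall k, Rabs (a k) <= A / r ^ k) -> Rabs (PSeries a h) <= A * r / (r - rho).
Proof.
  intros [p0 pr] hp Ha.
  assert (q : 0 <= rho / r < 1).
  { split.
    - apply Rmult_le_pos; [lra|left; apply Rinv_0_lt_compat; lra].
    - apply (Rmult_lt_reg_r r); [lra|]. unfold Rdiv. rewrite Rmult_assoc, Rinv_l; lra. }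
  assert (A0 : 0 <= A). { specialize (Ha 0%nat). rewrite pow_O, Rdiv_1_r in Ha. pose proof (Rabs_pos (a 0%nat)); lra. }
  assert (B : forall n, 0 <= Rabs (a n * h ^ n) <= A * (rho / r) ^ n).
  { intros n. split; [apply Rabs_pos|]. rewrite Rabs_mult, <- RPow_abs.
    replace (A * (rho / r) ^ n) with (A / r ^ n * rho ^ n).
    2:{ unfold Rdiv. rewrite Rpow_mult_distr, pow_inv. ring. }
    apply Rmult_le_compat; [apply Rabs_pos|apply pow_le, Rabs_pos|apply Ha|].
    apply pow_incr. split; [apply Rabs_pos|assumption]. }
  assert (G : is_series (fun n => A * (rho / r) ^ n) (A * / (1 - rho / r))).
  { apply (is_series_scal A (fun n => (rho / r) ^ n)). apply is_series_geom. rewrite Rabs_pos_eq; lra. }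
  assert (S : ex_series (fun n => Rabs (a n * h ^ n))).
  { apply (@ex_series_le R_AbsRing R_CompleteNormedModule) with (b := fun n => A * (rho / r) ^ n); [|eexists; exact G].
    intros n. change (Rabs (Rabs (a n * h ^ n)) <= A * (rho / r) ^ n). rewrite Rabs_Rabsolu. apply B. }
  unfold PSeries. eapply Rle_trans; [apply Series_Rabs; exact S|].
  eapply Rle_trans; [apply Series_le with (1 := B); eexists; exact G|].
  rewrite (is_series_unique _ _ G). right. field. lra.
Qed.

Lemma geometric_bound_ex (a : nat -> R) (A r h : R) : 0 < r -> Rabs h < r ->
  (forall k, Rabs (a k) <= A / r ^ k) -> ex_pseries a h.
Proof.
  intros r0 hr Ha. apply CV_disk_correct. apply CV_disk_inside. eapply geometric_bound_cv; eassumption.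
Qed.

(** The quotient has coefficients b_j = sum_i a_(j+1+i) z^i, which satisfy b_j = a_(j+1) + z
    b_(j+1). The bound keeps the radius r and loses only the factor 1 / (r - rho), so that the
    division can be repeated without shrinking the disc. *)
Lemma PSeries_divided_difference (a : nat -> R) (A r rho z : R) : 0 < rho < r -> Rabs z <= rho ->
  (forall k, Rabs (a k) <= A / r ^ k) ->
  exists b : nat -> R, (forall k, Rabs (b k) <= A / (r - rho) / r ^ k) /\
    forall h, Rabs h <= rho -> PSeries a h - PSeries a z = (h - z) * PSeries b h.
Proof.
  intros pr hz Ha.
  set (b := fun j => PSeries (fun i => a (S j + i)%nat) z).
  assert (Hs : forall j k, Rabs (a (j + k)%nat) <= A / r ^ j / r ^ k).
  { intros j k. unfold Rdiv. rewrite Rmult_assoc, <- Rinv_mult, <- pow_add. apply Ha. }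
  assert (Hb : forall k, Rabs (b k) <= A / (r - rho) / r ^ k).
  { intros k. unfold b. eapply Rle_trans; [apply geometric_bound_PSeries with (1 := pr) (2 := hz) (3 := Hs (S k))|].
    right. simpl. field. repeat split; try lra. apply pow_nonzero; lra. }
  exists b. split; [exact Hb|]. intros h hh.
  assert (Rz : forall j, b j = a (S j) + z * b (S j)).
  { intros j. unfold b at 1. rewrite PSeries_decr_1.
    2:{ eapply geometric_bound_ex with (r := r); [lra|lra|apply (Hs (S j))]. }
    rewrite Nat.add_0_r. unfold b. do 2 f_equal. apply PSeries_ext. intros n. unfold PS_decr_1.
    f_equal. lia. }
  assert (Ea : PSeries a z = a 0%nat + z * b 0%nat).
  { rewrite PSeries_decr_1; [reflexivity|]. eapply geometric_bound_ex with (r := r); [lra|lra|exact Ha]. }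
  assert (Fa : PSeries a h = a 0%nat + h * PSeries (PS_decr_1 a) h).
  { apply PSeries_decr_1. eapply geometric_bound_ex with (r := r); [lra|lra|exact Ha]. }
  assert (Fb : PSeries b h = b 0%nat + h * PSeries (PS_decr_1 b) h).
  { apply PSeries_decr_1. eapply geometric_bound_ex with (r := r); [lra|lra|exact Hb]. }
  assert (Z : PSeries b h = PSeries (PS_decr_1 a) h + z * PSeries (PS_decr_1 b) h).
  { rewrite <- PSeries_scal, <- PSeries_plus.
    - apply PSeries_ext. intros n. apply Rz.
    - eapply geometric_bound_ex with (r := r) (A := A / r ^ 1); [lra|lra|intros k; apply (Hs 1%nat k)].
    - apply ex_pseries_scal; [apply Rmult_comm|].
      eapply geometric_bound_ex with (r := r) (A := A / (r - rho) / r ^ 1); [lra|lra|].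
      intros k. unfold PS_decr_1. eapply Rle_trans; [apply Hb|]. right. simpl. field. repeat split; try lra. apply pow_nonzero; lra. }
  rewrite Ea, Fa. replace ((h - z) * PSeries b h) with (h * PSeries b h - z * PSeries b h) by ring.
  rewrite Z at 1. rewrite Fb. ring.
Qed.

(** Each zero divided out costs 1 / (r - rho) in the coefficient bound and returns a factor |h - z|
    <= 2 rho in the value. The ratio is 1/2 when rho = r / 5, the choice made in the
    applications. *)
Lemma PSeries_many_zeros (r rho : R) : 0 < rho < r -> forall (zs : list R) (a : nat -> R) (A : R),
  (forall k, Rabs (a k) <= A / r ^ k) -> NoDup zs ->
  (forall z, In z zs -> Rabs z <= rho /\ PSeries a z = 0) ->
  forall h, Rabs h <= rho ->
    Rabs (PSeries a h) <= A * r / (r - rho) * (2 * rho / (r - rho)) ^ length zs.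
Proof.
  intros pr zs. induction zs as [|z zs IH]; intros a A Ha nd Hz h hh.
  - simpl. rewrite Rmult_1_r. apply geometric_bound_PSeries; assumption.
  - destruct (Hz z (or_introl eq_refl)) as [z1 z2].
    destruct (PSeries_divided_difference a A r rho z pr z1 Ha) as [b [Hb Fb]].
    inversion nd as [|? ? nz nd']; subst.
    assert (IHb : Rabs (PSeries b h) <= A / (r - rho) * r / (r - rho) * (2 * rho / (r - rho)) ^ length zs).
    { apply IH; try assumption. intros w Hw. destruct (Hz w (or_intror Hw)) as [w1 w2].
      split; [assumption|]. specialize (Fb w w1). rewrite w2, z2 in Fb.
      destruct (Rmult_integral (w - z) (PSeries b w)) as [e|e]; [lra| |assumption].
      exfalso. apply nz. replace z with w by lra. assumption. }
    specialize (Fb h hh). rewrite z2, Rminus_0_r in Fb. rewrite Fb, Rabs_mult.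
    apply Rle_trans with (2 * rho * (A / (r - rho) * r / (r - rho) * (2 * rho / (r - rho)) ^ length zs)).
    + apply Rmult_le_compat; try apply Rabs_pos; [|assumption].
      eapply Rle_trans; [apply Rabs_triang|]. rewrite Rabs_Ropp. lra.
    + right. simpl. field. lra.
Qed.

(* Taylor coefficients of (cos P, sin P) for a power series P with coefficients p, solving
   the differential equation C' = - P' S, S' = P' C. *)
Fixpoint trig_prefix (p : nat -> R) (n : nat) : nat -> R * R :=
  match n with
  | O => fun _ => (cos (p O), sin (p O))
  | S m => fun i => if Nat.leb i m then trig_prefix p m i else
      (- PS_mult (PS_derive p) (fun j => snd (trig_prefix p m j)) m / INR (S m),
       PS_mult (PS_derive p) (fun j => fst (trig_prefix p m j)) m / INR (S m))
  end.

Definition cos_coef (p : nat -> R) (k : nat) : R := fst (trig_prefix p k k).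
Definition sin_coef (p : nat -> R) (k : nat) : R := snd (trig_prefix p k k).

Lemma trig_prefix_diag (p : nat -> R) (n i : nat) : (i <= n)%nat -> trig_prefix p n i = trig_prefix p i i.
Proof.
  induction n as [|n IH]; intros H.
  - now replace i with O by lia.
  - destruct (Nat.eq_dec i (S n)) as [->|d]; [reflexivity|].
    cbn [trig_prefix]. rewrite (proj2 (Nat.leb_le i n)) by lia. apply IH. lia.
Qed.

Lemma trig_coef_step (p : nat -> R) (n : nat) :
  cos_coef p (S n) = - PS_mult (PS_derive p) (sin_coef p) n / INR (S n) /\
  sin_coef p (S n) = PS_mult (PS_derive p) (cos_coef p) n / INR (S n).
Proof.
  unfold cos_coef at 1, sin_coef at 2. cbn [trig_prefix].
  replace (Nat.leb (S n) n) with false by (symmetry; apply Nat.leb_gt; lia).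
  cbn [fst snd]. unfold PS_mult.
  split; [do 2 f_equal|f_equal]; apply sum_eq; intros i Hi; unfold sin_coef, cos_coef;
    rewrite (trig_prefix_diag p n (n - i)); auto; lia.
Qed.

Definition exp_taylor (x : R) (n : nat) : R := sum_f_R0 (fun j => x ^ j / INR (fact j)) n.

Lemma exp_taylor_pos (x : R) (n : nat) : 0 <= x -> 1 <= exp_taylor x n.
Proof.
  intros x0. induction n as [|n IH]; unfold exp_taylor in *; simpl sum_f_R0; [simpl; lra|].
  assert (0 <= x ^ S n / INR (fact (S n))); [|unfold exp_taylor in *; simpl in *; lra].
  apply Rmult_le_pos; [now apply pow_le|left; apply Rinv_0_lt_compat, INR_fact_lt_0].
Qed.

Lemma exp_taylor_mono (x : R) (i n : nat) : 0 <= x -> (i <= n)%nat -> exp_taylor x i <= exp_taylor x n.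
Proof.
  intros x0. induction 1 as [|n _ IH]; [lra|].
  unfold exp_taylor in *. rewrite tech5. assert (0 <= x ^ S n / INR (fact (S n))); [|lra].
  apply Rmult_le_pos; [now apply pow_le|left; apply Rinv_0_lt_compat, INR_fact_lt_0].
Qed.

Lemma exp_taylor_step (x : R) (n : nat) : 0 <= x -> x * exp_taylor x n / INR (S n) <= exp_taylor x (S n).
Proof.
  intros x0. unfold exp_taylor at 2. rewrite decomp_sum by lia. simpl pred.
  assert (x * exp_taylor x n / INR (S n) <= sum_f_R0 (fun i => x ^ S i / INR (fact (S i))) n).
  { unfold exp_taylor. unfold Rdiv at 1. rewrite (Rmult_comm x), Rmult_assoc, Rmult_comm, scal_sum.
    apply sum_Rle. intros j Hj. rewrite fact_simpl, mult_INR.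
    replace (x ^ j / INR (fact j) * (x * / INR (S n))) with (x ^ S j / INR (fact j) * / INR (S n))
      by (simpl; unfold Rdiv; ring).
    replace (x ^ S j / (INR (S j) * INR (fact j))) with (x ^ S j / INR (fact j) * / INR (S j)).
    2:{ field. split; [apply INR_fact_neq_0|apply not_0_INR; lia]. }
    apply Rmult_le_compat_l.
    - apply Rmult_le_pos; [now apply pow_le|left; apply Rinv_0_lt_compat, INR_fact_lt_0].
    - apply Rinv_le_contravar; [apply lt_0_INR; lia|apply le_INR; lia]. }
  simpl in *. lra.
Qed.

Lemma half_powers_sum (n : nat) : sum_f_R0 (fun j => (/ 2) ^ j) n <= 2.
Proof.
  rewrite tech3 by lra. assert (0 < (/ 2) ^ S n) by (apply pow_lt; lra). lra.
Qed.

(** The majorant is the exponential series truncated at degree k, because x T_n / (n + 1) <= T_(n+1)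
    matches the recurrence for the coefficients exactly. Halving the radius bounds the convolution
    by the geometric sum of the 2^(-j). *)
Lemma trig_coef_bound (p : nat -> R) (Q r : R) : 0 <= Q -> 0 < r ->
  (forall k, Rabs (PS_derive p k) <= Q / r ^ k) ->
  forall k, Rabs (cos_coef p k) <= exp_taylor (Q * r) k / (r / 2) ^ k /\
            Rabs (sin_coef p k) <= exp_taylor (Q * r) k / (r / 2) ^ k.
Proof.
  intros Q0 R0 HD. set (T := exp_taylor (Q * r)).
  assert (x0 : 0 <= Q * r) by nra.
  assert (conv : forall b n, (forall i, (i <= n)%nat -> Rabs (b i) <= T i / (r / 2) ^ i) ->
    Rabs (PS_mult (PS_derive p) b n / INR (S n)) <= T (S n) / (r / 2) ^ S n).
  { intros b n Hb.
    assert (N0 : 0 < INR (S n)) by (apply lt_0_INR; lia).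
    assert (P0 : 0 < (r / 2) ^ n) by (apply pow_lt; lra).
    apply Rle_trans with (2 * Q * T n / (r / 2) ^ n / INR (S n)).
    - unfold Rdiv at 1 4. rewrite Rabs_mult, (Rabs_pos_eq (/ _)) by (left; now apply Rinv_0_lt_compat).
      apply Rmult_le_compat_r; [left; now apply Rinv_0_lt_compat|].
      unfold PS_mult. eapply Rle_trans; [apply sum_f_R0_triangle|].
      apply Rle_trans with (sum_f_R0 (fun j => (/ 2) ^ j * (Q * T n / (r / 2) ^ n)) n).
      + apply sum_Rle. intros j Hj. rewrite Rabs_mult.
        apply Rle_trans with (Q / r ^ j * (T n / (r / 2) ^ (n - j))).
        * apply Rmult_le_compat; try apply Rabs_pos; [apply HD|].
          eapply Rle_trans; [apply Hb; lia|].
          apply Rmult_le_compat_r; [left; apply Rinv_0_lt_compat, pow_lt; lra|].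
          apply exp_taylor_mono; [assumption|lia].
        * right. replace ((r / 2) ^ n) with ((r / 2) ^ j * (r / 2) ^ (n - j)).
          2:{ rewrite <- pow_add. f_equal. lia. }
          replace (r ^ j) with (2 ^ j * (r / 2) ^ j).
          2:{ rewrite <- Rpow_mult_distr. f_equal. field. }
          rewrite pow_inv. field. repeat split; try (apply pow_nonzero; lra).
      + rewrite <- scal_sum.
        apply Rle_trans with (Q * T n / (r / 2) ^ n * 2); [|right; unfold Rdiv; ring].
        apply Rmult_le_compat_l; [|apply half_powers_sum].
        apply Rmult_le_pos; [|left; now apply Rinv_0_lt_compat].
        apply Rmult_le_pos; [assumption|]. pose proof (exp_taylor_pos _ n x0). unfold T. lra.
    - pose proof (exp_taylor_step _ n x0) as Hs. fold T in Hs.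
      replace (2 * Q * T n / (r / 2) ^ n / INR (S n)) with ((Q * r) * T n / INR (S n) / (r / 2) ^ S n).
      2:{ simpl pow. field. repeat split; try lra. }
      apply Rmult_le_compat_r; [|assumption]. left. apply Rinv_0_lt_compat, pow_lt. lra. }
  intros k. induction k as [k IH] using (well_founded_induction PeanoNat.Nat.lt_wf_0).
  destruct k as [|k].
  - unfold cos_coef, sin_coef, T, exp_taylor. simpl.
    pose proof (COS_bound (p 0%nat)). pose proof (SIN_bound (p 0%nat)).
    split; apply Rabs_le; lra.
  - destruct (trig_coef_step p k) as [-> ->]. split.
    + replace (- PS_mult (PS_derive p) (sin_coef p) k / INR (S k))
        with (- (PS_mult (PS_derive p) (sin_coef p) k / INR (S k))) by (unfold Rdiv; ring).
      rewrite Rabs_Ropp. apply conv. intros i Hi. apply IH. lia.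
    + apply conv. intros i Hi. apply IH. lia.
Qed.

Lemma derive_zero_const (F : R -> R) (r : R) :
  (forall h, Rabs h < r -> is_derive F h 0) -> forall h, Rabs h < r -> F h = F 0.
Proof.
  intros H h hr.
  destruct (MVT_gen F 0 h (fun _ => 0)) as [c [_ Hc]].
  - intros x Hx. apply H. unfold Rmin, Rmax in Hx. destruct (Rle_dec 0 h); apply Rabs_def1; apply Rabs_def2 in hr; lra.
  - intros x Hx. apply continuity_pt_filterlim, (ex_derive_continuous F x). exists 0. apply H.
    unfold Rmin, Rmax in Hx. destruct (Rle_dec 0 h); apply Rabs_def1; apply Rabs_def2 in hr; lra.
  - lra.
Qed.

(** The series solve the same linear system as (cos P, sin P) with the same initial values; the sum
    of the squared differences has derivative 0, which is the uniqueness argument. For a phase of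
    frequency lam the exponent Q r is linear in lam, the source of the sqrt E in the upper bound. *)
Lemma trig_power_series (p : nat -> R) (Q r : R) : 0 <= Q -> 0 < r ->
  (forall k, Rabs (PS_derive p k) <= Q / r ^ k) ->
  exists c s : nat -> R,
    (forall k, Rabs (c k) <= exp (Q * r) / (r / 2) ^ k) /\
    (forall k, Rabs (s k) <= exp (Q * r) / (r / 2) ^ k) /\
    forall h, Rabs h < r / 2 -> cos (PSeries p h) = PSeries c h /\ sin (PSeries p h) = PSeries s h.
Proof.
  intros Q0 R0 HD.
  assert (B : forall k, Rabs (cos_coef p k) <= exp (Q * r) / (r / 2) ^ k /\
                        Rabs (sin_coef p k) <= exp (Q * r) / (r / 2) ^ k).
  { intros k.
    assert (exp_taylor (Q * r) k / (r / 2) ^ k <= exp (Q * r) / (r / 2) ^ k).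
    { apply Rmult_le_compat_r; [left; apply Rinv_0_lt_compat, pow_lt; lra|].
      apply exp_ge_taylor. nra. }
    pose proof (trig_coef_bound p Q r Q0 R0 HD k). split; lra. }
  exists (cos_coef p), (sin_coef p). split; [apply B|split; [apply B|]].
  set (c := cos_coef p) in *. set (s := sin_coef p) in *.
  assert (Rc : forall h, Rabs h < r / 2 -> Rbar_lt (Finite (Rabs h)) (CV_radius c)).
  { intros h hr. apply geometric_bound_cv with (exp (Q * r)) (r / 2); [lra|assumption|apply B]. }
  assert (Rs : forall h, Rabs h < r / 2 -> Rbar_lt (Finite (Rabs h)) (CV_radius s)).
  { intros h hr. apply geometric_bound_cv with (exp (Q * r)) (r / 2); [lra|assumption|apply B]. }
  assert (Rd : forall h, Rabs h < r / 2 -> Rbar_lt (Finite (Rabs h)) (CV_radius (PS_derive p))).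
  { intros h hr. apply geometric_bound_cv with Q r; [lra|lra|apply HD]. }
  assert (Dp : forall h, Rabs h < r / 2 -> is_derive (PSeries p) h (PSeries (PS_derive p) h)).
  { intros h hr. apply is_derive_PSeries. rewrite <- CV_radius_derive. now apply Rd. }
  assert (Dc : forall h, Rabs h < r / 2 -> is_derive (PSeries c) h (- (PSeries (PS_derive p) h * PSeries s h))).
  { intros h hr. rewrite <- PSeries_mult by auto. rewrite <- PSeries_opp.
    rewrite (PSeries_ext _ (PS_derive c)); [apply is_derive_PSeries; auto|].
    intros n. unfold PS_derive at 2. unfold c. destruct (trig_coef_step p n) as [-> _].
    fold s. unfold PS_opp. change (opp ?x) with (- x). field. apply not_0_INR; lia. }
  assert (Ds : forall h, Rabs h < r / 2 -> is_derive (PSeries s) h (PSeries (PS_derive p) h * PSeries c h)).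
  { intros h hr. rewrite <- PSeries_mult by auto.
    rewrite (PSeries_ext _ (PS_derive s)); [apply is_derive_PSeries; auto|].
    intros n. unfold PS_derive at 2. unfold s. destruct (trig_coef_step p n) as [_ ->].
    fold c. field. apply not_0_INR; lia. }
  intros h hr.
  set (F := fun h => (PSeries c h - cos (PSeries p h)) ^ 2 + (PSeries s h - sin (PSeries p h)) ^ 2).
  assert (F0 : F 0 = 0).
  { unfold F. rewrite !PSeries_0. unfold c, s, cos_coef, sin_coef. simpl. ring. }
  assert (DF : forall x, Rabs x < r / 2 -> is_derive F x 0).
  { intros x xr. unfold F. pose proof (Dp x xr) as D1. pose proof (Dc x xr) as D2. pose proof (Ds x xr) as D3.
    auto_derive.
    - repeat split; eexists; eassumption.
    - rewrite (is_derive_unique (fun y : R => PSeries p y) _ _ D1), (is_derive_unique (fun y : R => PSeries c y) _ _ D2), (is_derive_unique (fun y : R => PSeries s y) _ _ D3).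
      ring. }
  assert (Fh : F h = 0) by (rewrite (derive_zero_const F (r / 2) DF h hr); exact F0).
  unfold F in Fh.
  assert (Z : forall u v : R, u ^ 2 + v ^ 2 = 0 -> u = 0).
  { intros u v H. apply Rsqr_eq_0. unfold Rsqr. pose proof (pow2_ge_0 u). pose proof (pow2_ge_0 v).
    replace (u * u) with (u ^ 2) by ring. lra. }
  split; apply Rminus_diag_uniq_sym.
  - exact (Z _ _ Fh).
  - rewrite Rplus_comm in Fh. exact (Z _ _ Fh).
Qed.

(** * Oscillatory integrals on a curved arc *)

(** Monotonicity of G + F and G - F replaces integrating |dF| <= dG, so that no integrability of the
    derivatives has to be established. *)
Lemma abs_increment_le (F G dF dG : R -> R) (p q : R) : p <= q ->
  (forall t, p <= t <= q -> is_derive F t (dF t) /\ is_derive G t (dG t) /\ Rabs (dF t) <= dG t) ->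
  Rabs (F q - F p) <= G q - G p.
Proof.
  intros pq H.
  assert (C : forall F dF x, is_derive F x (dF x) -> continuity_pt F x).
  { intros F0 dF0 x Hx. apply continuity_pt_filterlim, (ex_derive_continuous F0 x). eexists; exact Hx. }
  assert (M : forall F dF, (forall t, p <= t <= q -> is_derive F t (dF t) /\ 0 <= dF t) -> F p <= F q).
  { intros F0 dF0 H0. destruct (MVT_gen F0 p q dF0) as [c [Hc E]].
    - intros x Hx. rewrite Rmin_left, Rmax_right in Hx by lra. apply H0. lra.
    - intros x Hx. rewrite Rmin_left, Rmax_right in Hx by lra. apply (C F0 dF0), H0. lra.
    - rewrite Rmin_left, Rmax_right in Hc by lra. destruct (H0 c Hc) as [_ P].
      assert (0 <= dF0 c * (q - p)) by (apply Rmult_le_pos; lra). lra. }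
  apply Rabs_le. split.
  - assert (G p + F p <= G q + F q); [|lra].
    apply (M (fun t => G t + F t) (fun t => dG t + dF t)). intros t Ht. destruct (H t Ht) as [H1 [H2 H3]].
    split; [apply (is_derive_plus G F t (dG t) (dF t)); assumption|]. apply Rabs_le_between in H3. lra.
  - assert (G p - F p <= G q - F q); [|lra].
    apply (M (fun t => G t - F t) (fun t => dG t - dF t)). intros t Ht. destruct (H t Ht) as [H1 [H2 H3]].
    split; [apply (is_derive_minus G F t (dG t) (dF t)); assumption|]. apply Rabs_le_between in H3. lra.
Qed.

(* [s] is the slope of the arc, so monotonicity of [s] is non-vanishing of the curvature. *)
Definition curved_graph (l u : R) (g1 g2 : R -> R) : Prop :=
  exists (p s dp ds : R -> R) (mu K kap sg : R), 0 < mu /\ 0 < kap /\ (sg = 1 \/ sg = -1) /\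
    forall t, l < t < u ->
      is_derive g1 t (p t) /\ is_derive g2 t (p t * s t) /\
      is_derive p t (dp t) /\ is_derive s t (ds t) /\
      mu <= Rabs (p t) <= K /\ Rabs (dp t) <= K /\ Rabs (s t) <= K /\ Rabs (ds t) <= K /\
      kap <= sg * ds t.

Definition phase (g1 g2 : R -> R) (v1 v2 t : R) : R := 2 * PI * (g1 t * v1 + g2 t * v2).

(** The shift [th] covers the cosine (0) and the sine (-PI/2) at once, so that each oscillation
    estimate is proved only once. *)
Definition wave (g1 g2 : R -> R) (v1 v2 th t : R) : R := cos (phase g1 g2 v1 v2 t + th).

Lemma sin_wave (g1 g2 : R -> R) (v1 v2 t : R) :
  wave g1 g2 v1 v2 (- (PI / 2)) t = sin (phase g1 g2 v1 v2 t).
Proof.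
  unfold wave. rewrite <- (cos_shift (phase g1 g2 v1 v2 t)), <- (cos_neg (PI / 2 - _)). f_equal. ring.
Qed.

Lemma cos_wave (g1 g2 : R -> R) (v1 v2 t : R) : wave g1 g2 v1 v2 0 t = cos (phase g1 g2 v1 v2 t).
Proof. unfold wave. now rewrite Rplus_0_r. Qed.

Lemma wave_continuous (g1 g2 : R -> R) (v1 v2 th t : R) : continuous g1 t -> continuous g2 t ->
  continuous (wave g1 g2 v1 v2 th) t.
Proof.
  intros C1 C2. unfold wave.
  apply (continuous_comp (fun t => phase g1 g2 v1 v2 t + th) cos); [|apply continuous_cos].
  apply (continuous_plus (phase g1 g2 v1 v2) (fun _ => th)); [|apply continuous_const].
  unfold phase. apply (continuous_scal_r (2 * PI) (fun t => g1 t * v1 + g2 t * v2)).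
  apply (continuous_plus (fun t => g1 t * v1) (fun t => g2 t * v2)).
  - apply (continuous_mult g1 (fun _ => v1)); [assumption|apply continuous_const].
  - apply (continuous_mult g2 (fun _ => v2)); [assumption|apply continuous_const].
Qed.

Lemma RInt_derive_at (f : R -> R) (l u p t : R) : l < p < u -> l < t < u ->
  (forall x, l < x < u -> continuous f x) -> is_derive (fun y => RInt f p y) t (f t).
Proof.
  intros Hp Ht Cf. apply (is_derive_RInt f (fun y => RInt f p y) p t); [|now apply Cf].
  assert (e0 : 0 < Rmin (t - l) (u - t)) by (apply Rmin_glb_lt; lra).
  exists (mkposreal _ e0). intros y Hy. apply (RInt_correct f). apply ex_RInt_continuous.
  intros z Hz. apply Cf.
  assert (Rabs (y - t) < Rmin (t - l) (u - t)) as B by exact Hy.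
  apply Rabs_def2 in B. pose proof (Rmin_l (t - l) (u - t)). pose proof (Rmin_r (t - l) (u - t)).
  unfold Rmin, Rmax in Hz. destruct (Rle_dec p y); lra.
Qed.

(** An approximate primitive of cos Psi that is smooth where P vanishes. The first error term is
    concentrated where |P| is at most of order m; the second is at most |dP| / m^2. *)
Lemma oscillating_weight_derive (Psi P : R -> R) (dP m t : R) : 0 < m ->
  is_derive Psi t (P t) -> is_derive P t dP ->
  is_derive (fun y => sin (Psi y) * P y / (P y ^ 2 + m ^ 2)) t
    (cos (Psi t) - (cos (Psi t) * m ^ 2 / (P t ^ 2 + m ^ 2)
      - sin (Psi t) * dP * (m ^ 2 - P t ^ 2) / (P t ^ 2 + m ^ 2) ^ 2)).
Proof.
  intros m0 D1 D2.
  assert (N : P t ^ 2 + m ^ 2 <> 0).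
  { pose proof (pow2_ge_0 (P t)). pose proof (pow_lt m 2 m0). lra. }
  auto_derive.
  - repeat split; try (eexists; eassumption). simpl in N. intros E. apply N. simpl. lra.
  - rewrite (is_derive_unique (fun y : R => Psi y) _ _ D1), (is_derive_unique (fun y : R => P y) _ _ D2).
    field. simpl in N. simpl. intros E. apply N. lra.
Qed.

Lemma oscillating_weight_bound (x y m : R) : 0 < m -> Rabs y <= 1 -> Rabs (y * x / (x ^ 2 + m ^ 2)) <= / (2 * m).
Proof.
  intros m0 Hy.
  assert (N : 0 < x ^ 2 + m ^ 2) by nra.
  unfold Rdiv. rewrite !Rabs_mult, (Rabs_pos_eq (/ _)) by (left; now apply Rinv_0_lt_compat).
  apply Rle_trans with (Rabs x * / (x ^ 2 + m ^ 2)).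
  { apply Rmult_le_compat_r; [left; now apply Rinv_0_lt_compat|].
    rewrite <- (Rmult_1_l (Rabs x)) at 2. apply Rmult_le_compat_r; [apply Rabs_pos|assumption]. }
  assert (k : Rabs x * (2 * m) <= x ^ 2 + m ^ 2).
  { rewrite <- (pow2_abs x). pose proof (pow2_ge_0 (Rabs x - m)). lra. }
  apply Rle_trans with ((x ^ 2 + m ^ 2) * / (2 * m) * / (x ^ 2 + m ^ 2)); [|right; field; split; lra].
  apply Rmult_le_compat_r; [left; now apply Rinv_0_lt_compat|].
  apply (Rmult_le_reg_r (2 * m)); [lra|]. rewrite Rmult_assoc, Rinv_l; lra.
Qed.

Lemma vector_coordinate_bounds (v1 v2 lam : R) : 0 < lam -> lam ^ 2 = v1 ^ 2 + v2 ^ 2 ->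
  Rabs v1 <= lam /\ Rabs v2 <= lam.
Proof. intros H E. split; apply Rabs_le; split; nra. Qed.

(* Integration by parts with the weight psi' / (psi'^2 + m^2) in place of 1 / psi' keeps the bound
   uniform through the stationary point of the phase, where [W] (an arctangent) pays for the
   stretch |psi'| < m. *)
Lemma oscillation_piece (l u : R) (g1 g2 : R -> R) : l < u -> curved_graph l u g1 g2 ->
  exists C D : R, 0 < C /\ 0 < D /\
    forall v1 v2 lam m th : R, 0 < lam -> lam ^ 2 = v1 ^ 2 + v2 ^ 2 -> 0 < m <= lam ->
    exists W : R -> R,
      (forall a b, l < a < u -> l < b < u -> W b - W a <= C * m / lam) /\
      forall a b, l < a -> a <= b -> b < u ->
        Rabs (RInt (wave g1 g2 v1 v2 th) a b) <= / m + (W b - W a) + D * lam / m ^ 2 * (b - a).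
Proof.
  intros lu (p & s & dp & ds & mu & K & kap & sg & mu0 & kap0 & Hsg & H).
  assert (K0 : mu <= K). { destruct (H ((l + u) / 2)) as (_ & _ & _ & _ & B & _); lra. }
  (* The phase derivative is 2 PI p U with U = v1 + v2 s. If |v2| >= c lam, then U is strictly
     monotone with speed of order lam; otherwise |v2 s| <= lam / 4 and |v1| >= 3 lam / 4, so |U| >=
     lam / 2 throughout. *)
  set (c := / (4 * (K + 1))).
  assert (c0 : 0 < c) by (apply Rinv_0_lt_compat; lra).
  assert (cK : 4 * (K + 1) * c = 1) by (apply Rinv_r; lra).
  exists (PI / (mu * c * kap) + 4 / mu ^ 2 * (u - l)), (2 * PI * (K + 2 * K ^ 2)).
  assert (P0 := PI_RGT_0).
  assert (P4 : 1 <= PI) by (pose proof PI2_1; lra).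
  assert (A1 : 0 < PI / (mu * c * kap)).
  { apply Rmult_lt_0_compat; [lra|]. apply Rinv_0_lt_compat. apply Rmult_lt_0_compat; [nra|assumption]. }
  assert (A2 : 0 < 4 / mu ^ 2 * (u - l)).
  { apply Rmult_lt_0_compat; [|lra]. apply Rmult_lt_0_compat; [lra|]. apply Rinv_0_lt_compat. nra. }
  split; [lra|]. split; [nra|].
  intros v1 v2 lam m th lam0 Elam [m0 mlam].
  destruct (vector_coordinate_bounds v1 v2 lam lam0 Elam) as [V1 V2].
  set (U := fun t => v1 + v2 * s t).
  set (dU := fun t => v2 * ds t).
  set (P := fun t => 2 * PI * (p t * U t)).
  set (dP := fun t => 2 * PI * (dp t * U t + p t * dU t)).
  set (Psi := fun t => phase g1 g2 v1 v2 t + th).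
  assert (DU : forall t, l < t < u -> is_derive U t (dU t)).
  { intros t Ht. destruct (H t Ht) as (_ & _ & _ & Ds & _). unfold U, dU.
    auto_derive; [eexists; exact Ds|]. rewrite (is_derive_unique (fun y : R => s y) _ _ Ds). ring. }
  assert (DPsi : forall t, l < t < u -> is_derive Psi t (P t)).
  { intros t Ht. destruct (H t Ht) as (D1 & D2 & _). unfold Psi, phase, P, U.
    auto_derive; [repeat split; first [eexists; exact D1 | eexists; exact D2]|].
    rewrite (is_derive_unique (fun y : R => g1 y) _ _ D1), (is_derive_unique (fun y : R => g2 y) _ _ D2). ring. }
  assert (DP : forall t, l < t < u -> is_derive P t (dP t)).
  { intros t Ht. destruct (H t Ht) as (_ & _ & D1 & _). pose proof (DU t Ht) as D2. unfold P, dP.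
    auto_derive; [repeat split; first [eexists; exact D1 | eexists; exact D2]|].
    rewrite (is_derive_unique (fun y : R => p y) _ _ D1), (is_derive_unique (fun y : R => U y) _ _ D2). ring. }
  assert (BdP : forall t, l < t < u -> Rabs (dP t) <= 2 * PI * (K + 2 * K ^ 2) * lam).
  { intros t Ht. destruct (H t Ht) as (_ & _ & _ & _ & [_ B1] & B2 & B3 & B4 & _).
    unfold dP. rewrite Rabs_mult, (Rabs_pos_eq (2 * PI)) by lra.
    apply Rle_trans with (2 * PI * ((K + 2 * K ^ 2) * lam)); [|right; ring]. apply Rmult_le_compat_l; [lra|].
    assert (Rabs (U t) <= lam + lam * K).
    { unfold U. eapply Rle_trans; [apply Rabs_triang|]. rewrite Rabs_mult.
      apply Rplus_le_compat; [assumption|]. apply Rmult_le_compat; try apply Rabs_pos; assumption. }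
    assert (Rabs (dU t) <= lam * K).
    { unfold dU. rewrite Rabs_mult. apply Rmult_le_compat; try apply Rabs_pos; assumption. }
    eapply Rle_trans; [apply Rabs_triang|]. rewrite !Rabs_mult.
    apply Rle_trans with (K * (lam + lam * K) + K * (lam * K)); [|right; ring].
    apply Rplus_le_compat; apply Rmult_le_compat; try apply Rabs_pos; assumption. }
  assert (LP : forall t, l < t < u -> (mu * U t) ^ 2 <= P t ^ 2).
  { intros t Ht. destruct (H t Ht) as (_ & _ & _ & _ & [B1 _] & _).
    unfold P. rewrite !Rpow_mult_distr. rewrite <- (pow2_abs (p t)).
    assert (mu ^ 2 <= Rabs (p t) ^ 2) by (apply pow_incr; lra).
    assert (0 <= U t ^ 2) by apply pow2_ge_0.
    assert (1 <= 2 ^ 2 * PI ^ 2) by nra.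
    apply Rle_trans with (1 * (Rabs (p t) ^ 2 * U t ^ 2)); [rewrite Rmult_1_l; now apply Rmult_le_compat_r|].
    apply Rmult_le_compat_r; [|assumption]. apply Rmult_le_pos; [apply pow2_ge_0|assumption]. }
  (* The first error is dominated by the derivative of one function [W] on the whole arc. Its
     increments add up, so a subdivision of the arc pays O(m / lam) for the stationary point once
     and not once per piece. *)
  assert (HW : exists W dW : R -> R,
     (forall t, l < t < u -> is_derive W t (dW t) /\ m ^ 2 / (P t ^ 2 + m ^ 2) <= dW t) /\
     (forall a b, l < a < u -> l < b < u ->
        W b - W a <= (PI / (mu * c * kap) + 4 / mu ^ 2 * (u - l)) * m / lam)).
  { assert (ml : 0 < m / lam) by (apply Rmult_lt_0_compat; [lra|now apply Rinv_0_lt_compat]).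
    destruct (Rle_or_lt (c * lam) (Rabs v2)) as [big|small].
    - set (sv := if Rle_dec 0 v2 then 1 else -1).
      assert (Hsv : sv * v2 = Rabs v2 /\ sv ^ 2 = 1).
      { unfold sv. destruct (Rle_dec 0 v2); [rewrite Rabs_pos_eq by lra|rewrite Rabs_left by lra]; split; ring. }
      assert (Hsg2 : sg ^ 2 = 1) by (destruct Hsg as [-> | ->]; ring).
      set (A := m / (mu * c * lam * kap)).
      assert (q0 : 0 < mu * c * lam * kap) by (repeat apply Rmult_lt_0_compat; assumption).
      assert (A0 : 0 < A) by (apply Rmult_lt_0_compat; [lra|now apply Rinv_0_lt_compat]).
      (* The signs [sv] and [sg] make the argument increasing, with derivative at least mu c lam kap
         / m; [A] normalises this speed, and (mu U)^2 <= P^2 gives the required lower bound on the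
         derivative. The range of atan limits the total increase to A PI. *)
      exists (fun t => A * atan (mu * (sv * sg * U t) / m)),
             (fun t => A * ((mu * (sv * sg * dU t) / m) / (1 + (mu * (sv * sg * U t) / m) ^ 2))).
      split.
      + intros t Ht. split.
        * pose proof (DU t Ht) as D. auto_derive; [eexists; exact D|].
          rewrite (is_derive_unique (fun y : R => U y) _ _ D). field.
          split; [lra|]. pose proof (pow2_ge_0 (mu * (sv * sg * U t))). pose proof (pow_lt m 2 m0). lra.
        * destruct (H t Ht) as (_ & _ & _ & _ & _ & _ & _ & _ & B).
          assert (E2 : (mu * (sv * sg * U t) / m) ^ 2 = (mu * U t) ^ 2 / m ^ 2).
          { transitivity ((sv ^ 2 * sg ^ 2) * ((mu * U t) ^ 2 / m ^ 2)); [field; lra|].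
            destruct Hsv as [_ ->]. rewrite Hsg2. ring. }
          rewrite E2.
          assert (E1 : sv * sg * dU t = Rabs v2 * (sg * ds t)).
          { unfold dU. destruct Hsv as [<- _]. ring. }
          rewrite E1.
          assert (L1 : c * lam * kap <= Rabs v2 * (sg * ds t)).
          { apply Rmult_le_compat; try lra. apply Rmult_le_pos; lra. }
          pose proof (LP t Ht) as L2.
          set (Y := (mu * U t) ^ 2) in *. assert (Y0 : 0 <= Y) by apply pow2_ge_0.
          assert (m2 : 0 < m ^ 2) by nra.
          apply Rle_trans with (m ^ 2 / (Y + m ^ 2)).
          { apply Rmult_le_compat_l; [lra|]. apply Rinv_le_contravar; lra. }
          apply Rle_trans with (A * (mu * (c * lam * kap) / m / (1 + Y / m ^ 2))).
          { right. unfold A. field. repeat split; try lra. }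
          apply Rmult_le_compat_l; [lra|]. apply Rmult_le_compat_r.
          { left. apply Rinv_0_lt_compat. assert (0 <= Y / m ^ 2); [|lra].
            apply Rmult_le_pos; [assumption|left; now apply Rinv_0_lt_compat]. }
          apply Rmult_le_compat_r; [left; now apply Rinv_0_lt_compat|].
          apply Rmult_le_compat_l; lra.
      + intros a b _ _.
        pose proof (atan_bound (mu * (sv * sg * U a) / m)). pose proof (atan_bound (mu * (sv * sg * U b) / m)).
        apply Rle_trans with (A * PI).
        { rewrite <- Rmult_minus_distr_l. apply Rmult_le_compat_l; lra. }
        apply Rle_trans with (PI / (mu * c * kap) * (m / lam)).
        { right. unfold A. field. repeat split; lra. }
        apply Rle_trans with ((PI / (mu * c * kap) + 4 / mu ^ 2 * (u - l)) * (m / lam)).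
        { apply Rmult_le_compat_r; lra. }
        right. unfold Rdiv. ring.
    (* Without a stationary point |P| >= mu lam / 2, and the error is at most 4 m^2 / (mu lam)^2,
       hence below the constant slope used here because m <= lam. *)
    - exists (fun t => 4 / mu ^ 2 * (m / lam) * t), (fun t => 4 / mu ^ 2 * (m / lam)). split.
      + intros t Ht. split; [auto_derive; [trivial|field; repeat split; lra]|].
        destruct (H t Ht) as (_ & _ & _ & _ & _ & _ & B3 & _).
        assert (v2s : v2 ^ 2 <= (lam / 4) ^ 2).
        { rewrite <- (pow2_abs v2). apply pow_incr. split; [apply Rabs_pos|]. nra. }
        assert (v1b : 3 / 4 * lam <= Rabs v1).
        { apply Rsqr_incr_0_var; [|apply Rabs_pos]. rewrite <- Rsqr_abs. unfold Rsqr. nra. }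
        assert (Ub : lam / 2 <= Rabs (U t)).
        { unfold U. pose proof (Rabs_triang_inv v1 (- (v2 * s t))) as T.
          rewrite Rabs_Ropp, Rabs_mult in T. unfold Rminus in T. rewrite Ropp_involutive in T.
          assert (Rabs v2 * Rabs (s t) <= c * lam * K).
          { apply Rmult_le_compat; try apply Rabs_pos; lra. }
          assert (c * K <= / 4) by lra. assert (c * lam * K <= lam / 4) by nra. lra. }
        assert (U2 : (lam / 2) ^ 2 <= U t ^ 2).
        { rewrite <- (pow2_abs (U t)). apply pow_incr. lra. }
        pose proof (LP t Ht) as L. rewrite Rpow_mult_distr in L.
        assert (mu2 : 0 < mu ^ 2) by nra.
        assert (L3 : mu ^ 2 * (lam / 2) ^ 2 <= P t ^ 2 + m ^ 2) by nra.
        assert (0 < mu ^ 2 * (lam / 2) ^ 2) by (apply Rmult_lt_0_compat; nra).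
        apply Rle_trans with (m ^ 2 / (mu ^ 2 * (lam / 2) ^ 2)).
        { apply Rmult_le_compat_l; [nra|]. now apply Rinv_le_contravar. }
        apply Rle_trans with (4 / mu ^ 2 * (m / lam) * (m / lam)); [right; field; lra|].
        rewrite <- (Rmult_1_r (4 / mu ^ 2 * (m / lam))) at 2.
        apply Rmult_le_compat_l.
        * apply Rmult_le_pos; [|lra]. apply Rmult_le_pos; [lra|]. left; now apply Rinv_0_lt_compat.
        * apply (Rmult_le_reg_r lam); [lra|]. unfold Rdiv. rewrite Rmult_assoc, Rinv_l; lra.
      + intros a b Ha Hb. rewrite <- Rmult_minus_distr_l.
        assert (0 < 4 / mu ^ 2) by (apply Rmult_lt_0_compat; [lra|apply Rinv_0_lt_compat; nra]).
        apply Rle_trans with (4 / mu ^ 2 * (u - l) * (m / lam)).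
        * rewrite Rmult_assoc, (Rmult_assoc (4 / mu ^ 2)). apply Rmult_le_compat_l; [lra|]. nra.
        * apply Rle_trans with ((PI / (mu * c * kap) + 4 / mu ^ 2 * (u - l)) * (m / lam)).
          { apply Rmult_le_compat_r; lra. }
          right. unfold Rdiv. ring. }
  destruct HW as (W & dW & HW & HWb). exists W. split; [exact HWb|].
  intros a b la ab bu.
  set (f := wave g1 g2 v1 v2 th).
  assert (Cf : forall x, l < x < u -> continuous f x).
  { intros x Hx. destruct (H x Hx) as (D1 & D2 & _).
    apply wave_continuous; apply (@ex_derive_continuous R_AbsRing R_NormedModule); eexists; eassumption. }
  set (Hh := fun y => sin (Psi y) * P y / (P y ^ 2 + m ^ 2)).
  (* Integration by parts in differential form: the integral minus the weight [Hh] has a derivative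
     bounded by that of [W] plus D lam / m^2. *)
  assert (I : Rabs ((RInt f a b - Hh b) - (RInt f a a - Hh a)) <=
    (W b + 2 * PI * (K + 2 * K ^ 2) * lam / m ^ 2 * b) - (W a + 2 * PI * (K + 2 * K ^ 2) * lam / m ^ 2 * a)).
  { set (D := 2 * PI * (K + 2 * K ^ 2)) in *.
    apply (abs_increment_le (fun t => RInt f a t - Hh t) (fun t => W t + D * lam / m ^ 2 * t)
      (fun t => f t - (cos (Psi t) - (cos (Psi t) * m ^ 2 / (P t ^ 2 + m ^ 2)
        - sin (Psi t) * dP t * (m ^ 2 - P t ^ 2) / (P t ^ 2 + m ^ 2) ^ 2)))
      (fun t => dW t + D * lam / m ^ 2)); [assumption|].
    intros t Ht. assert (Ht' : l < t < u) by lra. split; [|split].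
    - apply (is_derive_minus (fun y => RInt f a y) Hh).
      + apply RInt_derive_at with l u; try assumption; lra.
      + apply oscillating_weight_derive; auto.
    - apply (is_derive_plus W (fun y => D * lam / m ^ 2 * y)); [apply HW; assumption|].
      auto_derive; [trivial|simpl; field; repeat split; lra].
    - replace (f t) with (cos (Psi t)) by reflexivity.
      destruct (HW t Ht') as [_ Hw]. pose proof (BdP t Ht') as Bd.
      set (X := P t ^ 2) in *. assert (X0 : 0 <= X) by apply pow2_ge_0.
      assert (m2 : 0 < m ^ 2) by nra. set (M := m ^ 2) in *.
      assert (XM : 0 < X + M) by lra.
      replace (cos (Psi t) - (cos (Psi t) - (cos (Psi t) * M / (X + M) - sin (Psi t) * dP t * (M - X) / (X + M) ^ 2)))
        with (cos (Psi t) * (M / (X + M)) + sin (Psi t) * (- (dP t * ((M - X) / (X + M) ^ 2))))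
        by (unfold Rdiv; ring).
      assert (cs : forall x y, Rabs x <= 1 -> Rabs (x * y) <= Rabs y).
      { intros x y Hx. rewrite Rabs_mult. rewrite <- (Rmult_1_l (Rabs y)) at 2.
        apply Rmult_le_compat_r; [apply Rabs_pos|assumption]. }
      eapply Rle_trans; [apply Rabs_triang|]. apply Rplus_le_compat.
      + eapply Rle_trans; [apply cs; apply Rabs_le; apply COS_bound|].
        rewrite Rabs_pos_eq; [assumption|]. apply Rmult_le_pos; [lra|left; now apply Rinv_0_lt_compat].
      + eapply Rle_trans; [apply cs; apply Rabs_le; apply SIN_bound|].
        rewrite Rabs_Ropp, Rabs_mult. unfold Rdiv at 2.
        apply Rmult_le_compat; try apply Rabs_pos; [assumption|].
        unfold Rdiv. rewrite Rabs_mult, (Rabs_pos_eq (/ _)) by (left; apply Rinv_0_lt_compat, pow_lt; assumption).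
        apply Rle_trans with ((X + M) * / (X + M) ^ 2).
        * apply Rmult_le_compat_r; [left; apply Rinv_0_lt_compat, pow_lt; assumption|]. apply Rabs_le. lra.
        * replace ((X + M) * / (X + M) ^ 2) with (/ (X + M)) by (field; lra).
          apply Rinv_le_contravar; lra. }
  rewrite RInt_point in I. change (zero : R) with 0 in I.
  assert (Ha : Rabs (Hh a) <= / (2 * m)).
  { apply oscillating_weight_bound; [assumption|]. apply Rabs_le. apply SIN_bound. }
  assert (Hb : Rabs (Hh b) <= / (2 * m)).
  { apply oscillating_weight_bound; [assumption|]. apply Rabs_le. apply SIN_bound. }
  replace (/ m) with (/ (2 * m) + / (2 * m)) by (field; lra).
  apply Rabs_le_between in Ha. apply Rabs_le_between in Hb. apply Rabs_le_between in I.
  apply Rabs_le. lra.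
Qed.

(** Regularity makes only one component of the velocity nonzero, so either coordinate may have to
    serve as the variable of the graph. *)
Definition curved_arc (l u : R) (g1 g2 : R -> R) : Prop :=
  curved_graph l u g1 g2 \/ curved_graph l u g2 g1.

Lemma phase_swap (g1 g2 : R -> R) (v1 v2 t : R) : phase g1 g2 v1 v2 t = phase g2 g1 v2 v1 t.
Proof. unfold phase. ring. Qed.

Lemma curved_arc_oscillation (l u : R) (g1 g2 : R -> R) : l < u -> curved_arc l u g1 g2 ->
  exists C D : R, 0 < C /\ 0 < D /\
    forall v1 v2 lam m th : R, 0 < lam -> lam ^ 2 = v1 ^ 2 + v2 ^ 2 -> 0 < m <= lam ->
    exists W : R -> R,
      (forall a b, l < a < u -> l < b < u -> W b - W a <= C * m / lam) /\
      forall a b, l < a -> a <= b -> b < u ->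
        Rabs (RInt (wave g1 g2 v1 v2 th) a b) <= / m + (W b - W a) + D * lam / m ^ 2 * (b - a).
Proof.
  intros lu [H|H]; destruct (oscillation_piece l u _ _ lu H) as (C & D & C0 & D0 & HO);
    exists C, D; (split; [assumption|split; [assumption|]]); intros v1 v2 lam m th lam0 E Hm.
  - exact (HO v1 v2 lam m th lam0 E Hm).
  - destruct (HO v2 v1 lam m th lam0) as (W & W1 & W2); [lra|assumption|].
    exists W. split; [exact W1|]. intros a b la ab bu.
    rewrite (RInt_ext _ (wave g2 g1 v2 v1 th)); [now apply W2|].
    intros x _. unfold wave. now rewrite phase_swap.
Qed.

(** * Integrals of single waves over a curved arc *)

Lemma curved_arc_derive (l u : R) (g1 g2 : R -> R) : curved_arc l u g1 g2 -> forall t, l < t < u ->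
  ex_derive g1 t /\ ex_derive g2 t.
Proof.
  intros [H|H] t Ht; destruct H as (p & s & dp & ds & mu & K & kap & sg & _ & _ & _ & H);
    destruct (H t Ht) as (D1 & D2 & _); split; eexists; eassumption.
Qed.

Lemma curved_arc_wave_continuous (l u : R) (g1 g2 : R -> R) (v1 v2 th t : R) :
  curved_arc l u g1 g2 -> l < t < u -> continuous (wave g1 g2 v1 v2 th) t.
Proof.
  intros H Ht. destruct (curved_arc_derive l u g1 g2 H t Ht).
  apply wave_continuous; now apply (@ex_derive_continuous R_AbsRing R_NormedModule).
Qed.

Lemma wave_RInt_correct (l u : R) (g1 g2 : R -> R) (v1 v2 th a b : R) :
  curved_arc l u g1 g2 -> l < a -> a <= b -> b < u ->
  is_RInt (wave g1 g2 v1 v2 th) a b (RInt (wave g1 g2 v1 v2 th) a b).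
Proof.
  intros H la ab bu. apply (RInt_correct (wave g1 g2 v1 v2 th)). apply ex_RInt_continuous.
  intros z Hz. rewrite Rmin_left, Rmax_right in Hz by lra.
  apply curved_arc_wave_continuous with l u; [assumption|lra].
Qed.

(** The cut-off m = lam^(2/3) balances m / lam against lam / m^2, both equal to lam^(-1/3); the
    endpoint term 1 / m is smaller still. *)
Lemma wave_decay (l u a b : R) (g1 g2 : R -> R) : l < a < b -> b < u -> curved_arc l u g1 g2 ->
  exists C : R, 0 < C /\ forall v1 v2 lam th : R, 1 <= lam -> lam ^ 2 = v1 ^ 2 + v2 ^ 2 ->
    Rabs (RInt (wave g1 g2 v1 v2 th) a b) <= C * Rpower lam (- (1 / 3)).
Proof.
  intros la bu H. destruct (curved_arc_oscillation l u g1 g2) as (C & D & C0 & D0 & HO); [lra|assumption|].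
  exists (1 + C + D * (b - a)). split; [assert (0 < D * (b - a)) by (apply Rmult_lt_0_compat; lra); lra|].
  intros v1 v2 lam th lam1 E.
  set (m := Rpower lam (2 / 3)).
  assert (m0 : 0 < m) by apply exp_pos.
  assert (mlam : m <= lam).
  { rewrite <- (Rpower_1 lam) by lra. apply Rle_Rpower; lra. }
  destruct (HO v1 v2 lam m th) as (W & W1 & W2); [lra|assumption|lra|].
  specialize (W1 a b ltac:(lra) ltac:(lra)). specialize (W2 a b ltac:(lra) ltac:(lra) ltac:(lra)).
  set (q := Rpower lam (- (1 / 3))) in *.
  assert (e1 : / m <= q).
  { unfold m, q. rewrite <- Rpower_Ropp. apply Rle_Rpower; lra. }
  assert (e2 : m = lam * q).
  { unfold m, q. rewrite <- (Rpower_1 lam) at 2 by lra. rewrite <- Rpower_plus. f_equal. lra. }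
  assert (e3 : m ^ 2 * q = lam).
  { unfold m, q. rewrite <- Rpower_pow by apply exp_pos. rewrite Rpower_mult, <- Rpower_plus.
    rewrite <- (Rpower_1 lam) at 2 by lra. f_equal. simpl. lra. }
  assert (q0 : 0 < q) by apply exp_pos.
  replace (C * m / lam) with (C * q) in W1 by (rewrite e2; field; lra).
  replace (D * lam / m ^ 2 * (b - a)) with (D * (b - a) * q) in W2 by (rewrite <- e3; field; lra).
  lra.
Qed.

Lemma RInt_nonneg_zero (l u a b : R) (G : R -> R) : l < a -> a < b -> b < u ->
  (forall t, l < t < u -> continuous G t) -> (forall t, l < t < u -> 0 <= G t) ->
  RInt G a b <= 0 -> forall t, a < t < b -> G t = 0.
Proof.
  intros la ab bu CG PG I t Ht.
  destruct (Rle_lt_or_eq_dec 0 (G t)) as [pos|e]; [apply PG; lra| |now symmetry].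
  exfalso.
  assert (ex : forall x y, l < x -> x <= y -> y < u -> ex_RInt G x y).
  { intros x y H1 H2 H3. apply (@ex_RInt_continuous R_CompleteNormedModule). intros z Hz.
    rewrite Rmin_left, Rmax_right in Hz by lra. apply CG. lra. }
  assert (CGt : continuous G t) by (apply CG; lra).
  destruct (CGt (fun y => 0 < y)) as [d Hd].
  { exists (mkposreal _ pos). intros y Hy. assert (B : Rabs (y - G t) < G t) by exact Hy.
    apply Rabs_def2 in B. lra. }
  set (e := Rmin (d / 2) (Rmin ((t - a) / 2) ((b - t) / 2))).
  assert (e0 : 0 < e).
  { destruct d as [d d0]. simpl in e. unfold e. repeat apply Rmin_glb_lt; lra. }
  assert (e1 : e <= d / 2) by apply Rmin_l.
  assert (e2 : e <= (t - a) / 2) by (eapply Rle_trans; [apply Rmin_r|apply Rmin_l]).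
  assert (e3 : e <= (b - t) / 2) by (eapply Rle_trans; [apply Rmin_r|apply Rmin_r]).
  assert (I1 : 0 <= RInt G a (t - e)).
  { apply RInt_ge_0; [lra|apply ex; lra|]. intros x Hx. apply PG. lra. }
  assert (I2 : 0 < RInt G (t - e) (t + e)).
  { apply RInt_gt_0; [lra| |].
    - intros x Hx. apply (Hd x). change (Rabs (x - t) < d). destruct d as [d d0]. simpl in *.
      apply Rabs_def1; lra.
    - intros x Hx. apply CG. lra. }
  assert (I3 : 0 <= RInt G (t + e) b).
  { apply RInt_ge_0; [lra|apply ex; lra|]. intros x Hx. apply PG. lra. }
  rewrite <- (RInt_Chasles G a (t - e) b) in I by (apply ex; lra).
  rewrite <- (RInt_Chasles G (t - e) (t + e) b) in I by (apply ex; lra).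
  change plus with Rplus in I. lra.
Qed.

(** A stationary phase means v1 + v2 s = 0 on an interval. Differentiating gives v2 ds = 0, and the
    curvature bound on ds excludes v2 <> 0. *)
Lemma phase_derive_zero_on_curved_graph (l u a b : R) (g1 g2 : R -> R) (v1 v2 : R) :
  l <= a -> a < b -> b <= u -> curved_graph l u g1 g2 ->
  (forall t, a < t < b -> is_derive (phase g1 g2 v1 v2) t 0) -> v1 = 0 /\ v2 = 0.
Proof.
  intros la ab bu (p & s & dp & ds & mu & K & kap & sg & mu0 & kap0 & Hsg & H) HD.
  assert (Z : forall t, a < t < b -> v1 + v2 * s t = 0).
  { intros t Ht. destruct (H t) as (D1 & D2 & _ & _ & [B _] & _); [lra|].
    assert (D : is_derive (phase g1 g2 v1 v2) t (2 * PI * (p t * (v1 + v2 * s t)))).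
    { unfold phase. auto_derive; [repeat split; first [eexists; exact D1|eexists; exact D2]|].
      rewrite (is_derive_unique (fun y : R => g1 y) _ _ D1), (is_derive_unique (fun y : R => g2 y) _ _ D2). ring. }
    apply is_derive_unique in D. rewrite (is_derive_unique _ _ _ (HD t Ht)) in D.
    pose proof PI_RGT_0. symmetry in D. apply Rmult_integral in D as [D|D]; [lra|].
    apply Rmult_integral in D as [D|D]; [|assumption]. rewrite D, Rabs_R0 in B. lra. }
  set (t := (a + b) / 2). destruct (H t) as (_ & _ & _ & Ds & _ & _ & _ & _ & B); [unfold t; lra|].
  assert (D : is_derive (fun t => v1 + v2 * s t) t (v2 * ds t)).
  { auto_derive; [eexists; exact Ds|]. rewrite (is_derive_unique (fun y : R => s y) _ _ Ds). ring. }
  assert (D' : is_derive (fun t => v1 + v2 * s t) t 0).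
  { apply (is_derive_ext_loc (fun _ => 0)); [|apply (is_derive_const 0)].
    assert (e0 : 0 < (b - a) / 2) by lra. exists (mkposreal _ e0). intros y Hy.
    assert (Hy' : Rabs (y - t) < (b - a) / 2) by exact Hy. apply Rabs_def2 in Hy'.
    symmetry. apply Z. unfold t in Hy'. lra. }
  apply is_derive_unique in D. rewrite (is_derive_unique _ _ _ D') in D.
  assert (v20 : v2 = 0).
  { symmetry in D. apply Rmult_integral in D as [D|D]; [assumption|]. rewrite D in B. lra. }
  split; [|assumption]. specialize (Z t ltac:(unfold t; lra)). rewrite v20 in Z. lra.
Qed.

(** The equality case of the triangle inequality. With Z = |X + iY| >= b - a, the nonnegative
    function Z - (X cos psi + Y sin psi) has integral (b - a) Z - Z^2 <= 0, hence vanishes; the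
    phase is then constant, which curvature forbids. *)
Lemma wave_strict (l u a b : R) (g1 g2 : R -> R) (v1 v2 : R) :
  l < a -> a < b -> b < u -> curved_arc l u g1 g2 -> ~ (v1 = 0 /\ v2 = 0) ->
  RInt (wave g1 g2 v1 v2 0) a b ^ 2 + RInt (wave g1 g2 v1 v2 (- (PI / 2))) a b ^ 2 < (b - a) ^ 2.
Proof.
  intros la ab bu Hc Hv.
  set (X := RInt (wave g1 g2 v1 v2 0) a b). set (Y := RInt (wave g1 g2 v1 v2 (- (PI / 2))) a b).
  destruct (Rlt_or_le (X ^ 2 + Y ^ 2) ((b - a) ^ 2)) as [|bad]; [assumption|exfalso; apply Hv].
  set (Z := sqrt (X ^ 2 + Y ^ 2)).
  assert (S0 : 0 <= X ^ 2 + Y ^ 2) by (pose proof (pow2_ge_0 X); pose proof (pow2_ge_0 Y); lra).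
  assert (Z2 : Z * Z = X ^ 2 + Y ^ 2) by (apply sqrt_sqrt; assumption).
  assert (ZL : b - a <= Z).
  { rewrite <- (sqrt_pow2 (b - a)) by lra. apply sqrt_le_1_alt. assumption. }
  set (psi := phase g1 g2 v1 v2).
  assert (W0 : forall t, wave g1 g2 v1 v2 0 t = cos (psi t)) by (intros t; apply cos_wave).
  assert (W1 : forall t, wave g1 g2 v1 v2 (- (PI / 2)) t = sin (psi t)) by (intros t; apply sin_wave).
  set (G := fun t => Z - (X * wave g1 g2 v1 v2 0 t + Y * wave g1 g2 v1 v2 (- (PI / 2)) t)).
  assert (IG : is_RInt G a b ((b - a) * Z - (X * X + Y * Y))).
  { apply (is_RInt_minus (fun _ => Z)); [apply (is_RInt_const a b Z)|].
    apply (is_RInt_plus (fun t => X * wave g1 g2 v1 v2 0 t));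
      [apply (is_RInt_scal (wave g1 g2 v1 v2 0))|apply (is_RInt_scal (wave g1 g2 v1 v2 (- (PI / 2))))];
      apply wave_RInt_correct with l u; lra || assumption. }
  assert (PG : forall t, 0 <= G t).
  { intros t. unfold G. rewrite W0, W1. assert (T := sin2_cos2 (psi t)). unfold Rsqr in T.
    set (co := cos (psi t)) in *. set (si := sin (psi t)) in *.
    assert (X * co + Y * si <= Z); [|lra].
    apply Rsqr_incr_0_var; [|lra]. unfold Rsqr. rewrite Z2.
    replace (X ^ 2 + Y ^ 2) with ((X ^ 2 + Y ^ 2) * (si * si + co * co)) by (rewrite T; ring).
    pose proof (pow2_ge_0 (X * si - Y * co)). nra. }
  assert (G0 : forall t, a < t < b -> G t = 0).
  { apply (RInt_nonneg_zero l u); try assumption.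
    - intros t Ht. unfold G.
      apply (continuous_minus (fun _ => Z)); [apply continuous_const|].
      apply (continuous_plus (fun t => X * wave g1 g2 v1 v2 0 t));
        [apply (continuous_scal_r X (wave g1 g2 v1 v2 0))|apply (continuous_scal_r Y (wave g1 g2 v1 v2 (- (PI / 2))))];
        apply curved_arc_wave_continuous with l u; assumption.
    - intros t _. apply PG.
    - rewrite (is_RInt_unique _ _ _ _ IG). nra. }
  assert (dpsi : forall t, a < t < b -> exists d, is_derive psi t d).
  { intros t Ht. destruct (curved_arc_derive l u g1 g2 Hc t) as [[d1 D1] [d2 D2]]; [lra|].
    eexists. unfold psi, phase. auto_derive; [repeat split; first [eexists; exact D1|eexists; exact D2]|reflexivity]. }
  assert (Hz : forall t, a < t < b -> - X * sin (psi t) + Y * cos (psi t) = 0).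
  { intros t Ht. specialize (G0 t Ht). unfold G in G0. rewrite W0, W1 in G0.
    assert (T := sin2_cos2 (psi t)). unfold Rsqr in T.
    set (co := cos (psi t)) in *. set (si := sin (psi t)) in *.
    apply Rsqr_eq_0. unfold Rsqr.
    replace ((- X * si + Y * co) * (- X * si + Y * co))
      with ((X ^ 2 + Y ^ 2) * (si * si + co * co) - (X * co + Y * si) * (X * co + Y * si)) by ring.
    rewrite T. replace (X * co + Y * si) with Z by lra. lra. }
  (* Differentiating the vanishing combination -X sin psi + Y cos psi gives -Z psi' = 0, and Z > 0.
     This avoids any choice of a branch for the angle. *)
  assert (D0 : forall t, a < t < b -> is_derive psi t 0).
  { intros t Ht. destruct (dpsi t Ht) as [d D].
    assert (D1 : is_derive (fun t => - X * sin (psi t) + Y * cos (psi t)) t (- (X * cos (psi t) + Y * sin (psi t)) * d)).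
    { auto_derive; [repeat split; eexists; exact D|]. rewrite (is_derive_unique (fun y : R => psi y) _ _ D). ring. }
    assert (D2 : is_derive (fun t => - X * sin (psi t) + Y * cos (psi t)) t 0).
    { apply (is_derive_ext_loc (fun _ => 0)); [|apply (is_derive_const 0)].
      assert (e0 : 0 < Rmin (t - a) (b - t)) by (apply Rmin_glb_lt; lra). exists (mkposreal _ e0). intros y Hy.
      assert (Hy' : Rabs (y - t) < Rmin (t - a) (b - t)) by exact Hy. apply Rabs_def2 in Hy'.
      pose proof (Rmin_l (t - a) (b - t)). pose proof (Rmin_r (t - a) (b - t)).
      symmetry. apply Hz. lra. }
    apply is_derive_unique in D1. rewrite (is_derive_unique _ _ _ D2) in D1.
    specialize (G0 t Ht). unfold G in G0. rewrite W0, W1 in G0.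
    replace (X * cos (psi t) + Y * sin (psi t)) with Z in D1 by lra.
    symmetry in D1. apply Rmult_integral in D1 as [D1|D1]; [lra|]. rewrite <- D1. exact D. }
  destruct Hc as [Hc|Hc].
  - apply (phase_derive_zero_on_curved_graph l u a b g1 g2); lra || assumption.
  - apply and_comm. apply (phase_derive_zero_on_curved_graph l u a b g2 g1); try lra; try assumption.
    intros t Ht. apply (is_derive_ext psi); [|now apply D0]. intros y. apply phase_swap.
Qed.

(** Decay makes the integral small for all but finitely many integer vectors, and strictness applies
    to each of the remaining ones; a minimum over a finite list yields one uniform gap. *)
Lemma wave_gap (l u a b : R) (g1 g2 : R -> R) :
  l < a -> a < b -> b < u -> curved_arc l u g1 g2 ->
  exists kap : R, 0 < kap <= 1 /\ forall v1 v2 : Z, ~ (v1 = 0 /\ v2 = 0)%Z ->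
    RInt (wave g1 g2 (IZR v1) (IZR v2) 0) a b ^ 2 + RInt (wave g1 g2 (IZR v1) (IZR v2) (- (PI / 2))) a b ^ 2
      <= ((1 - kap) * (b - a)) ^ 2.
Proof.
  intros la ab bu Hc.
  set (I := fun v : Z * Z => RInt (wave g1 g2 (IZR (fst v)) (IZR (snd v)) 0) a b ^ 2 +
    RInt (wave g1 g2 (IZR (fst v)) (IZR (snd v)) (- (PI / 2))) a b ^ 2).
  assert (fin : forall L : list (Z * Z), exists kap, 0 < kap <= 1 / 2 /\
     forall v, In v L -> ~ (fst v = 0 /\ snd v = 0)%Z -> I v <= ((1 - kap) * (b - a)) ^ 2).
  { induction L as [|v L [k [Hk HL]]]; [exists (1 / 2); split; [lra|]; intros v []|].
    destruct (classic (fst v = 0 /\ snd v = 0)%Z) as [z|nz].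
    - exists k. split; [assumption|]. intros w [<-|Hw]; [tauto|now apply HL].
    - assert (S : I v < (b - a) ^ 2).
      { refine (wave_strict l u a b g1 g2 (IZR (fst v)) (IZR (snd v)) la ab bu Hc _).
        intros [e1 e2]. apply nz. split; now apply eq_IZR. }
      (* Half the relative gap of the squared modulus, so that 1 - 2 k' <= (1 - r)^2 for every r <=
         k'. *)
      set (k' := (1 - I v / (b - a) ^ 2) / 2).
      assert (b2 : 0 < (b - a) ^ 2) by (apply pow_lt; lra).
      assert (k0 : 0 < k').
      { unfold k'. assert (I v / (b - a) ^ 2 < 1); [|lra].
        apply (Rmult_lt_reg_r ((b - a) ^ 2)); [assumption|]. unfold Rdiv. rewrite Rmult_assoc, Rinv_l; lra. }
      assert (kv : I v <= (1 - 2 * k') * (b - a) ^ 2) by (right; unfold k'; field; lra).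
      exists (Rmin k k'). assert (R1 := Rmin_l k k'). assert (R2 := Rmin_r k k').
      assert (R0 : 0 < Rmin k k') by (apply Rmin_glb_lt; lra). set (r := Rmin k k') in *.
      split; [lra|]. intros w [<-|Hw] Hn.
      + eapply Rle_trans; [exact kv|]. rewrite Rpow_mult_distr. apply Rmult_le_compat_r; nra.
      + eapply Rle_trans; [now apply HL|]. apply pow_incr. split; [apply Rmult_le_pos; lra|].
        apply Rmult_le_compat_r; lra. }
  destruct (wave_decay l u a b g1 g2 ltac:(lra) bu Hc) as (C & C0 & HC).
  (* Beyond this norm C lam^(-1/3) <= (b - a) / 4, and both integrals together stay below the bound
     attached to any gap of at most 1/2. *)
  destruct (INR_unbounded (Rmax 1 (Rpower (4 * C / (b - a)) 3))) as [N HN].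
  set (rng := map (fun k => (Z.of_nat k - Z.of_nat N)%Z) (seq 0 (2 * N + 1))).
  assert (Hr : forall z, (Z.abs z <= Z.of_nat N)%Z -> In z rng).
  { intros z Hz. apply in_map_iff. exists (Z.to_nat (z + Z.of_nat N)). split; [lia|]. apply in_seq. lia. }
  destruct (fin (list_prod rng rng)) as [k [Hk HL]].
  exists k. split; [lra|]. intros v1 v2 nz.
  destruct (Z_le_gt_dec (Z.max (Z.abs v1) (Z.abs v2)) (Z.of_nat N)) as [small|big].
  { apply (HL (v1, v2)); [|assumption]. apply in_prod; apply Hr; lia. }
  set (lam := sqrt (IZR v1 ^ 2 + IZR v2 ^ 2)).
  assert (P1 := pow2_ge_0 (IZR v1)). assert (P2 := pow2_ge_0 (IZR v2)).
  assert (lam2 : lam ^ 2 = IZR v1 ^ 2 + IZR v2 ^ 2) by (apply pow2_sqrt; lra).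
  assert (lam0 : 0 <= lam) by apply sqrt_pos.
  assert (Nlam : INR N <= lam).
  { apply Rsqr_incr_0_var; [|assumption]. unfold Rsqr. replace (lam * lam) with (lam ^ 2) by ring. rewrite lam2.
    rewrite INR_IZR_INZ. replace (IZR v1 ^ 2 + IZR v2 ^ 2) with (IZR (v1 * v1 + v2 * v2)).
    - rewrite <- mult_IZR. apply IZR_le. nia.
    - rewrite plus_IZR, !mult_IZR. ring. }
  assert (l1 := Rmax_l 1 (Rpower (4 * C / (b - a)) 3)). assert (l2 := Rmax_r 1 (Rpower (4 * C / (b - a)) 3)).
  assert (q0 : 0 < 4 * C / (b - a)) by (apply Rmult_lt_0_compat; [lra|apply Rinv_0_lt_compat; lra]).
  assert (Rp : Rpower lam (- (1 / 3)) <= / (4 * C / (b - a))).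
  { rewrite Rpower_Ropp. apply Rinv_le_contravar; [assumption|].
    rewrite <- (Rpower_1 (4 * C / (b - a))) by assumption.
    replace 1 with (3 * (1 / 3)) at 1 by field. rewrite <- Rpower_mult.
    apply Rle_Rpower_l; [lra|]. split; [apply exp_pos|lra]. }
  assert (B : forall th, RInt (wave g1 g2 (IZR v1) (IZR v2) th) a b ^ 2 <= ((b - a) / 4) ^ 2).
  { intros th. rewrite <- (pow2_abs (RInt _ _ _)). apply pow_incr. split; [apply Rabs_pos|].
    eapply Rle_trans; [apply (HC _ _ lam); lra|].
    apply Rle_trans with (C * / (4 * C / (b - a))); [apply Rmult_le_compat_l; lra|]. right. field. lra. }
  pose proof (B 0). pose proof (B (- (PI / 2))).
  apply Rle_trans with ((b - a) ^ 2 / 4); [nra|].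
  rewrite Rpow_mult_distr. assert (0 < (b - a) ^ 2) by (apply pow_lt; lra).
  apply Rle_trans with (/ 4 * (b - a) ^ 2); [lra|].
  apply Rmult_le_compat_r; [lra|]. assert (0 <= (1 / 2 - k) * (3 / 2 - k)) by (apply Rmult_le_pos; lra). lra.
Qed.

(** * Mean square on a curved arc *)

Definition lsum {A : Type} (l : list A) (F : A -> R) : R := fold_right Rplus 0 (map F l).

Lemma lsum_cons {A : Type} (x : A) (l : list A) (F : A -> R) : lsum (x :: l) F = F x + lsum l F.
Proof. reflexivity. Qed.

Lemma lsum_ext {A : Type} (l : list A) (F G : A -> R) :
  (forall x, In x l -> F x = G x) -> lsum l F = lsum l G.
Proof.
  induction l as [|x l IH]; intros H; [reflexivity|]. rewrite !lsum_cons.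
  rewrite (H x (or_introl eq_refl)), IH; [reflexivity|]. intros y Hy. apply H. now right.
Qed.

Lemma lsum_le {A : Type} (l : list A) (F G : A -> R) :
  (forall x, In x l -> F x <= G x) -> lsum l F <= lsum l G.
Proof.
  induction l as [|x l IH]; intros H; [apply Rle_refl|]. rewrite !lsum_cons.
  apply Rplus_le_compat; [apply H; now left|apply IH; intros y Hy; apply H; now right].
Qed.

Lemma lsum_plus {A : Type} (l : list A) (F G : A -> R) :
  lsum l (fun x => F x + G x) = lsum l F + lsum l G.
Proof. induction l as [|x l IH]; [unfold lsum; simpl; ring|]. rewrite !lsum_cons, IH. ring. Qed.

Lemma lsum_scal {A : Type} (l : list A) (k : R) (F : A -> R) :
  lsum l (fun x => k * F x) = k * lsum l F.
Proof. induction l as [|x l IH]; [unfold lsum; simpl; ring|]. rewrite !lsum_cons, IH. ring. Qed.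

Lemma lsum_const {A : Type} (l : list A) (k : R) : lsum l (fun _ => k) = k * INR (length l).
Proof.
  induction l as [|x l IH]; [unfold lsum; simpl; ring|]. rewrite lsum_cons, IH.
  simpl length. rewrite S_INR. ring.
Qed.

Lemma lsum_nonneg {A : Type} (l : list A) (F : A -> R) :
  (forall x, In x l -> 0 <= F x) -> 0 <= lsum l F.
Proof.
  intros H. apply Rle_trans with (lsum l (fun _ => 0)); [|now apply lsum_le].
  rewrite lsum_const. lra.
Qed.

Lemma lsum_abs {A : Type} (l : list A) (F : A -> R) : Rabs (lsum l F) <= lsum l (fun x => Rabs (F x)).
Proof.
  induction l as [|x l IH]; [unfold lsum; simpl; rewrite Rabs_R0; lra|].
  rewrite !lsum_cons. eapply Rle_trans; [apply Rabs_triang|]. lra.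
Qed.

Lemma lsum_exchange {A B : Type} (l : list A) (m : list B) (F : A -> B -> R) :
  lsum l (fun x => lsum m (F x)) = lsum m (fun y => lsum l (fun x => F x y)).
Proof.
  induction l as [|x l IH].
  - unfold lsum at 1. simpl. symmetry. erewrite lsum_ext; [|intros; unfold lsum; simpl; reflexivity].
    rewrite lsum_const. ring.
  - rewrite lsum_cons, IH, <- lsum_plus. reflexivity.
Qed.

Lemma lsum_mult {A B : Type} (l : list A) (m : list B) (F : A -> R) (G : B -> R) :
  lsum l F * lsum m G = lsum l (fun x => lsum m (fun y => F x * G y)).
Proof.
  rewrite Rmult_comm, <- lsum_scal. apply lsum_ext. intros x _. now rewrite lsum_scal, Rmult_comm.
Qed.

Lemma lsum_square_le {A : Type} (l : list A) (F : A -> R) :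
  lsum l F ^ 2 <= INR (length l) * lsum l (fun x => F x ^ 2).
Proof.
  replace (lsum l F ^ 2) with (lsum l F * lsum l F) by ring. rewrite lsum_mult.
  apply Rle_trans with (lsum l (fun x => lsum l (fun y => / 2 * F x ^ 2 + / 2 * F y ^ 2))).
  - apply lsum_le. intros x _. apply lsum_le. intros y _. pose proof (pow2_ge_0 (F x - F y)). lra.
  - right. erewrite lsum_ext; [|intros x _; rewrite lsum_plus, lsum_const, lsum_scal; reflexivity].
    rewrite lsum_plus, lsum_const.
    erewrite (lsum_ext l (fun x => / 2 * F x ^ 2 * INR (length l))).
    2:{ intros x _. rewrite (Rmult_comm (/ 2)), Rmult_assoc, Rmult_comm. reflexivity. }
    rewrite lsum_scal. field.
Qed.

Lemma is_RInt_lsum {A : Type} (l : list A) (F : A -> R -> R) (I : A -> R) (a b : R) :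
  (forall x, In x l -> is_RInt (F x) a b (I x)) ->
  is_RInt (fun t => lsum l (fun x => F x t)) a b (lsum l I).
Proof.
  induction l as [|x l IH]; intros H.
  - pose proof (is_RInt_const a b (0 : R)) as H0. change (scal (b - a) (0 : R)) with ((b - a) * 0) in H0.
    rewrite Rmult_0_r in H0. exact H0.
  - rewrite lsum_cons. apply (is_RInt_plus (F x)); [apply H; now left|].
    apply IH. intros y Hy. apply H. now right.
Qed.

(** Serves for the row sums in Schur's test, where the selected entry is the possible close
    neighbour. *)
Lemma lsum_single_large {A : Type} (l : list A) (P : A -> bool) (F : A -> R) (M e : R) :
  NoDup l -> 0 <= M -> 0 <= e ->
  (forall x y, In x l -> In y l -> P x = true -> P y = true -> x = y) ->
  (forall x, In x l -> F x <= if P x then M else e) ->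
  lsum l F <= M + e * INR (length l).
Proof.
  intros nd M0 e0. induction nd as [|x l nx nd IH]; intros HP HF.
  - unfold lsum; simpl. lra.
  - rewrite lsum_cons. simpl length. rewrite S_INR.
    pose proof (HF x (or_introl eq_refl)) as Hx. destruct (P x) eqn:Px.
    + assert (lsum l F <= lsum l (fun _ => e)).
      { apply lsum_le. intros y Hy. specialize (HF y (or_intror Hy)). destruct (P y) eqn:Py; [|assumption].
        exfalso. apply nx. rewrite (HP x y); [assumption|now left|now right|assumption|assumption]. }
      rewrite lsum_const in H. lra.
    + assert (lsum l F <= M + e * INR (length l)); [|lra].
      apply IH; intros; [apply HP|apply HF]; auto; now right.
Qed.

Lemma lsum_delta {A : Type} (dec : forall x y : A, {x = y} + {x <> y}) (l : list A) (x : A) (k : R) :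
  NoDup l -> In x l -> lsum l (fun y => if dec x y then k else 0) = k.
Proof.
  induction l as [|z l IH]; intros nd Hin; [destruct Hin|].
  inversion nd as [|? ? nz nd']; subst. rewrite lsum_cons. destruct (dec x z) as [->|n].
  - assert (lsum l (fun y => if dec z y then k else 0) = lsum l (fun _ => 0)).
    { apply lsum_ext. intros y Hy. destruct (dec z y) as [->|]; [contradiction|reflexivity]. }
    rewrite H, lsum_const. ring.
  - destruct Hin as [->|Hin]; [contradiction|]. rewrite IH; [ring|assumption|assumption].
Qed.

Lemma Rpower_neg_small (d e : R) : 0 < d -> 0 < e -> exists E0 : nat, (0 < E0)%nat /\
  forall E : nat, (E0 <= E)%nat -> Rpower (INR E) (- d) <= e.
Proof.
  intros d0 e0. destruct (INR_unbounded (Rpower (/ e) (/ d))) as [N HN].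
  assert (P := exp_pos (/ d * ln (/ e))). fold (Rpower (/ e) (/ d)) in P.
  exists N. split; [apply INR_lt; simpl; lra|]. intros E HE. apply le_INR in HE.
  rewrite Rpower_Ropp. rewrite <- (Rinv_inv e). apply Rinv_le_contravar; [now apply Rinv_0_lt_compat|].
  replace (/ e) with (Rpower (Rpower (/ e) (/ d)) d).
  - apply Rle_Rpower_l; lra.
  - rewrite Rpower_mult, Rinv_l by lra. apply Rpower_1. now apply Rinv_0_lt_compat.
Qed.

(** * The restricted exponential sum and its quadratic form *)

Definition xwave (g1 g2 : R -> R) (xi : Z * Z) (th t : R) : R :=
  wave g1 g2 (IZR (fst xi)) (IZR (snd xi)) th t.

Definition re_sum (l : list (Z * Z)) (g1 g2 : R -> R) (c : Z * Z -> C) (t : R) : R :=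
  lsum l (fun xi => Re (c xi) * xwave g1 g2 xi 0 t - Im (c xi) * xwave g1 g2 xi (- (PI / 2)) t).

Definition im_sum (l : list (Z * Z)) (g1 g2 : R -> R) (c : Z * Z -> C) (t : R) : R :=
  lsum l (fun xi => Re (c xi) * xwave g1 g2 xi (- (PI / 2)) t + Im (c xi) * xwave g1 g2 xi 0 t).

Definition nrm (c : Z * Z -> C) (xi : Z * Z) : R := sqrt (Re (c xi) ^ 2 + Im (c xi) ^ 2).

Definition energy (l : list (Z * Z)) (c : Z * Z -> C) : R := lsum l (fun xi => nrm c xi ^ 2).

Lemma nrm_sq (c : Z * Z -> C) (xi : Z * Z) : nrm c xi ^ 2 = Re (c xi) ^ 2 + Im (c xi) ^ 2.
Proof. apply pow2_sqrt. pose proof (pow2_ge_0 (Re (c xi))). pose proof (pow2_ge_0 (Im (c xi))). lra. Qed.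

Definition zdiff (xi eta : Z * Z) : Z * Z := (fst xi - fst eta, snd xi - snd eta)%Z.

(** The modulus of the complex sum is expanded, because it involves only the differences xi - eta;
    the square of the real part would bring in the sums xi + eta as well. For an eigenfunction
    [im_sum] is zero, so both squares agree. *)
Lemma modulus_expansion (l : list (Z * Z)) (g1 g2 : R -> R) (c : Z * Z -> C) (t : R) :
  re_sum l g1 g2 c t ^ 2 + im_sum l g1 g2 c t ^ 2 =
  lsum l (fun xi => lsum l (fun eta =>
    (Re (c xi) * Re (c eta) + Im (c xi) * Im (c eta)) * xwave g1 g2 (zdiff xi eta) 0 t
    - (Im (c xi) * Re (c eta) - Re (c xi) * Im (c eta)) * xwave g1 g2 (zdiff xi eta) (- (PI / 2)) t)).
Proof.
  unfold re_sum, im_sum. rewrite <- !Rsqr_pow2. unfold Rsqr. rewrite !lsum_mult, <- lsum_plus.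
  apply lsum_ext. intros xi _. rewrite <- lsum_plus. apply lsum_ext. intros eta _.
  unfold xwave. rewrite !sin_wave, !cos_wave.
  assert (E : phase g1 g2 (IZR (fst (zdiff xi eta))) (IZR (snd (zdiff xi eta))) t =
    phase g1 g2 (IZR (fst xi)) (IZR (snd xi)) t - phase g1 g2 (IZR (fst eta)) (IZR (snd eta)) t).
  { unfold phase, zdiff. simpl. rewrite !minus_IZR. ring. }
  rewrite E, cos_minus, sin_minus. ring.
Qed.

Definition normsq (v : Z * Z) : Z := (fst v * fst v + snd v * snd v)%Z.

(** The condition |v| < E^(1/6), written in integers as |v|^6 < E, in the form the determinant
    argument uses. *)
Definition closeb (E : nat) (v : Z * Z) : bool := Z.ltb (normsq v ^ 3) (Z.of_nat E).

Lemma pair_eq_dec (xi eta : Z * Z) : {xi = eta} + {xi <> eta}.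
Proof. decide equality; apply Z.eq_dec. Qed.

Lemma at_most_one_close (E : nat) (xi eta zeta : Z * Z) : (0 < E)%nat ->
  In xi (lattice_pts E) -> In eta (lattice_pts E) -> In zeta (lattice_pts E) ->
  xi <> eta -> xi <> zeta -> closeb E (zdiff xi eta) = true -> closeb E (zdiff xi zeta) = true ->
  eta = zeta.
Proof.
  destruct xi as [x y], eta as [x1 y1], zeta as [x2 y2]. intros E0 H0 H1 H2 n1 n2 c1 c2.
  apply lattice_pts_norm in H0, H1, H2. apply Z.ltb_lt in c1, c2. unfold normsq, zdiff in c1, c2. simpl fst in *; simpl snd in *.
  assert (Hp : forall p q, (x, y) <> (p, q) -> (0 < (p - x) * (p - x) + (q - y) * (q - y))%Z).
  { clear. intros p q n. pose proof (Z.square_nonneg (p - x)). pose proof (Z.square_nonneg (q - y)).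
    assert (sq : forall d, (d * d = 0 -> d = 0)%Z) by (intros d e; apply Z.mul_eq_0 in e; tauto).
    destruct (Z.eq_dec ((p - x) * (p - x) + (q - y) * (q - y)) 0) as [e|]; [exfalso|lia].
    apply n. f_equal; [specialize (sq (p - x)%Z)|specialize (sq (q - y)%Z)]; lia. }
  specialize (Hp x1 y1 n1) as p1. specialize (Hp x2 y2 n2) as p2.
  replace ((x - x1) * (x - x1) + (y - y1) * (y - y1))%Z with ((x1 - x) * (x1 - x) + (y1 - y) * (y1 - y))%Z in c1 by ring.
  replace ((x - x2) * (x - x2) + (y - y2) * (y - y2))%Z with ((x2 - x) * (x2 - x) + (y2 - y) * (y2 - y))%Z in c2 by ring.
  destruct (close_points_on_circle (Z.of_nat E) x y (x1 - x) (y1 - y) (x2 - x) (y2 - y)) as [e1 e2];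
    [lia|assumption| | |assumption|assumption|assumption|assumption|f_equal; lia].
  - now replace (x + (x1 - x))%Z with x1 by ring; replace (y + (y1 - y))%Z with y1 by ring.
  - now replace (x + (x2 - x))%Z with x2 by ring; replace (y + (y2 - y))%Z with y2 by ring.
Qed.

(** The right-hand side is the real part of c times the conjugate of c' times X + iY, of modulus at
    most n n' k; then n n' is at most the mean of the squares. *)
Lemma cross_term_bound (A B A' B' X Y n n' k : R) : 0 <= k -> 0 <= n -> 0 <= n' ->
  n ^ 2 = A ^ 2 + B ^ 2 -> n' ^ 2 = A' ^ 2 + B' ^ 2 -> X ^ 2 + Y ^ 2 <= k ^ 2 ->
  - (k * (n ^ 2 + n' ^ 2) / 2) <= (A * A' + B * B') * X - (B * A' - A * B') * Y.
Proof.
  intros k0 n0 n0' En En' HXY.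
  set (P := A * A' + B * B'). set (Q := B * A' - A * B').
  assert (PQ : P ^ 2 + Q ^ 2 = (n * n') ^ 2).
  { rewrite Rpow_mult_distr, En, En'. unfold P, Q. ring. }
  assert (Rabs (P * X - Q * Y) <= n * n' * k).
  { apply Rsqr_incr_0_var; [|repeat apply Rmult_le_pos; assumption].
    rewrite <- Rsqr_abs, !Rsqr_pow2. rewrite (Rpow_mult_distr (n * n')), <- PQ.
    apply Rle_trans with ((P ^ 2 + Q ^ 2) * (X ^ 2 + Y ^ 2)).
    - pose proof (pow2_ge_0 (P * Y + Q * X)). lra.
    - apply Rmult_le_compat_l; [|assumption]. pose proof (pow2_ge_0 P). pose proof (pow2_ge_0 Q). lra. }
  apply Rabs_le_between in H. pose proof (pow2_ge_0 (n - n')).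
  assert (0 <= k * (n - n') ^ 2) by (now apply Rmult_le_pos). lra.
Qed.

(* Schur's test: the diagonal beats the off-diagonal because every frequency has at most one close
   neighbour, whose coefficient is smaller than the diagonal one by a fixed factor, while the
   coefficients of the other pairs decay like a power of E and r_2(E) = O(E^eps). *)
Lemma restriction_lower_bound (l u a b : R) (g1 g2 : R -> R) :
  l < a -> a < b -> b < u -> curved_arc l u g1 g2 ->
  exists (kap : R) (E0 : nat), 0 < kap /\ (0 < E0)%nat /\
    forall (E : nat) (c : Z * Z -> C), (E0 <= E)%nat ->
      kap * energy (lattice_pts E) c <=
      RInt (fun t => re_sum (lattice_pts E) g1 g2 c t ^ 2 + im_sum (lattice_pts E) g1 g2 c t ^ 2) a b.
Proof.
  intros la ab bu Hc.
  destruct (wave_gap l u a b g1 g2 la ab bu Hc) as (k & [k0 k1] & Hk).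
  destruct (wave_decay l u a b g1 g2 ltac:(lra) bu Hc) as (D & D0 & HD).
  (* A pair at distance at least E^(1/6) contributes O(E^(-1/18)). Summing over N = O(E^(1/36)) of
     them leaves E^(-1/36), which beats half the gap for large E. *)
  destruct (lattice_pts_bound (1 / 36)) as (CN & CN0 & HN); [lra|].
  destruct (Rpower_neg_small (1 / 36) (k * (b - a) / 2 / (2 * D * CN))) as (E0 & E00 & HE0); [lra| |].
  { apply Rmult_lt_0_compat; [apply Rmult_lt_0_compat; [apply Rmult_lt_0_compat|]; lra|].
    apply Rinv_0_lt_compat. apply Rmult_lt_0_compat; lra. }
  exists (k * (b - a) / 2), E0. split; [apply Rmult_lt_0_compat; [apply Rmult_lt_0_compat|]; lra|].
  split; [assumption|]. intros E c HE.
  assert (Epos : (0 < E)%nat) by lia.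
  assert (EI : 1 <= INR E) by (apply (le_INR 1); lia).
  set (L := lattice_pts E).
  set (X := fun v => RInt (xwave g1 g2 v 0) a b).
  set (Y := fun v => RInt (xwave g1 g2 v (- (PI / 2))) a b).
  set (e := 2 * D * Rpower (INR E) (- (1 / 18))).
  assert (e0 : 0 < e) by (apply Rmult_lt_0_compat; [lra|apply exp_pos]).
  (* Majorant of the off-diagonal integrals: the uniform gap for a close pair, the decay bound for
     the others. *)
  set (w := fun xi eta => if pair_eq_dec xi eta then 0 else if closeb E (zdiff xi eta) then (1 - k) * (b - a) else e).
  assert (M0 : 0 <= (1 - k) * (b - a)) by (apply Rmult_le_pos; lra).
  assert (w0 : forall xi eta, 0 <= w xi eta).
  { intros xi eta. unfold w. destruct (pair_eq_dec xi eta); [lra|]. destruct (closeb _ _); lra. }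
  assert (wsym : forall xi eta, w xi eta = w eta xi).
  { intros xi eta. unfold w, closeb, normsq, zdiff. simpl fst; simpl snd.
    replace ((fst xi - fst eta) * (fst xi - fst eta) + (snd xi - snd eta) * (snd xi - snd eta))%Z
      with ((fst eta - fst xi) * (fst eta - fst xi) + (snd eta - snd xi) * (snd eta - snd xi))%Z by ring.
    destruct (pair_eq_dec xi eta), (pair_eq_dec eta xi); congruence. }
  assert (wb : forall xi eta, xi <> eta -> X (zdiff xi eta) ^ 2 + Y (zdiff xi eta) ^ 2 <= w xi eta ^ 2).
  { intros xi eta n. unfold w. destruct (pair_eq_dec xi eta); [contradiction|].
    destruct (closeb E (zdiff xi eta)) eqn:cl.
    - refine (Hk _ _ _). unfold zdiff; simpl. intros [h1 h2]. apply n. destruct xi, eta; simpl in *. f_equal; lia.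
    - apply Z.ltb_ge in cl. set (v := zdiff xi eta) in *.
      set (lam := sqrt (IZR (fst v) ^ 2 + IZR (snd v) ^ 2)).
      assert (P1 := pow2_ge_0 (IZR (fst v))). assert (P2 := pow2_ge_0 (IZR (snd v))).
      assert (lam2 : lam ^ 2 = IZR (fst v) ^ 2 + IZR (snd v) ^ 2) by (apply pow2_sqrt; lra).
      assert (lamZ : lam ^ 2 = IZR (normsq v)).
      { rewrite lam2. unfold normsq. rewrite plus_IZR, !mult_IZR. ring. }
      assert (lam0 : 0 <= lam) by apply sqrt_pos.
      assert (lam6 : INR E <= lam ^ 6).
      { replace (lam ^ 6) with ((lam ^ 2) ^ 3) by ring. rewrite lamZ, INR_IZR_INZ.
        replace (IZR (normsq v) ^ 3) with (IZR (normsq v ^ 3)); [now apply IZR_le|].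
        replace (normsq v ^ 3)%Z with (normsq v * normsq v * normsq v)%Z by ring. rewrite !mult_IZR. ring. }
      assert (lam1 : 1 <= lam).
      { destruct (Rle_or_lt 1 lam) as [|lt]; [assumption|].
        assert (lam ^ 5 <= 1) by (rewrite <- (pow1 5); apply pow_incr; lra).
        assert (0 <= lam ^ 5) by (apply pow_le; lra).
        replace (lam ^ 6) with (lam * lam ^ 5) in lam6 by ring. nra. }
      assert (Rq : Rpower lam (- (1 / 3)) <= Rpower (INR E) (- (1 / 18))).
      { rewrite !Rpower_Ropp. apply Rinv_le_contravar; [apply exp_pos|].
        apply Rle_trans with (Rpower (lam ^ 6) (1 / 18)); [apply Rle_Rpower_l; lra|].
        rewrite <- Rpower_pow by lra. rewrite Rpower_mult. right. f_equal. simpl. lra. }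
      assert (B : forall th, RInt (wave g1 g2 (IZR (fst v)) (IZR (snd v)) th) a b ^ 2 <= (D * Rpower (INR E) (- (1 / 18))) ^ 2).
      { intros th. rewrite <- (pow2_abs (RInt _ _ _)). apply pow_incr. split; [apply Rabs_pos|].
        eapply Rle_trans; [apply (HD _ _ lam); assumption|]. apply Rmult_le_compat_l; lra. }
      eapply Rle_trans; [exact (Rplus_le_compat _ _ _ _ (B 0) (B (- (PI / 2))))|].
      unfold e. rewrite (Rmult_assoc 2 D). set (x := D * Rpower (INR E) (- (1 / 18))).
      pose proof (pow2_ge_0 x). lra. }
  assert (row : forall xi, In xi L -> lsum L (w xi) <= (1 - k / 2) * (b - a)).
  { intros xi Hxi. apply Rle_trans with ((1 - k) * (b - a) + e * INR (length L)).
    - apply (lsum_single_large L (fun eta => if pair_eq_dec xi eta then false else closeb E (zdiff xi eta)));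
        [apply lattice_pts_NoDup|assumption|lra| |].
      + intros eta zeta He Hz. destruct (pair_eq_dec xi eta), (pair_eq_dec xi zeta); try discriminate.
        now apply at_most_one_close.
      + intros eta _. unfold w. destruct (pair_eq_dec xi eta); [lra|]. destruct (closeb _ _); lra.
    - assert (e * INR (length L) <= k * (b - a) / 2); [|lra].
      specialize (HN E Epos). fold L in HN. specialize (HE0 E HE).
      assert (0 < 2 * D * CN) by (apply Rmult_lt_0_compat; lra).
      apply Rle_trans with (e * (CN * Rpower (INR E) (1 / 36))); [apply Rmult_le_compat_l; lra|].
      apply Rle_trans with (2 * D * CN * Rpower (INR E) (- (1 / 36))).
      + right. unfold e. replace (- (1 / 36)) with (- (1 / 18) + 1 / 36) by lra. rewrite Rpower_plus. ring.
      + apply Rle_trans with (2 * D * CN * (k * (b - a) / 2 / (2 * D * CN))); [apply Rmult_le_compat_l; lra|].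
        right. field. lra. }
  assert (HI : is_RInt (fun t => re_sum L g1 g2 c t ^ 2 + im_sum L g1 g2 c t ^ 2) a b
    (lsum L (fun xi => lsum L (fun eta =>
      (Re (c xi) * Re (c eta) + Im (c xi) * Im (c eta)) * X (zdiff xi eta)
      - (Im (c xi) * Re (c eta) - Re (c xi) * Im (c eta)) * Y (zdiff xi eta))))).
  { eapply is_RInt_ext; [intros t _; symmetry; apply modulus_expansion|].
    apply is_RInt_lsum. intros xi _. apply is_RInt_lsum. intros eta _.
    apply (is_RInt_minus (fun t => _ * xwave g1 g2 (zdiff xi eta) 0 t));
      [apply (is_RInt_scal (xwave g1 g2 (zdiff xi eta) 0))|apply (is_RInt_scal (xwave g1 g2 (zdiff xi eta) (- (PI / 2))))];
      apply (wave_RInt_correct l u); lra || assumption. }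
  rewrite (is_RInt_unique _ _ _ _ HI).
  set (n := nrm c). assert (n0 : forall xi, 0 <= n xi) by (intros; apply sqrt_pos).
  (* Each off-diagonal weight is shared equally between the energies of its two frequencies.
     Exchanging the sums and using the symmetry of [w] turns both halves into row sums. *)
  apply Rle_trans with (lsum L (fun xi => lsum L (fun eta =>
    (if pair_eq_dec xi eta then n xi ^ 2 * (b - a) else 0) + - / 2 * (w xi eta * n xi ^ 2) + - / 2 * (w xi eta * n eta ^ 2)))).
  - erewrite (lsum_ext L); [|intros xi Hxi; rewrite !lsum_plus, !lsum_scal, lsum_delta by (apply lattice_pts_NoDup || assumption); reflexivity].
    rewrite !lsum_plus, !lsum_scal.
    rewrite (lsum_exchange L L (fun xi eta => w xi eta * n eta ^ 2)).
    erewrite (lsum_ext L (fun eta => lsum L (fun xi => w xi eta * n eta ^ 2))).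
    2:{ intros eta _. apply lsum_ext. intros xi _. rewrite wsym. reflexivity. }
    assert (S : lsum L (fun xi => lsum L (fun eta => w xi eta * n xi ^ 2)) <= (1 - k / 2) * (b - a) * energy L c).
    { unfold energy. rewrite <- lsum_scal. apply lsum_le. intros xi Hxi.
      erewrite lsum_ext; [|intros eta _; rewrite Rmult_comm; reflexivity]. rewrite lsum_scal, Rmult_comm.
      apply Rmult_le_compat_r; [apply pow2_ge_0|now apply row]. }
    erewrite (lsum_ext L (fun xi => n xi ^ 2 * (b - a))); [|intros xi _; rewrite Rmult_comm; reflexivity].
    rewrite lsum_scal. change (energy L c) with (lsum L (fun xi => n xi ^ 2)) in *.
    set (A := lsum L (fun xi => n xi ^ 2)) in *.
    set (B := lsum L (fun xi => lsum L (fun eta => w xi eta * n xi ^ 2))) in *.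
    change (k * (b - a) / 2 * A <= (b - a) * A + - / 2 * B + - / 2 * B). lra.
  - apply lsum_le. intros xi _. apply lsum_le. intros eta _.
    destruct (pair_eq_dec xi eta) as [<-|ne].
    + unfold w. destruct (pair_eq_dec xi xi); [|contradiction].
      assert (zd : zdiff xi xi = (0, 0)%Z) by (unfold zdiff; f_equal; lia).
      assert (X0 : X (zdiff xi xi) = b - a).
      { unfold X. rewrite zd. rewrite (RInt_ext _ (fun _ => 1)).
        - rewrite RInt_const. change ((b - a) * 1 = b - a). ring.
        - intros t _. unfold xwave. rewrite cos_wave. rewrite <- cos_0. apply (f_equal cos). unfold phase. simpl. ring. }
      rewrite X0. unfold n. rewrite nrm_sq. right. ring.
    + pose proof (cross_term_bound (Re (c xi)) (Im (c xi)) (Re (c eta)) (Im (c eta)) (X (zdiff xi eta)) (Y (zdiff xi eta))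
        (n xi) (n eta) (w xi eta) (w0 _ _) (n0 _) (n0 _) (nrm_sq c xi) (nrm_sq c eta) (wb _ _ ne)) as T.
      lra.
Qed.

(** * Upper bound for the number of zeros *)

Lemma cexpi_phase (g1 g2 : R -> R) (xi : Z * Z) (t : R) :
  cexpi (2 * PI * (g1 t * IZR (fst xi) + g2 t * IZR (snd xi))) =
  (xwave g1 g2 xi 0 t, xwave g1 g2 xi (- (PI / 2)) t).
Proof. unfold cexpi, xwave. rewrite cos_wave, sin_wave. reflexivity. Qed.

Lemma eigen_sum_curve (E : nat) (c : Z * Z -> C) (g1 g2 : R -> R) (t : R) :
  eigen_sum E c (g1 t, g2 t) =
  (re_sum (lattice_pts E) g1 g2 c t, im_sum (lattice_pts E) g1 g2 c t).
Proof.
  unfold eigen_sum, re_sum, im_sum. induction (lattice_pts E) as [|xi l IH]; [reflexivity|].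
  rewrite !lsum_cons. cbn [map fold_right]. rewrite IH. cbn [fst snd]. rewrite cexpi_phase.
  reflexivity.
Qed.

Lemma eigen_sum_red (E : nat) (c : Z * Z -> C) (x : R * R) : eigen_sum E c (red x) = eigen_sum E c x.
Proof.
  unfold eigen_sum. f_equal. apply map_ext. intros xi. f_equal. unfold red, frac_part. cbn [fst snd].
  set (i := Int_part (fst x)). set (j := Int_part (snd x)).
  assert (E0 : 2 * PI * (fst x * IZR (fst xi) + snd x * IZR (snd xi)) =
    2 * PI * ((fst x - IZR i) * IZR (fst xi) + (snd x - IZR j) * IZR (snd xi))
      + 2 * IZR (i * fst xi + j * snd xi) * PI).
  { rewrite plus_IZR, !mult_IZR. ring. }
  unfold cexpi. rewrite E0. generalize (i * fst xi + j * snd xi)%Z. intros k.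
  set (th := 2 * PI * _).
  assert (Hs : sin (IZR k * PI) = 0) by (apply sin_eq_0_1; now exists k).
  assert (Hc : cos (2 * IZR k * PI) = 1).
  { replace (2 * IZR k * PI) with (2 * (IZR k * PI)) by ring. rewrite cos_2a_sin, Hs. ring. }
  assert (Hs2 : sin (2 * IZR k * PI) = 0).
  { replace (2 * IZR k * PI) with (2 * (IZR k * PI)) by ring. rewrite sin_2a, Hs. ring. }
  rewrite cos_plus, sin_plus, Hc, Hs2. f_equal; ring.
Qed.

Lemma energy_pos (E : nat) (c : Z * Z -> C) : is_eigenfunction E c -> 0 < energy (lattice_pts E) c.
Proof.
  intros [_ [x Hx]].
  assert (H0 : 0 <= energy (lattice_pts E) c) by (apply lsum_nonneg; intros; apply pow2_ge_0).
  destruct H0 as [|e]; [assumption|exfalso]. apply Hx. clear Hx. symmetry in e. unfold energy in e.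
  unfold eigen_sum. induction (lattice_pts E) as [|xi l IH]; [reflexivity|].
  rewrite lsum_cons in e.
  assert (P1 : 0 <= nrm c xi ^ 2) by apply pow2_ge_0.
  assert (P2 : 0 <= lsum l (fun xi => nrm c xi ^ 2)) by (apply lsum_nonneg; intros; apply pow2_ge_0).
  cbn [map fold_right]. rewrite IH by lra.
  assert (N : Re (c xi) ^ 2 + Im (c xi) ^ 2 = 0) by (rewrite <- nrm_sq; lra).
  pose proof (pow2_ge_0 (Re (c xi))). pose proof (pow2_ge_0 (Im (c xi))).
  assert (R0 : Re (c xi) = 0) by (apply Rsqr_eq_0; rewrite Rsqr_pow2; lra).
  assert (I0 : Im (c xi) = 0) by (apply Rsqr_eq_0; rewrite Rsqr_pow2; lra).
  replace (c xi) with (RtoC 0).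
  - rewrite Cmult_0_l. apply Cplus_0_l.
  - destruct (c xi) as [p q]. simpl in R0, I0. now subst.
Qed.

(** * Taylor series of the restricted eigenfunction *)

Lemma ex_pseries_cv_radius (c : nat -> R) (x r : R) : 0 < x < r ->
  (forall h, Rabs h < r -> ex_pseries c h) -> Rbar_lt (Finite x) (CV_radius c).
Proof.
  intros Hx H. apply Rbar_not_le_lt. intros L.
  assert (L2 : Rbar_lt (CV_radius c) (Finite (Rabs ((x + r) / 2)))).
  { eapply Rbar_le_lt_trans; [exact L|]. simpl. rewrite Rabs_pos_eq; lra. }
  apply CV_disk_outside in L2. apply L2.
  assert (ex : ex_pseries c ((x + r) / 2)) by (apply H; rewrite Rabs_pos_eq; lra).
  apply (proj1 (ex_pseries_R c ((x + r) / 2))), ex_series_lim_0 in ex. exact ex.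
Qed.

Lemma cv_radius_coef_bound (c : nat -> R) (x : R) : 0 < x -> Rbar_lt (Finite x) (CV_radius c) ->
  exists M : R, 0 <= M /\ forall k, Rabs (c k) <= M / x ^ k.
Proof.
  intros x0 cv. rewrite <- (Rabs_pos_eq x) in cv by lra.
  apply CV_disk_inside in cv. apply ex_series_lim_0 in cv.
  destruct (filterlim_bounded (fun n => Rabs (c n * x ^ n))) as [M HM].
  { exists 0. exact cv. }
  exists (Rabs M). split; [apply Rabs_pos|]. intros k. specialize (HM k).
  change (Rabs (Rabs (c k * x ^ k)) <= M) in HM. rewrite Rabs_Rabsolu, Rabs_mult in HM.
  assert (p : 0 < x ^ k) by (apply pow_lt; lra). rewrite (Rabs_pos_eq (x ^ k)) in HM by lra.
  apply (Rmult_le_reg_r (x ^ k)); [assumption|]. replace (Rabs M / x ^ k * x ^ k) with (Rabs M) by (field; lra).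
  pose proof (Rle_abs M). lra.
Qed.

Lemma pseries_derive_bound (c : nat -> R) (r : R) : 0 < r ->
  (forall h, Rabs h < r -> ex_pseries c h) ->
  exists M : R, 0 <= M /\ forall k, Rabs (PS_derive c k) <= M / (r / 2) ^ k.
Proof.
  intros r0 H. apply cv_radius_coef_bound; [lra|]. rewrite CV_radius_derive.
  apply ex_pseries_cv_radius with r; [lra|assumption].
Qed.

Lemma nrm_bounds (c : Z * Z -> C) (xi : Z * Z) : Rabs (Re (c xi)) <= nrm c xi /\ Rabs (Im (c xi)) <= nrm c xi.
Proof.
  unfold nrm. rewrite <- (sqrt_Rsqr_abs (Re (c xi))), <- (sqrt_Rsqr_abs (Im (c xi))).
  pose proof (pow2_ge_0 (Re (c xi))). pose proof (pow2_ge_0 (Im (c xi))).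
  split; apply sqrt_le_1_alt; rewrite Rsqr_pow2; lra.
Qed.

Lemma wave_power_series (c1 c2 : nat -> R) (g1 g2 : R -> R) (t0 r M1 M2 : R) (xi : Z * Z) (lam : R) :
  0 < r -> 0 <= M1 -> 0 <= M2 ->
  (forall k, Rabs (PS_derive c1 k) <= M1 / r ^ k) -> (forall k, Rabs (PS_derive c2 k) <= M2 / r ^ k) ->
  (forall h, Rabs h < r -> is_pseries c1 h (g1 (t0 + h)) /\ is_pseries c2 h (g2 (t0 + h))) ->
  0 <= lam -> Rabs (IZR (fst xi)) <= lam -> Rabs (IZR (snd xi)) <= lam ->
  exists c s : nat -> R,
    (forall k, Rabs (c k) <= exp (2 * PI * (M1 + M2) * r * lam) / (r / 2) ^ k) /\
    (forall k, Rabs (s k) <= exp (2 * PI * (M1 + M2) * r * lam) / (r / 2) ^ k) /\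
    forall h, Rabs h < r / 2 ->
      xwave g1 g2 xi 0 (t0 + h) = PSeries c h /\ xwave g1 g2 xi (- (PI / 2)) (t0 + h) = PSeries s h.
Proof.
  intros r0 M10 M20 B1 B2 H l0 L1 L2.
  set (p := PS_scal (2 * PI) (PS_plus (PS_scal (IZR (fst xi)) c1) (PS_scal (IZR (snd xi)) c2))).
  assert (P0 := PI_RGT_0).
  destruct (trig_power_series p (2 * PI * (M1 + M2) * lam) r) as (c & s & Hc & Hs & Hcs).
  - apply Rmult_le_pos; [apply Rmult_le_pos; lra|lra].
  - assumption.
  - intros k.
    assert (Ed : PS_derive p k = 2 * PI * (IZR (fst xi) * PS_derive c1 k + IZR (snd xi) * PS_derive c2 k)).
    { unfold PS_derive, p, PS_scal, PS_plus. change scal with Rmult. change plus with Rplus. simpl. ring. }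
    rewrite Ed, Rabs_mult, (Rabs_pos_eq (2 * PI)) by lra.
    apply Rle_trans with (2 * PI * (lam * (M1 / r ^ k) + lam * (M2 / r ^ k))); [|right; unfold Rdiv; ring].
    apply Rmult_le_compat_l; [lra|]. eapply Rle_trans; [apply Rabs_triang|]. rewrite !Rabs_mult.
    apply Rplus_le_compat; apply Rmult_le_compat; try apply Rabs_pos; auto.
  - exists c, s.
    replace (2 * PI * (M1 + M2) * r * lam) with (2 * PI * (M1 + M2) * lam * r) by ring.
    split; [exact Hc|split; [exact Hs|]]. intros h hr.
    assert (Ep : PSeries p h = phase g1 g2 (IZR (fst xi)) (IZR (snd xi)) (t0 + h)).
    { destruct (H h) as [H1 H2]; [lra|]. unfold p. rewrite PSeries_scal, PSeries_plus.
      - rewrite !PSeries_scal, (is_pseries_unique _ _ _ H1), (is_pseries_unique _ _ _ H2).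
        unfold phase. ring.
      - apply ex_pseries_scal; [apply Rmult_comm|eexists; exact H1].
      - apply ex_pseries_scal; [apply Rmult_comm|eexists; exact H2]. }
    unfold xwave. rewrite cos_wave, sin_wave, <- Ep. now apply Hcs.
Qed.

Lemma lattice_pts_radius (E : nat) (xi : Z * Z) : In xi (lattice_pts E) ->
  sqrt (INR E) ^ 2 = IZR (fst xi) ^ 2 + IZR (snd xi) ^ 2.
Proof.
  destruct xi as [x y]. intros H. apply lattice_pts_norm in H. simpl fst; simpl snd.
  rewrite pow2_sqrt by apply pos_INR. rewrite INR_IZR_INZ, <- H, plus_IZR, !mult_IZR. ring.
Qed.

(** The radius r and the rate Q come from the curve near t0 alone, since each frequency enters the
    phase linearly; this uniformity in E and in the coefficients is what the zero count rests on. *)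
Lemma re_sum_power_series (g1 g2 : R -> R) (t0 : R) :
  real_analytic_at g1 t0 -> real_analytic_at g2 t0 ->
  exists r Q : R, 0 < r /\ 0 <= Q /\ forall (E : nat) (c : Z * Z -> C), (0 < E)%nat ->
    exists a : nat -> R,
      (forall k, Rabs (a k) <= 2 * lsum (lattice_pts E) (nrm c) * exp (Q * sqrt (INR E)) / r ^ k) /\
      forall h, Rabs h < r -> re_sum (lattice_pts E) g1 g2 c (t0 + h) = PSeries a h.
Proof.
  intros (c1 & r1 & r10 & H1) (c2 & r2 & r20 & H2).
  set (r := Rmin r1 r2). assert (r0 : 0 < r) by (apply Rmin_glb_lt; assumption).
  assert (l1 : r <= r1) by apply Rmin_l. assert (l2 : r <= r2) by apply Rmin_r.
  assert (S1 : forall h, Rabs h < r -> is_pseries c1 h (g1 (t0 + h))).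
  { intros h hr. specialize (H1 (t0 + h)). replace (t0 + h - t0) with h in H1 by ring. apply H1. lra. }
  assert (S2 : forall h, Rabs h < r -> is_pseries c2 h (g2 (t0 + h))).
  { intros h hr. specialize (H2 (t0 + h)). replace (t0 + h - t0) with h in H2 by ring. apply H2. lra. }
  destruct (pseries_derive_bound c1 r r0) as (M1 & M10 & B1); [intros h hr; eexists; now apply S1|].
  destruct (pseries_derive_bound c2 r r0) as (M2 & M20 & B2); [intros h hr; eexists; now apply S2|].
  exists (r / 2 / 2), (2 * PI * (M1 + M2) * (r / 2)). assert (P0 := PI_RGT_0).
  split; [lra|]. split; [apply Rmult_le_pos; [apply Rmult_le_pos; lra|lra]|]. intros E c E0.
  set (lam := sqrt (INR E)). assert (lam0 : 0 < lam) by (apply sqrt_lt_R0, lt_0_INR; assumption).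
  set (K := exp (2 * PI * (M1 + M2) * (r / 2) * lam)).
  assert (Hl : forall xi, In xi (lattice_pts E) -> Rabs (IZR (fst xi)) <= lam /\ Rabs (IZR (snd xi)) <= lam).
  { intros xi Hxi. apply vector_coordinate_bounds; [assumption|now apply lattice_pts_radius]. }
  induction (lattice_pts E) as [|xi l IH].
  - exists (fun _ => 0). split.
    + intros k. rewrite Rabs_R0. unfold lsum; simpl. right. unfold Rdiv. ring.
    + intros h _. unfold re_sum, lsum. simpl. symmetry. apply PSeries_const_0.
  - destruct IH as (a' & Ba & Ha); [intros; apply Hl; now right|].
    destruct (Hl xi (or_introl eq_refl)) as [L1 L2].
    destruct (wave_power_series c1 c2 g1 g2 t0 (r / 2) M1 M2 xi lam) as (cc & ss & Bc & Bs & Hcs); try assumption; try lra.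
    { intros h hr. split; [apply S1|apply S2]; lra. }
    fold K in Bc, Bs. destruct (nrm_bounds c xi) as [N1 N2].
    assert (D1 : forall k, Rabs (PS_scal (Re (c xi)) cc k) <= nrm c xi * K / (r / 2 / 2) ^ k).
    { intros k. unfold PS_scal. change scal with Rmult. simpl. rewrite Rabs_mult. unfold Rdiv at 1. rewrite Rmult_assoc.
      apply Rmult_le_compat; try apply Rabs_pos; [assumption|apply Bc]. }
    assert (D2 : forall k, Rabs (PS_scal (Im (c xi)) ss k) <= nrm c xi * K / (r / 2 / 2) ^ k).
    { intros k. unfold PS_scal. change scal with Rmult. simpl. rewrite Rabs_mult. unfold Rdiv at 1. rewrite Rmult_assoc.
      apply Rmult_le_compat; try apply Rabs_pos; [assumption|apply Bs]. }
    assert (D3 : forall k, Rabs (PS_minus (PS_scal (Re (c xi)) cc) (PS_scal (Im (c xi)) ss) k) <= 2 * nrm c xi * K / (r / 2 / 2) ^ k).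
    { intros k. change (PS_minus (PS_scal (Re (c xi)) cc) (PS_scal (Im (c xi)) ss) k)
        with (PS_scal (Re (c xi)) cc k + - PS_scal (Im (c xi)) ss k).
      eapply Rle_trans; [apply Rabs_triang|]. rewrite Rabs_Ropp. specialize (D1 k). specialize (D2 k).
      replace (2 * nrm c xi * K / (r / 2 / 2) ^ k) with (nrm c xi * K / (r / 2 / 2) ^ k + nrm c xi * K / (r / 2 / 2) ^ k) by (unfold Rdiv; ring).
      lra. }
    exists (PS_plus (PS_minus (PS_scal (Re (c xi)) cc) (PS_scal (Im (c xi)) ss)) a'). split.
    + intros k. change (PS_plus ?u ?v k) with (u k + v k). rewrite lsum_cons.
      eapply Rle_trans; [apply Rabs_triang|]. specialize (D3 k). specialize (Ba k). fold lam in Ba. fold K in Ba.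
      replace (2 * (nrm c xi + lsum l (nrm c)) * K / (r / 2 / 2) ^ k)
        with (2 * nrm c xi * K / (r / 2 / 2) ^ k + 2 * lsum l (nrm c) * K / (r / 2 / 2) ^ k) by (unfold Rdiv; ring).
      lra.
    + intros h hr. unfold re_sum. rewrite lsum_cons. fold (re_sum l g1 g2 c (t0 + h)). rewrite (Ha h hr).
      destruct (Hcs h hr) as [-> ->].
      rewrite PSeries_plus, PSeries_minus, !PSeries_scal; [reflexivity| | | |].
      * eapply geometric_bound_ex with (3 := D1); lra.
      * eapply geometric_bound_ex with (3 := D2); lra.
      * eapply geometric_bound_ex with (3 := D3); lra.
      * eapply geometric_bound_ex with (3 := Ba); lra.
Qed.

Lemma lsum_continuous {A : Type} (l : list A) (F : A -> R -> R) (t : R) :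
  (forall x, In x l -> continuous (F x) t) -> continuous (fun s => lsum l (fun x => F x s)) t.
Proof.
  induction l as [|x l IH]; intros H; [apply continuous_const|].
  apply (continuous_plus (F x) (fun s => lsum l (fun x => F x s))); [apply H; now left|].
  apply IH. intros y Hy. apply H. now right.
Qed.

Lemma re_sum_continuous (l : list (Z * Z)) (g1 g2 : R -> R) (c : Z * Z -> C) (t : R) :
  continuous g1 t -> continuous g2 t -> continuous (re_sum l g1 g2 c) t.
Proof.
  intros C1 C2. unfold re_sum.
  apply (lsum_continuous l (fun xi s => Re (c xi) * xwave g1 g2 xi 0 s - Im (c xi) * xwave g1 g2 xi (- (PI / 2)) s)).
  intros xi _. apply (continuous_minus (fun s => Re (c xi) * xwave g1 g2 xi 0 s)).
  - apply (continuous_scal_r (Re (c xi)) (xwave g1 g2 xi 0)). now apply wave_continuous.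
  - apply (continuous_scal_r (Im (c xi)) (xwave g1 g2 xi (- (PI / 2)))). now apply wave_continuous.
Qed.

Lemma curved_arc_re_sum_continuous (l u : R) (g1 g2 : R -> R) (L : list (Z * Z)) (c : Z * Z -> C) (t : R) :
  curved_arc l u g1 g2 -> l < t < u -> continuous (re_sum L g1 g2 c) t.
Proof.
  intros H Ht. destruct (curved_arc_derive l u g1 g2 H t Ht).
  apply re_sum_continuous; now apply (@ex_derive_continuous R_AbsRing R_NormedModule).
Qed.

Lemma square_RInt_le (l u a b M : R) (f : R -> R) : l < a -> a <= b -> b < u ->
  (forall t, l < t < u -> continuous f t) -> (forall t, a <= t <= b -> Rabs (f t) <= M) ->
  RInt (fun t => f t ^ 2) a b <= M ^ 2 * (b - a).
Proof.
  intros la ab bu Cf Bf. rewrite Rmult_comm.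
  apply Rle_trans with (RInt (fun _ => M ^ 2) a b); [|right; apply (RInt_const a b (M ^ 2))].
  apply RInt_le; [assumption| |apply ex_RInt_const|].
  - apply (@ex_RInt_continuous R_CompleteNormedModule). intros z Hz. rewrite Rmin_left, Rmax_right in Hz by lra.
    apply (continuous_ext (fun t => f t * f t)); [intros; simpl; ring|].
    apply (continuous_mult f f); apply Cf; lra.
  - intros t Ht. rewrite <- (pow2_abs (f t)). apply pow_incr. split; [apply Rabs_pos|apply Bf; lra].
Qed.

(** The radius rho is fixed by t0 before any arc is named, so that compactness can choose the
    intervals first and a curved arc is found in each afterwards. The energy cancels between the two
    estimates, leaving 4^n <= X E exp (2 Q sqrt E) for n zeros. *)
Lemma interval_zero_bound (g1 g2 : R -> R) (t0 : R) :
  real_analytic_at g1 t0 -> real_analytic_at g2 t0 ->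
  exists rho : R, 0 < rho /\ forall u v l0 u0 : R,
    t0 - rho <= u -> v <= t0 + rho -> u <= l0 -> l0 < u0 -> u0 <= v -> curved_arc l0 u0 g1 g2 ->
    exists (E0 : nat) (K : R), (0 < E0)%nat /\ 0 < K /\
      forall (E : nat) (c : Z * Z -> C), (E0 <= E)%nat -> is_eigenfunction E c ->
      forall zs : list R, NoDup zs ->
        (forall t, In t zs -> u <= t <= v /\ re_sum (lattice_pts E) g1 g2 c t = 0) ->
        INR (length zs) <= K * sqrt (INR E).
Proof.
  intros A1 A2. destruct (re_sum_power_series g1 g2 t0 A1 A2) as (r & Q & r0 & Q0 & HS).
  (* With zeros and values in a disc of radius r / 5 every zero gains the factor 1/2. *)
  exists (r / 5). split; [lra|]. intros u v l0 u0 Hu Hv H1 H2 H3 Hc.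
  set (a := l0 + (u0 - l0) / 3). set (b := l0 + 2 * (u0 - l0) / 3).
  assert (la : l0 < a) by (unfold a; lra). assert (ab : a < b) by (unfold a, b; lra).
  assert (bu : b < u0) by (unfold b; lra).
  destruct (restriction_lower_bound l0 u0 a b g1 g2 la ab bu Hc) as (kap & E0 & kap0 & E00 & HL).
  (* The crude N = O(E) is enough here: E is at most exp (2 sqrt E) and is absorbed by the
     exponential. *)
  destruct (lattice_pts_bound 1) as (CN & CN0 & HN); [lra|].
  set (X := 25 / 4 * CN * (b - a) / kap).
  assert (X0 : 0 < X).
  { apply Rmult_lt_0_compat; [|now apply Rinv_0_lt_compat]. apply Rmult_lt_0_compat; lra. }
  exists E0, (X + 2 * Q + 2). split; [assumption|]. split; [lra|].
  intros E c HE Heig zs nd Hz.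
  assert (Epos : (0 < E)%nat) by lia.
  assert (EI : 1 <= INR E) by (apply (le_INR 1); lia).
  specialize (HL E c HE). specialize (HN E Epos). rewrite Rpower_1 in HN by lra.
  destruct (HS E c Epos) as (as_ & Ba & Ha).
  assert (en := energy_pos E c Heig).
  set (L := lattice_pts E) in *. set (lam := sqrt (INR E)) in *. set (S1 := lsum L (nrm c)) in *.
  set (n := length zs).
  assert (lam1 : 1 <= lam) by (rewrite <- sqrt_1; apply sqrt_le_1_alt; assumption).
  assert (lamE : lam * lam = INR E) by (apply sqrt_sqrt; lra).
  assert (Bd : forall t, u <= t <= v -> Rabs (re_sum L g1 g2 c t) <= 5 / 2 * S1 * exp (Q * lam) * (/ 2) ^ n).
  { intros t Ht.
    pose proof (PSeries_many_zeros r (r / 5) ltac:(lra) (map (fun z => z - t0) zs) as_ _ Ba) as PZ.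
    replace t with (t0 + (t - t0)) by ring. rewrite Ha by (apply Rabs_def1; lra).
    eapply Rle_trans; [apply PZ|].
    - apply Injective_map_NoDup; [|assumption]. intros x y e. lra.
    - intros z Hzz. apply in_map_iff in Hzz as [w [<- Hw]]. destruct (Hz w Hw) as [W1 W2].
      split; [apply Rabs_le; lra|]. rewrite <- Ha by (apply Rabs_def1; lra).
      replace (t0 + (w - t0)) with w by ring. assumption.
    - apply Rabs_le; lra.
    - rewrite length_map. fold n. replace (2 * (r / 5) / (r - r / 5)) with (/ 2) by (field; lra).
      right. field. lra. }
  assert (S10 : 0 <= S1) by (apply lsum_nonneg; intros; apply sqrt_pos).
  assert (I1 : kap * energy L c <= (5 / 2 * S1 * exp (Q * lam) * (/ 2) ^ n) ^ 2 * (b - a)).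
  { eapply Rle_trans; [exact HL|].
    erewrite RInt_ext; [apply (square_RInt_le l0 u0 a b _ (re_sum L g1 g2 c))|].
    - assumption.
    - lra.
    - assumption.
    - intros t Ht. now apply curved_arc_re_sum_continuous with l0 u0.
    - intros t Ht. apply Bd. lra.
    - intros t _. destruct Heig as [HI _]. specialize (HI (g1 t, g2 t)).
      rewrite eigen_sum_curve in HI. simpl in HI. fold L in HI. rewrite HI. simpl. ring. }
  assert (S2 : S1 ^ 2 <= CN * INR E * energy L c).
  { eapply Rle_trans; [apply lsum_square_le|]. apply Rmult_le_compat_r; [lra|exact HN]. }
  assert (I2 : 4 ^ n <= X * INR E * exp (2 * Q * lam)).
  { assert (e4 : (/ 2) ^ n * (/ 2) ^ n * 4 ^ n = 1).
    { rewrite <- !Rpow_mult_distr. replace (/ 2 * / 2 * 4) with 1 by field. apply pow1. }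
    assert (ee : exp (Q * lam) * exp (Q * lam) = exp (2 * Q * lam)) by (rewrite <- exp_plus; f_equal; ring).
    assert (p4 : 0 < 4 ^ n) by (apply pow_lt; lra).
    assert (I3 : kap * energy L c * 4 ^ n <= 25 / 4 * S1 ^ 2 * exp (2 * Q * lam) * (b - a)).
    { apply Rle_trans with ((5 / 2 * S1 * exp (Q * lam) * (/ 2) ^ n) ^ 2 * (b - a) * 4 ^ n).
      - apply Rmult_le_compat_r; lra.
      - right. rewrite <- ee.
        transitivity (25 / 4 * S1 ^ 2 * (exp (Q * lam) * exp (Q * lam)) * (b - a) * ((/ 2) ^ n * (/ 2) ^ n * 4 ^ n)); [field|].
        rewrite e4. ring. }
    assert (I4 : 25 / 4 * S1 ^ 2 * exp (2 * Q * lam) * (b - a) <= 25 / 4 * (CN * INR E * energy L c) * exp (2 * Q * lam) * (b - a)).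
    { apply Rmult_le_compat_r; [lra|]. apply Rmult_le_compat_r; [left; apply exp_pos|]. lra. }
    apply (Rmult_le_reg_l (kap * energy L c)); [now apply Rmult_lt_0_compat|].
    apply Rle_trans with (25 / 4 * (CN * INR E * energy L c) * exp (2 * Q * lam) * (b - a)); [lra|].
    right. unfold X. field. lra. }
  assert (I5 : exp (INR n) <= 4 ^ n).
  { replace (exp (INR n)) with (exp 1 ^ n).
    - apply pow_incr. split; [left; apply exp_pos|]. pose proof exp_le_3. lra.
    - rewrite <- Rpower_pow by apply exp_pos. unfold Rpower. rewrite ln_exp. f_equal. ring. }
  assert (I6 : X * INR E * exp (2 * Q * lam) <= exp (X + 2 * lam + 2 * Q * lam)).
  { rewrite !exp_plus. apply Rmult_le_compat_r; [left; apply exp_pos|].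
    apply Rmult_le_compat; [lra|lra|pose proof (exp_ineq1_le X); lra|].
    rewrite <- lamE. replace (2 * lam) with (lam + lam) by ring. rewrite exp_plus.
    pose proof (exp_ineq1_le lam). apply Rmult_le_compat; lra. }
  assert (I7 : INR n <= X + 2 * lam + 2 * Q * lam).
  { apply Rnot_lt_le. intros lt. apply exp_increasing in lt. lra. }
  assert (X * 1 <= X * lam) by (apply Rmult_le_compat_l; lra). unfold n in *. lra.
Qed.

(** * Lower bound for the number of zeros *)

Fixpoint rsum (n : nat) (F : nat -> R) : R :=
  match n with O => 0 | S m => rsum m F + F m end.

Lemma rsum_le (n : nat) (F G : nat -> R) : (forall j, (j < n)%nat -> F j <= G j) -> rsum n F <= rsum n G.
Proof.
  induction n as [|n IH]; intros H; [simpl; lra|]. simpl. apply Rplus_le_compat; [|apply H; lia].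
  apply IH. intros j Hj. apply H. lia.
Qed.

Lemma rsum_plus (n : nat) (F G : nat -> R) : rsum n (fun j => F j + G j) = rsum n F + rsum n G.
Proof. induction n as [|n IH]; simpl; [ring|]. rewrite IH. ring. Qed.

Lemma rsum_scal (n : nat) (k : R) (F : nat -> R) : rsum n (fun j => k * F j) = k * rsum n F.
Proof. induction n as [|n IH]; simpl; [ring|]. rewrite IH. ring. Qed.

Lemma rsum_const (n : nat) (k : R) : rsum n (fun _ => k) = INR n * k.
Proof. induction n as [|n IH]; [simpl; ring|]. cbn [rsum]. rewrite IH, S_INR. ring. Qed.

Lemma rsum_telescope (n : nat) (F : nat -> R) : rsum n (fun j => F (S j) - F j) = F n - F 0%nat.
Proof. induction n as [|n IH]; simpl; [ring|]. rewrite IH. ring. Qed.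

Lemma rsum_lsum {A : Type} (n : nat) (l : list A) (F : nat -> A -> R) :
  rsum n (fun j => lsum l (F j)) = lsum l (fun x => rsum n (fun j => F j x)).
Proof.
  induction n as [|n IH]; simpl.
  - rewrite lsum_const. ring.
  - rewrite IH, <- lsum_plus. reflexivity.
Qed.

Lemma ivt_between (f : R -> R) (x y v : R) :
  (forall t, Rmin x y <= t <= Rmax x y -> continuous f t) -> f x < v < f y ->
  exists z, Rmin x y <= z <= Rmax x y /\ f z = v.
Proof.
  intros Cf [H1 H2].
  assert (Cp : forall t, Rmin x y <= t <= Rmax x y -> continuity_pt f t).
  { intros t Ht. apply continuity_pt_filterlim. now apply Cf. }
  assert (Cv : forall t, continuity_pt (fun _ : R => v) t) by (intros t; apply continuity_pt_const; intros ? ?; reflexivity).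
  destruct (Rtotal_order x y) as [lt|[e|gt]].
  - rewrite Rmin_left, Rmax_right in * by lra.
    destruct (IVT_interv (fun t => f t - v) x y) as [z [Hz E]]; try lra.
    { intros t Ht. apply (continuity_pt_minus f (fun _ => v)); auto. }
    exists z. split; [assumption|lra].
  - subst. lra.
  - rewrite Rmin_right, Rmax_left in * by lra.
    destruct (IVT_interv (fun t => v - f t) y x) as [z [Hz E]]; try lra.
    { intros t Ht. apply (continuity_pt_minus (fun _ => v) f); auto. }
    exists z. split; [assumption|lra].
Qed.

Lemma constant_sign (l u p q : R) (f : R -> R) : l < p -> q < u ->
  (forall t, l < t < u -> continuous f t) -> (forall t, p < t < q -> f t <> 0) ->
  (forall t, p < t < q -> 0 <= f t) \/ (forall t, p < t < q -> f t <= 0).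
Proof.
  intros lp qu Cf Nz.
  destruct (classic (forall t, p < t < q -> 0 <= f t)) as [|n]; [now left|right].
  apply not_all_ex_not in n as [t1 n]. apply imply_to_and in n as [T1 F1]. apply Rnot_le_lt in F1.
  intros t2 T2. apply Rnot_lt_le. intros F2.
  assert (B : forall t, Rmin t1 t2 <= t <= Rmax t1 t2 -> p < t < q).
  { intros t. unfold Rmin, Rmax. destruct (Rle_dec t1 t2); lra. }
  destruct (ivt_between f t1 t2 0) as [x [Hx Fx]]; [|lra|now apply (Nz x), Fx; apply B].
  intros t Ht. apply Cf. specialize (B t Ht). lra.
Qed.

(** Absence of zeros fixes the sign, so the integral of |f| is the modulus of the integral of f, and
    f^2 <= Mx |f|. *)
Lemma square_integral_one_sign (l u p q Mx : R) (f : R -> R) : l < p -> p <= q -> q < u ->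
  (forall t, l < t < u -> continuous f t) -> (forall t, p < t < q -> f t <> 0) ->
  (forall t, l < t < u -> Rabs (f t) <= Mx) ->
  RInt (fun t => f t ^ 2) p q <= Mx * Rabs (RInt f p q).
Proof.
  intros lp pq qu Cf Nz Bf.
  assert (S0 : 0 <= Mx) by (pose proof (Bf p ltac:(lra)); pose proof (Rabs_pos (f p)); lra).
  assert (ex : ex_RInt f p q).
  { apply (@ex_RInt_continuous R_CompleteNormedModule). intros z Hz. rewrite Rmin_left, Rmax_right in Hz by lra. apply Cf. lra. }
  assert (ex2 : ex_RInt (fun t => f t ^ 2) p q).
  { apply (@ex_RInt_continuous R_CompleteNormedModule). intros z Hz. rewrite Rmin_left, Rmax_right in Hz by lra.
    apply (continuous_ext (fun t => f t * f t)); [intros; simpl; ring|].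
    apply (continuous_mult f f); apply Cf; lra. }
  assert (sc : forall k, is_RInt (fun t => k * f t) p q (k * RInt f p q)).
  { intros k. apply (is_RInt_scal f p q k (RInt f p q)). now apply (RInt_correct f). }
  destruct (constant_sign l u p q f lp qu Cf Nz) as [pos|neg].
  - apply Rle_trans with (Mx * RInt f p q); [|apply Rmult_le_compat_l; [assumption|apply Rle_abs]].
    rewrite <- (is_RInt_unique _ _ _ _ (sc Mx)).
    apply RInt_le; [assumption|assumption|eexists; apply sc|]. intros t Ht.
    specialize (pos t Ht). specialize (Bf t ltac:(lra)). rewrite Rabs_pos_eq in Bf by assumption. nra.
  - apply Rle_trans with (- Mx * RInt f p q).
    + rewrite <- (is_RInt_unique _ _ _ _ (sc (- Mx))).
      apply RInt_le; [assumption|assumption|eexists; apply sc|]. intros t Ht.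
      specialize (neg t Ht). specialize (Bf t ltac:(lra)). rewrite Rabs_left1 in Bf by assumption. nra.
    + rewrite <- Rabs_Ropp. replace (- Mx * RInt f p q) with (Mx * - RInt f p q) by ring.
      apply Rmult_le_compat_l; [assumption|apply Rle_abs].
Qed.

(** One zero is taken from the interior of each piece that has one; open pieces are disjoint, so the
    zeros are distinct. Such a piece is charged the trivial bound Mx^2 h, every other piece the
    one-sign bound. *)
Lemma zeros_from_partition (l u a h Mx : R) (f : R -> R) : l < a -> 0 < h ->
  (forall t, l < t < u -> continuous f t) -> (forall t, l < t < u -> Rabs (f t) <= Mx) ->
  forall n : nat, a + INR n * h < u ->
  exists zs : list R, NoDup zs /\ (forall z, In z zs -> a < z < a + INR n * h /\ f z = 0) /\
    RInt (fun t => f t ^ 2) a (a + INR n * h) <=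
      Mx * rsum n (fun j => Rabs (RInt f (a + INR j * h) (a + INR (S j) * h))) + INR (length zs) * (Mx ^ 2 * h).
Proof.
  intros la h0 Cf Bf n. induction n as [|n IH]; intros Hn.
  - exists nil. split; [constructor|]. split; [intros z []|]. simpl.
    rewrite Rmult_0_l, Rplus_0_r, RInt_point. change (zero : R) with 0. lra.
  - set (p := a + INR n * h) in *. assert (Ep : a + INR (S n) * h = p + h) by (rewrite S_INR; unfold p; ring).
    assert (n0 := pos_INR n). assert (ap : a <= p) by (unfold p; nra).
    rewrite Ep in *. destruct IH as (zs & nd & Hz & HI); [lra|].
    assert (ex : forall x y, l < x -> x <= y -> y < u -> ex_RInt (fun t => f t ^ 2) x y).
    { intros x y H1 H2 H3. apply (@ex_RInt_continuous R_CompleteNormedModule). intros z Hz'.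
      rewrite Rmin_left, Rmax_right in Hz' by lra.
      apply (continuous_ext (fun t => f t * f t)); [intros; simpl; ring|].
      apply (continuous_mult f f); apply Cf; lra. }
    rewrite <- (RInt_Chasles _ a p (p + h)) by (apply ex; lra). change plus with Rplus.
    cbn [rsum]. rewrite Ep. fold p. rewrite Rmult_plus_distr_l.
    assert (S00 : 0 <= Mx) by (pose proof (Bf p ltac:(lra)); pose proof (Rabs_pos (f p)); lra).
    assert (A0 : 0 <= Mx * Rabs (RInt f p (p + h))) by (apply Rmult_le_pos; [assumption|apply Rabs_pos]).
    destruct (classic (exists z, p < z < p + h /\ f z = 0)) as [[z [Z1 Z2]]|no].
    + exists (z :: zs). split; [|split].
      * constructor; [|assumption]. intros Hin. apply Hz in Hin. lra.
      * intros w [<-|Hw]; [split; [lra|assumption]|]. destruct (Hz w Hw). split; [lra|assumption].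
      * assert (RInt (fun t => f t ^ 2) p (p + h) <= Mx ^ 2 * h).
        { replace h with (p + h - p) at 2 by ring. apply (square_RInt_le l u); try lra; [assumption|].
          intros t Ht. apply Bf. lra. }
        simpl length. rewrite S_INR. lra.
    + exists zs. split; [assumption|split].
      * intros w Hw. destruct (Hz w Hw). split; [lra|assumption].
      * assert (RInt (fun t => f t ^ 2) p (p + h) <= Mx * Rabs (RInt f p (p + h))); [|lra].
        apply (square_integral_one_sign l u); try lra; try assumption.
        intros t Ht e. apply no. now exists t.
Qed.

Lemma re_sum_bound (l : list (Z * Z)) (g1 g2 : R -> R) (c : Z * Z -> C) (t : R) :
  Rabs (re_sum l g1 g2 c t) <= 2 * lsum l (nrm c).
Proof.
  unfold re_sum. eapply Rle_trans; [apply lsum_abs|]. rewrite <- lsum_scal. apply lsum_le.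
  intros xi _. destruct (nrm_bounds c xi) as [N1 N2].
  unfold xwave. rewrite cos_wave, sin_wave. set (x := phase _ _ _ _ _).
  assert (C1 : Rabs (cos x) <= 1) by (apply Rabs_le, COS_bound).
  assert (C2 : Rabs (sin x) <= 1) by (apply Rabs_le, SIN_bound).
  unfold Rminus. eapply Rle_trans; [apply Rabs_triang|]. rewrite Rabs_Ropp, !Rabs_mult.
  replace (2 * nrm c xi) with (nrm c xi * 1 + nrm c xi * 1) by ring.
  apply Rplus_le_compat; apply Rmult_le_compat; try apply Rabs_pos; assumption.
Qed.

(** The increments of [W] telescope over the pieces, so C m / sqrt E appears without a factor n;
    only the endpoint terms 1 / m are paid n times. *)
Lemma partition_oscillation (l u : R) (g1 g2 : R -> R) : l < u -> curved_arc l u g1 g2 ->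
  exists C D : R, 0 < C /\ 0 < D /\
    forall (a h m : R) (n E : nat) (c : Z * Z -> Complex.C), l < a -> 0 < h -> a + INR n * h < u ->
      (0 < E)%nat -> 0 < m <= sqrt (INR E) ->
      rsum n (fun j => Rabs (RInt (re_sum (lattice_pts E) g1 g2 c) (a + INR j * h) (a + INR (S j) * h)))
        <= 2 * lsum (lattice_pts E) (nrm c) *
           (INR n / m + C * m / sqrt (INR E) + D * sqrt (INR E) / m ^ 2 * (INR n * h)).
Proof.
  intros lu Hc. destruct (curved_arc_oscillation l u g1 g2 lu Hc) as (C & D & HC & HD & HO).
  exists C, D. split; [assumption|split; [assumption|]]. intros a0 h0 m n E c la hp Hn Epos Hm.
  set (lam := sqrt (INR E)) in *. assert (lam0 : 0 < lam) by (apply sqrt_lt_R0, lt_0_INR; assumption).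
  set (L := lattice_pts E). set (B := INR n / m + C * m / lam + D * lam / m ^ 2 * (INR n * h0)).
  set (p := fun j => a0 + INR j * h0).
  assert (Pj : forall j, (j < n)%nat -> l < p j /\ p j <= p (S j) /\ p (S j) < u /\ p (S j) - p j = h0).
  { intros j Hj. unfold p. assert (0 <= INR j) by apply pos_INR. assert (INR (S j) <= INR n) by (apply le_INR; lia).
    rewrite S_INR in *. repeat split; nra. }
  assert (O1 : forall xi th, In xi L -> rsum n (fun j => Rabs (RInt (xwave g1 g2 xi th) (p j) (p (S j)))) <= B).
  { intros xi th Hxi. destruct (HO (IZR (fst xi)) (IZR (snd xi)) lam m th lam0) as (W & W1 & W2);
      [now apply lattice_pts_radius|assumption|].
    apply Rle_trans with (rsum n (fun j => (W (p (S j)) - W (p j)) + (/ m + D * lam / m ^ 2 * h0))).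
    - apply rsum_le. intros j Hj. destruct (Pj j Hj) as (P1 & P2 & P3 & P4).
      specialize (W2 (p j) (p (S j)) P1 P2 P3). rewrite P4 in W2. eapply Rle_trans; [exact W2|lra].
    - rewrite rsum_plus, (rsum_telescope n (fun j => W (p j))), rsum_const. unfold B.
      assert (W (p n) - W (p 0%nat) <= C * m / lam).
      { assert (0 <= INR n) by apply pos_INR. apply W1; unfold p; simpl; nra. }
      unfold Rdiv in *. lra. }
  apply Rle_trans with (rsum n (fun j => lsum L (fun xi =>
    nrm c xi * Rabs (RInt (xwave g1 g2 xi 0) (p j) (p (S j))) +
    nrm c xi * Rabs (RInt (xwave g1 g2 xi (- (PI / 2))) (p j) (p (S j)))))).
  - apply rsum_le. intros j Hj. fold (p j) (p (S j)). destruct (Pj j Hj) as (P1 & P2 & P3 & P4).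
    assert (HI : is_RInt (re_sum L g1 g2 c) (p j) (p (S j)) (lsum L (fun xi =>
      Re (c xi) * RInt (xwave g1 g2 xi 0) (p j) (p (S j)) - Im (c xi) * RInt (xwave g1 g2 xi (- (PI / 2))) (p j) (p (S j))))).
    { apply is_RInt_lsum. intros xi _.
      apply (is_RInt_minus (fun t => _ * xwave g1 g2 xi 0 t));
        [apply (is_RInt_scal (xwave g1 g2 xi 0))|apply (is_RInt_scal (xwave g1 g2 xi (- (PI / 2))))];
        apply (wave_RInt_correct l u); assumption. }
    rewrite (is_RInt_unique _ _ _ _ HI). eapply Rle_trans; [apply lsum_abs|]. apply lsum_le.
    intros xi _. destruct (nrm_bounds c xi) as [N1 N2].
    unfold Rminus. eapply Rle_trans; [apply Rabs_triang|]. rewrite Rabs_Ropp, !Rabs_mult.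
    apply Rplus_le_compat; (apply Rmult_le_compat_r; [apply Rabs_pos|assumption]).
  - rewrite rsum_lsum. replace (2 * lsum L (nrm c) * B) with (2 * B * lsum L (nrm c)) by ring.
    rewrite <- lsum_scal. apply lsum_le. intros xi Hxi. rewrite rsum_plus, !rsum_scal.
    pose proof (O1 xi 0 Hxi). pose proof (O1 xi (- (PI / 2)) Hxi).
    assert (N0 : 0 <= nrm c xi) by apply sqrt_pos.
    replace (2 * B * nrm c xi) with (nrm c xi * B + nrm c xi * B) by ring.
    apply Rplus_le_compat; now apply Rmult_le_compat_l.
Qed.

(** With about E^(1/2 - 3d) pieces and m = E^(1/2 - d), the oscillation terms are E^(-2d), E^(-d)
    and E^(-1/2 + 2d), all at most E^(-d) = r^2 up to constants. Passing from the l^1 to the l^2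
    norm loses 1 / r = E^(d/2). The net error r is small, and the zeros number at least a constant
    times E^(1/2 - 3d) r. *)
Lemma many_sign_changes (l u : R) (g1 g2 : R -> R) (eps : R) : l < u -> curved_arc l u g1 g2 -> 0 < eps ->
  exists (k : R) (E0 : nat), 0 < k /\ (0 < E0)%nat /\
    forall (E : nat) (c : Z * Z -> Complex.C), (E0 <= E)%nat -> is_eigenfunction E c ->
      exists zs : list R, NoDup zs /\
        (forall z, In z zs -> l < z < u /\ re_sum (lattice_pts E) g1 g2 c z = 0) /\
        k * Rpower (INR E) (1 / 2 - eps) <= INR (length zs).
Proof.
  intros lu Hc eps0.
  set (a := l + (u - l) / 3). set (b := l + 2 * (u - l) / 3).
  assert (la : l < a) by (unfold a; lra). assert (ab : a < b) by (unfold a, b; lra).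
  assert (bu : b < u) by (unfold b; lra).
  destruct (restriction_lower_bound l u a b g1 g2 la ab bu Hc) as (kap & E1 & kap0 & E10 & HL).
  destruct (partition_oscillation l u g1 g2 lu Hc) as (C & D & C0 & D0 & HO).
  (* 4 d <= eps leaves room for the total loss E^(7d/2), and 8 d <= 1 keeps -1/2 + 2d <= -d and the
     number of pieces at least 1. *)
  set (d := Rmin eps (1 / 2) / 4).
  assert (d1 := Rmin_l eps (1 / 2)). assert (d2 := Rmin_r eps (1 / 2)).
  assert (d0 : 0 < d) by (assert (0 < Rmin eps (1 / 2)) by (apply Rmin_glb_lt; lra); unfold d; lra).
  assert (d4 : 4 * d <= eps) by (unfold d; lra). assert (d8 : 8 * d <= 1) by (unfold d; lra).
  clearbody d. clear d1 d2.
  destruct (lattice_pts_bound (d / 2)) as (CN & CN0 & HN); [lra|].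
  set (B1 := 2 + C + D * (b - a)).
  assert (B10 : 0 < B1) by (assert (0 < D * (b - a)) by (apply Rmult_lt_0_compat; lra); unfold B1; lra).
  assert (CB : 0 < CN * B1) by (apply Rmult_lt_0_compat; lra).
  destruct (Rpower_neg_small (d / 2) (kap / (8 * (CN * B1)))) as (E2 & E20 & HE2); [lra| |].
  { apply Rmult_lt_0_compat; [lra|apply Rinv_0_lt_compat; lra]. }
  exists (kap / (8 * CN * (b - a))), (E1 + E2)%nat. split.
  { apply Rmult_lt_0_compat; [lra|]. apply Rinv_0_lt_compat. apply Rmult_lt_0_compat; lra. }
  split; [lia|]. intros E c HE Heig.
  assert (Epos : (0 < E)%nat) by lia.
  assert (EI : 1 <= INR E) by (apply (le_INR 1); lia).
  specialize (HL E c ltac:(lia)). specialize (HN E Epos). specialize (HE2 E ltac:(lia)).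
  assert (en := energy_pos E c Heig).
  set (x := Rpower (INR E) (1 / 2 - 3 * d)).
  assert (x1 : 1 <= x).
  { rewrite <- (Rpower_O (INR E)) by lra. apply Rle_Rpower; lra. }
  destruct (nfloor_ex x) as [n0 [F1 F2]]; [lra|].
  set (n := S n0). assert (nI : x <= INR n <= 2 * x) by (unfold n; rewrite S_INR; lra).
  set (h := (b - a) / INR n).
  assert (h0 : 0 < h) by (apply Rmult_lt_0_compat; [lra|apply Rinv_0_lt_compat; lra]).
  assert (nh : INR n * h = b - a) by (unfold h; field; lra).
  assert (bE : a + INR n * h = b) by lra.
  set (lam := sqrt (INR E)) in *. set (m := Rpower (INR E) (1 / 2 - d)).
  assert (lamE : lam = Rpower (INR E) (1 / 2)).
  { unfold lam. rewrite <- Rpower_sqrt by lra. f_equal. lra. }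
  assert (m0 : 0 < m) by apply exp_pos.
  assert (mlam : m <= lam) by (rewrite lamE; apply Rle_Rpower; lra).
  set (r := Rpower (INR E) (- (d / 2))) in *. assert (r0 : 0 < r) by apply exp_pos.
  set (L := lattice_pts E) in *. set (S1 := lsum L (nrm c)).
  assert (HO' := HO a h m n E c la h0 ltac:(lra) Epos ltac:(split; assumption)).
  fold lam in HO'. fold L in HO'. fold S1 in HO'. rewrite nh in HO'.
  set (B := INR n / m + C * m / lam + D * lam / m ^ 2 * (b - a)) in *.
  assert (BB : B <= B1 * (r * r)).
  { assert (rr : r * r = Rpower (INR E) (- d)) by (unfold r; rewrite <- Rpower_plus; f_equal; lra).
    rewrite rr. set (q := Rpower (INR E) (- d)).
    assert (b1 : INR n / m <= 2 * q).
    { apply Rle_trans with (2 * x / m).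
      - apply Rmult_le_compat_r; [left; now apply Rinv_0_lt_compat|lra].
      - unfold Rdiv. rewrite Rmult_assoc. apply Rmult_le_compat_l; [lra|]. unfold x, m.
        rewrite <- Rpower_Ropp, <- Rpower_plus. apply Rle_Rpower; lra. }
    assert (b2 : C * m / lam = C * q).
    { unfold Rdiv. rewrite Rmult_assoc. f_equal. rewrite lamE. unfold m, q.
      rewrite <- Rpower_Ropp, <- Rpower_plus. f_equal. lra. }
    assert (b3 : D * lam / m ^ 2 * (b - a) <= D * (b - a) * q).
    { replace (D * lam / m ^ 2 * (b - a)) with (D * (b - a) * (lam / m ^ 2)) by (field; lra).
      apply Rmult_le_compat_l; [apply Rmult_le_pos; lra|]. rewrite lamE. unfold m, q.
      rewrite <- Rpower_pow by apply exp_pos. rewrite Rpower_mult. unfold Rdiv at 1.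
      rewrite <- Rpower_Ropp, <- Rpower_plus. apply Rle_Rpower; simpl; lra. }
    unfold B, B1. lra. }
  assert (Cf : forall t, l < t < u -> continuous (re_sum L g1 g2 c) t).
  { intros t Ht. now apply curved_arc_re_sum_continuous with l u. }
  destruct (zeros_from_partition l u a h (2 * S1) (re_sum L g1 g2 c) la h0 Cf) with (n := n) as (zs & nd & Hz & HI).
  { intros t _. apply re_sum_bound. }
  { lra. }
  exists zs. split; [assumption|]. split.
  { intros z Hin. destruct (Hz z Hin) as [Z1 Z2]. split; [lra|assumption]. }
  rewrite bE in HI.
  assert (S10 : 0 <= S1) by (apply lsum_nonneg; intros; apply sqrt_pos).
  assert (S2 : S1 ^ 2 <= CN * / r * energy L c).
  { eapply Rle_trans; [apply lsum_square_le|]. apply Rmult_le_compat_r; [lra|].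
    eapply Rle_trans; [exact HN|]. right. unfold r. rewrite Rpower_Ropp, Rinv_inv. reflexivity. }
  set (Zn := INR (length zs)) in *. assert (Z0 : 0 <= Zn) by apply pos_INR.
  assert (I1 : kap * energy L c <= 4 * S1 ^ 2 * (B1 * (r * r) + Zn * h)).
  { eapply Rle_trans; [exact HL|].
    erewrite RInt_ext; [eapply Rle_trans; [exact HI|]|].
    - assert (2 * S1 * rsum n (fun j => Rabs (RInt (re_sum L g1 g2 c) (a + INR j * h) (a + INR (S j) * h))) <= 2 * S1 * (2 * S1 * (B1 * (r * r)))).
      { apply Rmult_le_compat_l; [lra|]. eapply Rle_trans; [exact HO'|]. apply Rmult_le_compat_l; lra. }
      lra.
    - intros t _. destruct Heig as [HE' _]. specialize (HE' (g1 t, g2 t)).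
      rewrite eigen_sum_curve in HE'. simpl in HE'. fold L in HE'. rewrite HE'. simpl. ring. }
  assert (P : 0 <= B1 * (r * r) + Zn * h).
  { apply Rplus_le_le_0_compat; [|apply Rmult_le_pos; lra]. apply Rmult_le_pos; [lra|]. apply Rmult_le_pos; lra. }
  assert (I2 : kap <= 4 * (CN * / r) * (B1 * (r * r) + Zn * h)).
  { apply (Rmult_le_reg_r (energy L c)); [assumption|].
    eapply Rle_trans; [exact I1|].
    apply Rle_trans with (4 * (CN * / r * energy L c) * (B1 * (r * r) + Zn * h)); [|right; ring].
    apply Rmult_le_compat_r; lra. }
  assert (I3 : kap * r <= 4 * (CN * B1) * r * r + 4 * CN * (Zn * h)).
  { apply Rle_trans with (4 * (CN * / r) * (B1 * (r * r) + Zn * h) * r); [apply Rmult_le_compat_r; lra|].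
    right. field. lra. }
  assert (I4 : 4 * (CN * B1) * r * r <= kap * r / 2).
  { apply Rle_trans with (4 * (CN * B1) * (kap / (8 * (CN * B1))) * r).
    - apply Rmult_le_compat_r; [lra|]. apply Rmult_le_compat_l; lra.
    - right. field. split; lra. }
  assert (I5 : kap * r <= 8 * CN * (Zn * h)) by lra.
  apply Rle_trans with (kap / (8 * CN * (b - a)) * (x * r)).
  { apply Rmult_le_compat_l.
    - apply Rmult_le_pos; [lra|]. left. apply Rinv_0_lt_compat. apply Rmult_lt_0_compat; lra.
    - unfold x, r. rewrite <- Rpower_plus. apply Rle_Rpower; lra. }
  assert (Q : 0 < 8 * CN * (b - a)) by (apply Rmult_lt_0_compat; lra).
  apply (Rmult_le_reg_l (8 * CN * (b - a))); [assumption|].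
  apply Rle_trans with (kap * r * x); [right; field; split; lra|].
  apply Rle_trans with (8 * CN * (Zn * h) * INR n).
  - apply Rmult_le_compat; try lra. apply Rmult_le_pos; lra.
  - right. rewrite <- nh. ring.
Qed.

(** * Curved subarcs *)

(** The gauge given to compactness is half of rho: a point within rho / 2 of t then has its whole
    d-neighbourhood inside the rho-interval of t as soon as d <= rho / 2. *)
Lemma lebesgue_number (a b : R) (P : R -> R -> Prop) :
  (forall t, a <= t <= b -> exists rho, 0 < rho /\ P t rho) ->
  exists d : R, 0 < d /\ forall x, a <= x <= b ->
    exists t rho, P t rho /\ t - rho <= x - d /\ x + d <= t + rho.
Proof.
  intros H.
  assert (H' : forall t, exists rho : posreal, a <= t <= b -> P t (2 * rho)).
  { intros t. destruct (classic (a <= t <= b)) as [Ht|n].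
    - destruct (H t Ht) as (rho & r0 & Pr). assert (r2 : 0 < rho / 2) by lra.
      exists (mkposreal _ r2). intros _. simpl. now replace (2 * (rho / 2)) with rho by field.
    - exists (mkposreal 1 Rlt_0_1). tauto. }
  set (delta := fun t => proj1_sig (constructive_indefinite_description _ (H' t))).
  assert (Hd : forall t, a <= t <= b -> P t (2 * delta t)).
  { intros t. unfold delta. destruct (constructive_indefinite_description _ (H' t)) as [rho Hr]. exact Hr. }
  destruct (compactness_value_1d a b delta) as [d Hdd].
  exists d. split; [apply cond_pos|]. intros x Hx. specialize (Hdd x Hx). apply NNPP in Hdd.
  destruct Hdd as (t & Ht & H1 & H2). exists t, (2 * delta t). split; [now apply Hd|].
  apply Rabs_def2 in H1. lra.
Qed.

(** A series vanishing on an interval has as many zeros there as desired, so the zero estimate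
    bounds it by K 2^(-n) for every n. The coefficient bound holds at radius r / 2, and r / 10 is a
    fifth of it. *)
Lemma power_series_identity (c : nat -> R) (r : R) : 0 < r -> (forall h, Rabs h < r -> ex_pseries c h) ->
  forall p q, - (r / 10) <= p -> p < q -> q <= r / 10 -> (forall h, p <= h <= q -> PSeries c h = 0) ->
  forall h, Rabs h <= r / 10 -> PSeries c h = 0.
Proof.
  intros r0 H p q Hp pq Hq Z h hr.
  destruct (cv_radius_coef_bound c (r / 2)) as (M & M0 & HM); [lra|apply ex_pseries_cv_radius with r; [lra|assumption]|].
  assert (B : forall n, Rabs (PSeries c h) <= M * (r / 2) / (r / 2 - r / 10) * (2 * (r / 10) / (r / 2 - r / 10)) ^ n).
  (* n distinct points of [p, q), equally spaced. *)
  { intros n. set (zs := map (fun j => p + INR j / INR (S n) * (q - p)) (seq 0 n)).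
    assert (Ln : length zs = n) by (unfold zs; rewrite length_map, length_seq; reflexivity).
    rewrite <- Ln.
    assert (n0 : 0 < INR (S n)) by (apply lt_0_INR; lia).
    apply PSeries_many_zeros; try assumption; try lra.
    - apply Injective_map_NoDup; [|apply seq_NoDup]. intros i j e. apply INR_eq.
      assert (e' : (INR i - INR j) * ((q - p) / INR (S n)) = 0) by (unfold Rdiv in *; lra).
      apply Rmult_integral in e' as [e'|e']; [lra|].
      assert (0 < (q - p) / INR (S n)) by (apply Rmult_lt_0_compat; [lra|now apply Rinv_0_lt_compat]). lra.
    - intros z Hz. apply in_map_iff in Hz as [j [<- Hj]]. apply in_seq in Hj.
      assert (j0 := pos_INR j). assert (jn : INR j <= INR (S n)) by (apply le_INR; lia).
      assert (f : 0 <= INR j / INR (S n) <= 1).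
      { split; [apply Rmult_le_pos; [assumption|left; now apply Rinv_0_lt_compat]|].
        apply (Rmult_le_reg_r (INR (S n))); [assumption|]. unfold Rdiv. rewrite Rmult_assoc, Rinv_l; lra. }
      set (s := INR j / INR (S n)) in *. assert (0 <= s * (q - p) <= q - p) by nra.
      split; [apply Rabs_le; lra|apply Z; lra]. }
  replace (2 * (r / 10) / (r / 2 - r / 10)) with (/ 2) in B by (field; lra).
  set (K := M * (r / 2) / (r / 2 - r / 10)) in *.
  destruct (Req_dec (PSeries c h) 0) as [|nz]; [assumption|exfalso].
  apply Rabs_pos_lt in nz. set (y := Rabs (PSeries c h)) in *.
  assert (K0 : 0 <= K).
  { specialize (B 0%nat). simpl in B. lra. }
  destruct (pow_lt_1_zero (/ 2)) with (y := y / (K + 1)) as [N HN].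
  { rewrite Rabs_pos_eq; lra. }
  { apply Rmult_lt_0_compat; [assumption|apply Rinv_0_lt_compat; lra]. }
  specialize (HN N (le_n N)). specialize (B N).
  assert (p0 : 0 < (/ 2) ^ N) by (apply pow_lt; lra). rewrite Rabs_pos_eq in HN by lra.
  assert (K * (/ 2) ^ N <= (K + 1) * (/ 2) ^ N) by (apply Rmult_le_compat_r; lra).
  assert ((K + 1) * (/ 2) ^ N < (K + 1) * (y / (K + 1))) by (apply Rmult_lt_compat_l; lra).
  replace ((K + 1) * (y / (K + 1))) with y in H1 by (field; lra). lra.
Qed.

Lemma pseries_recenter (g : R -> R) (c : nat -> R) (t0 r : R) :
  (forall t, Rabs (t - t0) < r -> is_pseries c (t - t0) (g t)) ->
  forall h, Rabs h < r -> is_pseries c h (g (t0 + h)).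
Proof.
  intros H h hr. specialize (H (t0 + h)). replace (t0 + h - t0) with h in H by ring. now apply H.
Qed.

Lemma local_identity (G : R -> R) (t0 k : R) : real_analytic_at G t0 ->
  exists rho, 0 < rho /\ forall p q, t0 - rho <= p -> p < q -> q <= t0 + rho ->
    (forall t, p <= t <= q -> G t = k) -> forall t, t0 - rho <= t <= t0 + rho -> G t = k.
Proof.
  intros (c & r & r0 & H). exists (r / 10). split; [lra|]. intros p q Hp pq Hq HG t Ht.
  set (c' := fun n => match n with O => c O - k | S m => c (S m) end).
  assert (exc : forall h, Rabs h < r -> ex_pseries c h).
  { intros h hr. exists (G (t0 + h)). now apply pseries_recenter with r. }
  assert (exc' : forall h, Rabs h < r -> ex_pseries c' h).
  { intros h hr. apply (proj2 (ex_pseries_R c' h)). apply (ex_series_incr_1 (fun n => c' n * h ^ n)).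
    apply (ex_series_incr_1 (fun n => c n * h ^ n)). apply (proj1 (ex_pseries_R c h)). now apply exc. }
  assert (Ec : forall h, Rabs h < r -> PSeries c' h = G (t0 + h) - k).
  { intros h hr. rewrite PSeries_decr_1 by now apply exc'.
    assert (e : PSeries c h = G (t0 + h)).
    { apply is_pseries_unique. now apply pseries_recenter with r. }
    rewrite <- e, (PSeries_decr_1 c) by now apply exc. unfold PS_decr_1. simpl. ring. }
  assert (E0 : PSeries c' (t - t0) = 0).
  { apply (power_series_identity c' r r0 exc' (p - t0) (q - t0)); try lra.
    - intros h hh. rewrite Ec by (apply Rabs_def1; lra). rewrite HG by lra. ring.
    - apply Rabs_le; lra. }
  rewrite Ec in E0 by (apply Rabs_def1; lra). replace (t0 + (t - t0)) with t in E0 by ring. lra.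
Qed.

(** The Lebesgue number d is a uniform step of continuation: knowing G = k up to a point x, an
    interval next to x of length at most d carries the identity d further, on either side. *)
Lemma analytic_identity (G : R -> R) (a b u v k : R) :
  (forall t, a <= t <= b -> real_analytic_at G t) -> a <= u -> u < v -> v <= b ->
  (forall t, u <= t <= v -> G t = k) -> forall t, a <= t <= b -> G t = k.
Proof.
  intros HA au uv vb HG.
  destruct (lebesgue_number a b (fun t rho => forall p q, t - rho <= p -> p < q -> q <= t + rho ->
    (forall s, p <= s <= q -> G s = k) -> forall s, t - rho <= s <= t + rho -> G s = k)) as (d & d0 & Hd).
  { intros t Ht. apply local_identity. now apply HA. }
  assert (step : forall n t, a <= t <= b -> u - INR n * d <= t <= v + INR n * d -> G t = k).
  { induction n as [|n IH]; intros t Ht Hn.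
    - simpl in Hn. apply HG. lra.
    - rewrite S_INR in Hn. assert (nd : 0 <= INR n * d) by (apply Rmult_le_pos; [apply pos_INR|lra]).
      destruct (Rlt_or_le (v + INR n * d) t) as [R|R]; [|destruct (Rlt_or_le t (u - INR n * d)) as [L|L]].
      + set (x := v + INR n * d) in *. assert (Ex : x = v + INR n * d) by reflexivity. destruct (Hd x ltac:(lra)) as (t0 & rho & HP & H1 & H2).
        apply (HP (Rmax u (x - d)) x); try lra.
        * apply Rle_trans with (x - d); [lra|apply Rmax_r].
        * apply Rmax_lub_lt; lra.
        * intros s Hs. pose proof (Rmax_l u (x - d)). apply IH; lra.
      + set (x := u - INR n * d) in *. assert (Ex : x = u - INR n * d) by reflexivity. destruct (Hd x ltac:(lra)) as (t0 & rho & HP & H1 & H2).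
        apply (HP x (Rmin v (x + d))); try lra.
        * apply Rmin_glb_lt; lra.
        * apply Rle_trans with (x + d); [apply Rmin_r|lra].
        * intros s Hs. pose proof (Rmin_l v (x + d)). apply IH; lra.
      + apply IH; lra. }
  intros t Ht. destruct (INR_unbounded ((b - a) / d)) as [N HN].
  apply (step N t Ht).
  assert (b - a < INR N * d).
  { apply (Rmult_lt_compat_r d) in HN; [|assumption]. unfold Rdiv in HN. rewrite Rmult_assoc, Rinv_l, Rmult_1_r in HN by lra. lra. }
  lra.
Qed.

Lemma real_analytic_combination (f g : R -> R) (s t : R) :
  real_analytic_at f t -> real_analytic_at g t -> real_analytic_at (fun x => f x - s * g x) t.
Proof.
  intros (c1 & r1 & r10 & H1) (c2 & r2 & r20 & H2).
  exists (PS_plus c1 (PS_scal (- s) c2)), (Rmin r1 r2). split; [now apply Rmin_glb_lt|].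
  intros x Hx. pose proof (Rmin_l r1 r2). pose proof (Rmin_r r1 r2).
  replace (f x - s * g x) with (plus (f x) (scal (- s) (g x) : R)).
  - apply (@is_pseries_plus R_AbsRing R_NormedModule); [apply H1; lra|].
    apply (@is_pseries_scal R_AbsRing R_NormedModule); [apply Rmult_comm|apply H2; lra].
  - change (f x + (- s) * g x = f x - s * g x). ring.
Qed.

Lemma analytic_derivatives (g : R -> R) (t0 : R) : real_analytic_at g t0 ->
  exists (r : R) (g' g'' : R -> R), 0 < r /\ forall t, t0 - r < t < t0 + r ->
    is_derive g t (g' t) /\ is_derive g' t (g'' t) /\ continuous g'' t.
Proof.
  intros (c & r & r0 & H).
  exists r, (fun t => PSeries (PS_derive c) (t - t0)), (fun t => PSeries (PS_derive (PS_derive c)) (t - t0)).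
  split; [assumption|]. intros t Ht.
  assert (hr : Rabs (t - t0) < r) by (apply Rabs_def1; lra).
  assert (cv : Rbar_lt (Finite (Rabs (t - t0))) (CV_radius c)).
  { destruct (Req_dec (t - t0) 0) as [e|ne].
    - rewrite e, Rabs_R0. apply Rbar_lt_trans with (Finite (r / 2)); [simpl; lra|].
      apply ex_pseries_cv_radius with r; [lra|]. intros h hh. exists (g (t0 + h)).
      now apply pseries_recenter with r.
    - apply ex_pseries_cv_radius with r; [split; [now apply Rabs_pos_lt|assumption]|]. intros h hh. exists (g (t0 + h)).
      now apply pseries_recenter with r. }
  assert (shift : forall a : nat -> R, Rbar_lt (Finite (Rabs (t - t0))) (CV_radius a) ->
    is_derive (fun x => PSeries a (x - t0)) t (PSeries (PS_derive a) (t - t0))).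
  { intros a Ha. pose proof (is_derive_PSeries a (t - t0) Ha) as D.
    auto_derive; [repeat split; eexists; exact D|].
    change (t + - t0) with (t - t0). rewrite (is_derive_unique (fun y : R => PSeries a y) _ _ D). ring. }
  split; [|split].
  - apply (is_derive_ext_loc (fun x => PSeries c (x - t0))); [|now apply shift].
    assert (e0 : 0 < r - Rabs (t - t0)) by lra. exists (mkposreal _ e0). intros y Hy.
    apply is_pseries_unique. apply H.
    assert (Hy' : Rabs (y - t) < r - Rabs (t - t0)) by exact Hy.
    replace (y - t0) with ((y - t) + (t - t0)) by ring. eapply Rle_lt_trans; [apply Rabs_triang|]. lra.
  - apply shift. now rewrite CV_radius_derive.
  - apply (@ex_derive_continuous R_AbsRing R_NormedModule). eexists. apply shift. now rewrite !CV_radius_derive.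
Qed.

Lemma continuous_near (f : R -> R) (t e : R) : continuous f t -> 0 < e ->
  exists d : R, 0 < d /\ forall x, t - d < x < t + d -> Rabs (f x - f t) < e.
Proof.
  intros Cf e0. destruct (Cf (fun y => Rabs (y - f t) < e)) as [d Hd].
  { exists (mkposreal _ e0). intros y Hy. exact Hy. }
  exists d. split; [apply cond_pos|]. intros x Hx. apply Hd. change (Rabs (x - t) < d). apply Rabs_def1; lra.
Qed.

Lemma constant_of_derive_zero (F : R -> R) (u v : R) :
  (forall t, u < t < v -> is_derive F t 0) -> forall x y, u < x < v -> u < y < v -> F x = F y.
Proof.
  assert (W : (forall t, u < t < v -> is_derive F t 0) -> forall x y, u < x < v -> u < y < v -> x <= y -> F x = F y).
  { intros H x y Hx Hy xy.
    assert (D : forall t, x <= t <= y -> is_derive F t 0 /\ is_derive (fun _ : R => 0) t 0 /\ Rabs 0 <= 0).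
    { intros t Ht. split; [apply H; lra|split; [apply (is_derive_const 0)|rewrite Rabs_R0; lra]]. }
    pose proof (abs_increment_le F (fun _ => 0) (fun _ => 0) (fun _ => 0) x y xy D) as A.
    rewrite Rminus_0_r in A. pose proof (Rabs_pos (F y - F x)).
    destruct (Req_dec (F y - F x) 0) as [|n]; [lra|]. apply Rabs_pos_lt in n. lra. }
  intros H x y Hx Hy. destruct (Rle_or_lt x y); [now apply W|symmetry; apply W; auto; lra].
Qed.

(** Let s be the slope g2' / g1' near t0. If its derivative is nonzero somewhere, continuity
    supplies all the bounds of a curved graph around that point; otherwise s is constant and the
    graph is straight. *)
Lemma curved_graph_or_line (g1 g2 : R -> R) (t0 u v d : R) : u < t0 < v ->
  real_analytic_at g1 t0 -> real_analytic_at g2 t0 -> is_derive g1 t0 d -> d <> 0 ->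
  (exists l0 u0, u <= l0 /\ l0 < u0 /\ u0 <= v /\ curved_graph l0 u0 g1 g2) \/
  (exists s k p q, u <= p /\ p < q /\ q <= v /\ forall t, p <= t <= q -> g2 t - s * g1 t = k).
Proof.
  intros Ht A1 A2 D dn.
  destruct (analytic_derivatives g1 t0 A1) as (r1 & p & p' & r10 & H1).
  destruct (analytic_derivatives g2 t0 A2) as (r2 & q & q' & r20 & H2).
  assert (pd : p t0 = d).
  { destruct (H1 t0) as [D1 _]; [lra|]. apply is_derive_unique in D1. apply is_derive_unique in D. congruence. }
  assert (Cp : continuous p t0).
  { destruct (H1 t0) as (_ & D1 & _); [lra|]. apply (@ex_derive_continuous R_AbsRing R_NormedModule). eexists; exact D1. }
  destruct (continuous_near p t0 (Rabs d) Cp) as (r3 & r30 & H3); [now apply Rabs_pos_lt|].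
  set (rr := Rmin (Rmin r1 r2) (Rmin r3 (Rmin (t0 - u) (v - t0)))).
  assert (rr0 : 0 < rr) by (repeat apply Rmin_glb_lt; lra).
  assert (b1 : rr <= r1) by (eapply Rle_trans; [apply Rmin_l|apply Rmin_l]).
  assert (b2 : rr <= r2) by (eapply Rle_trans; [apply Rmin_l|apply Rmin_r]).
  assert (b3 : rr <= r3) by (eapply Rle_trans; [apply Rmin_r|apply Rmin_l]).
  assert (b4 : rr <= t0 - u) by (eapply Rle_trans; [apply Rmin_r|eapply Rle_trans; [apply Rmin_r|apply Rmin_l]]).
  assert (b5 : rr <= v - t0) by (eapply Rle_trans; [apply Rmin_r|eapply Rle_trans; [apply Rmin_r|apply Rmin_r]]).
  clearbody rr.
  assert (pn : forall t, t0 - rr < t < t0 + rr -> p t <> 0).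
  { intros t Htt e. specialize (H3 t ltac:(lra)). rewrite e, pd in H3.
    rewrite <- Rabs_Ropp in H3. replace (- (0 - d)) with d in H3 by ring. lra. }
  set (s := fun t => q t / p t). set (ds := fun t => (q' t * p t - q t * p' t) / (p t ^ 2)).
  assert (Ds : forall t, t0 - rr < t < t0 + rr -> is_derive s t (ds t)).
  { intros t Htt. destruct (H1 t) as (_ & D1 & _); [lra|]. destruct (H2 t) as (_ & D2 & _); [lra|].
    specialize (pn t Htt). unfold s, ds.
    auto_derive; [repeat split; try assumption; first [eexists; exact D1|eexists; exact D2]|].
    rewrite (is_derive_unique (fun y : R => p y) _ _ D1), (is_derive_unique (fun y : R => q y) _ _ D2). field. assumption. }
  destruct (classic (exists t1, t0 - rr < t1 < t0 + rr /\ ds t1 <> 0)) as [(t1 & T1 & nz)|zero].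
  - left. destruct (H1 t1) as (_ & D1 & C1); [lra|]. destruct (H2 t1) as (_ & D2 & C2); [lra|].
    assert (Cp1 : continuous p t1) by (apply (@ex_derive_continuous R_AbsRing R_NormedModule); eexists; exact D1).
    assert (Cq1 : continuous q t1) by (apply (@ex_derive_continuous R_AbsRing R_NormedModule); eexists; exact D2).
    assert (Cs1 : continuous s t1) by (apply (@ex_derive_continuous R_AbsRing R_NormedModule); eexists; apply Ds; assumption).
    assert (Cds : continuous ds t1).
    { unfold ds. apply (continuous_mult (fun t => q' t * p t - q t * p' t) (fun t => / p t ^ 2)).
      - apply (continuous_minus (fun t => q' t * p t) (fun t => q t * p' t)).
        + now apply (continuous_mult q' p).
        + now apply (continuous_mult q p').
      - apply (continuous_comp (fun t => p t ^ 2) Rinv).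
        + apply (continuous_ext (fun t => p t * p t)); [intros; simpl; ring|]. now apply (continuous_mult p p).
        + apply continuous_Rinv. apply pow_nonzero. now apply pn. }
    apply Rabs_pos_lt in nz. assert (nzp := Rabs_pos_lt _ (pn t1 T1)).
    destruct (continuous_near p t1 (Rabs (p t1) / 2) Cp1) as (e1 & e10 & N1); [lra|].
    destruct (continuous_near s t1 1 Cs1) as (e2 & e20 & N2); [lra|].
    destruct (continuous_near p' t1 1 C1) as (e3 & e30 & N3); [lra|].
    destruct (continuous_near ds t1 (Rabs (ds t1) / 2) Cds) as (e4 & e40 & N4); [lra|].
    set (e := Rmin (Rmin (Rmin e1 e2) (Rmin e3 e4)) (Rmin (t1 - (t0 - rr)) (t0 + rr - t1))).
    assert (e0 : 0 < e) by (repeat apply Rmin_glb_lt; lra).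
    assert (f1 : e <= e1) by (eapply Rle_trans; [apply Rmin_l|eapply Rle_trans; [apply Rmin_l|apply Rmin_l]]).
    assert (f2 : e <= e2) by (eapply Rle_trans; [apply Rmin_l|eapply Rle_trans; [apply Rmin_l|apply Rmin_r]]).
    assert (f3 : e <= e3) by (eapply Rle_trans; [apply Rmin_l|eapply Rle_trans; [apply Rmin_r|apply Rmin_l]]).
    assert (f4 : e <= e4) by (eapply Rle_trans; [apply Rmin_l|eapply Rle_trans; [apply Rmin_r|apply Rmin_r]]).
    assert (f5 : e <= t1 - (t0 - rr)) by (eapply Rle_trans; [apply Rmin_r|apply Rmin_l]).
    assert (f6 : e <= t0 + rr - t1) by (eapply Rle_trans; [apply Rmin_r|apply Rmin_r]).
    clearbody e.
    exists (t1 - e), (t1 + e). split; [lra|split; [lra|split; [lra|]]].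
    (* Near [t1] the functions [p] and [ds] deviate by less than half their modulus at [t1], and [s]
       and [p'] by less than 1; the large constant dominates all four. *)
    exists p, s, p', ds, (Rabs (p t1) / 2), (2 * Rabs (p t1) + Rabs (s t1) + Rabs (p' t1) + 2 * Rabs (ds t1) + 1),
      (Rabs (ds t1) / 2), (if Rle_dec 0 (ds t1) then 1 else -1).
    split; [lra|]. split; [lra|]. split; [destruct (Rle_dec 0 (ds t1)); auto|].
    intros t Htt. destruct (H1 t) as (G1 & G1' & _); [lra|]. destruct (H2 t) as (G2 & _ & _); [lra|].
    specialize (N1 t ltac:(lra)). specialize (N2 t ltac:(lra)). specialize (N3 t ltac:(lra)). specialize (N4 t ltac:(lra)).
    assert (Q : forall f : R -> R, Rabs (f t) <= Rabs (f t1) + Rabs (f t - f t1) /\ Rabs (f t1) <= Rabs (f t) + Rabs (f t - f t1)).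
    { intros f. split.
      - replace (f t) with (f t1 + (f t - f t1)) at 1 by ring. apply Rabs_triang.
      - replace (f t1) with (f t + - (f t - f t1)) at 1 by ring. rewrite <- (Rabs_Ropp (f t - f t1)). apply Rabs_triang. }
    pose proof (Q p). pose proof (Q s). pose proof (Q p'). pose proof (Q ds).
    pose proof (Rabs_pos (s t1)). pose proof (Rabs_pos (p' t1)).
    split; [exact G1|]. split.
    { replace (p t * s t) with (q t); [exact G2|]. unfold s. field. apply pn. lra. }
    split; [exact G1'|]. split; [apply Ds; lra|]. split; [lra|]. split; [lra|]. split; [lra|]. split; [lra|].
    apply Rabs_def2 in N4. destruct (Rle_dec 0 (ds t1)) as [pos|neg].
    + rewrite Rabs_pos_eq in N4 by lra. rewrite Rabs_pos_eq by lra. lra.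
    + rewrite Rabs_left in N4 by lra. rewrite Rabs_left by lra. lra.
  - right.
    assert (z : forall t, t0 - rr < t < t0 + rr -> is_derive s t 0).
    { intros t Htt. replace 0 with (ds t); [now apply Ds|]. apply NNPP. intros n. apply zero. now exists t. }
    assert (sc : forall t, t0 - rr < t < t0 + rr -> s t = s t0).
    { intros t Htt. apply (constant_of_derive_zero s (t0 - rr) (t0 + rr)); try assumption; lra. }
    exists (s t0), (g2 t0 - s t0 * g1 t0), (t0 - rr / 2), (t0 + rr / 2).
    split; [lra|split; [lra|split; [lra|]]]. intros t Htt.
    apply (constant_of_derive_zero (fun t => g2 t - s t0 * g1 t) (t0 - rr) (t0 + rr)); try lra.
    intros x Hx. destruct (H1 x) as (G1 & _ & _); [lra|]. destruct (H2 x) as (G2 & _ & _); [lra|].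
    auto_derive; [repeat split; first [eexists; exact G1|eexists; exact G2]|].
    rewrite (is_derive_unique (fun y : R => g1 y) _ _ G1), (is_derive_unique (fun y : R => g2 y) _ _ G2).
    specialize (sc x Hx). specialize (pn x Hx). rewrite <- sc. unfold s. field. assumption.
Qed.

(** By intermediate values the parameter [sig] fills the interval [m, m + w] between its extrema, so
    the image is exactly a segment, however [sig] moves along it. The case w = 0 only avoids a
    division by zero. *)
Lemma line_is_geodesic (a b : R) (g1 g2 sig : R -> R) (A1 A2 B1 B2 : R) : a <= b ->
  (forall t, a <= t <= b -> continuous sig t) ->
  (forall t, a <= t <= b -> g1 t = A1 + sig t * B1 /\ g2 t = A2 + sig t * B2) ->
  is_geodesic (in_Sigma a b g1 g2).
Proof.
  intros ab Cs H.
  assert (Cp : forall c, a <= c <= b -> continuity_pt sig c).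
  { intros c Hc. apply continuity_pt_filterlim. now apply Cs. }
  destruct (continuity_ab_min sig a b ab Cp) as (tm & Hm & Im).
  destruct (continuity_ab_maj sig a b ab Cp) as (tM & HM & IM).
  set (m := sig tm) in *. set (w := sig tM - m).
  assert (w0 : 0 <= w) by (unfold w; specialize (Hm tM IM); lra).
  exists (A1 + m * B1, A2 + m * B2), (w * B1, w * B2). intros q. cbn [fst snd]. split.
  - intros (t & Ht & <-). destruct (H t Ht) as [E1 E2].
    assert (L := Hm t Ht). assert (U := HM t Ht).
    destruct (Req_dec w 0) as [wz|wn].
    + exists 0. split; [lra|]. assert (sig t = m) by (unfold w in wz; lra). rewrite E1, E2, H0. f_equal. f_equal; ring.
    + exists ((sig t - m) / w). split.
      * split; [apply Rmult_le_pos; [lra|left; apply Rinv_0_lt_compat; lra]|].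
        apply (Rmult_le_reg_r w); [lra|]. unfold Rdiv. rewrite Rmult_assoc, Rinv_l by assumption. unfold w. lra.
      * rewrite E1, E2. f_equal. f_equal; field; assumption.
  - intros (s & Hs & <-).
    assert (ex : exists t, a <= t <= b /\ sig t = m + s * w).
    { destruct (Req_dec (s * w) 0) as [z|nz]; [exists tm; split; [assumption|unfold m in *; lra]|].
      destruct (Req_dec ((1 - s) * w) 0) as [z|nz'].
      { exists tM. split; [assumption|]. unfold w in *. lra. }
      assert (0 <= s * w) by (apply Rmult_le_pos; lra). assert (0 <= (1 - s) * w) by (apply Rmult_le_pos; lra).
      assert (Bt : forall t, Rmin tm tM <= t <= Rmax tm tM -> a <= t <= b).
      { intros t. unfold Rmin, Rmax. destruct (Rle_dec tm tM); lra. }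
      destruct (ivt_between sig tm tM (m + s * w)) as [z [Hz Ez]].
      - intros t Ht. apply Cs. now apply Bt.
      - fold m. unfold w in *. lra.
      - exists z. split; [now apply Bt|assumption]. }
    destruct ex as (t & Ht & Et). exists t. split; [assumption|]. destruct (H t Ht) as [-> ->]. rewrite Et.
    f_equal. f_equal; ring.
Qed.

Lemma curved_subarc (a b u v : R) (g1 g2 : R -> R) :
  analytic_regular_curve a b g1 g2 -> ~ is_geodesic (in_Sigma a b g1 g2) ->
  a <= u -> u < v -> v <= b ->
  exists l0 u0, u <= l0 /\ l0 < u0 /\ u0 <= v /\ curved_arc l0 u0 g1 g2.
Proof.
  intros (ab & An & Reg) Ng au uv vb.
  set (t0 := (u + v) / 2). assert (T : u < t0 < v) by (unfold t0; lra).
  destruct (An t0) as [A1 A2]; [lra|].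
  assert (Cg : forall t, a <= t <= b -> continuous g1 t /\ continuous g2 t).
  { intros t Ht. destruct (Reg t Ht) as (d1 & d2 & D1 & D2 & _).
    split; apply (@ex_derive_continuous R_AbsRing R_NormedModule); eexists; eassumption. }
  destruct (Reg t0) as (d1 & d2 & D1 & D2 & [n|n]); [lra| |].
  - destruct (curved_graph_or_line g1 g2 t0 u v d1 T A1 A2 D1 n) as [(l0 & u0 & H1 & H2 & H3 & H4)|(s & k & p & q & H1 & H2 & H3 & H4)].
    + exists l0, u0. repeat split; try assumption. now left.
    + exfalso. apply Ng. apply (line_is_geodesic a b g1 g2 g1 0 k 1 s); [lra|intros t Ht; now apply Cg|].
      assert (Id : forall t, a <= t <= b -> g2 t - s * g1 t = k).
      { apply (analytic_identity (fun t => g2 t - s * g1 t) a b p q); try lra; [|assumption].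
        intros t Ht. apply real_analytic_combination; now apply An. }
      intros t Ht. specialize (Id t Ht). split; lra.
  - destruct (curved_graph_or_line g2 g1 t0 u v d2 T A2 A1 D2 n) as [(l0 & u0 & H1 & H2 & H3 & H4)|(s & k & p & q & H1 & H2 & H3 & H4)].
    + exists l0, u0. repeat split; try assumption. now right.
    + exfalso. apply Ng. apply (line_is_geodesic a b g1 g2 g2 k 0 s 1); [lra|intros t Ht; now apply Cg|].
      assert (Id : forall t, a <= t <= b -> g1 t - s * g2 t = k).
      { apply (analytic_identity (fun t => g1 t - s * g2 t) a b p q); try lra; [|assumption].
        intros t Ht. apply real_analytic_combination; now apply An. }
      intros t Ht. specialize (Id t Ht). split; lra.
Qed.

(** * Nodal intersections *)

Definition few_zeros (g1 g2 : R -> R) (u v : R) : Prop :=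
  exists (E0 : nat) (K : R), (0 < E0)%nat /\ 0 < K /\
    forall (E : nat) (c : Z * Z -> C), (E0 <= E)%nat -> is_eigenfunction E c ->
    forall zs : list R, NoDup zs ->
      (forall t, In t zs -> u <= t <= v /\ re_sum (lattice_pts E) g1 g2 c t = 0) ->
      INR (length zs) <= K * sqrt (INR E).

Lemma few_zeros_union (g1 g2 : R -> R) (u v w : R) :
  few_zeros g1 g2 u v -> few_zeros g1 g2 v w -> few_zeros g1 g2 u w.
Proof.
  intros (E1 & K1 & E10 & K10 & H1) (E2 & K2 & E20 & K20 & H2).
  exists (E1 + E2)%nat, (K1 + K2). split; [lia|split; [lra|]]. intros E c HE He zs nd Hz.
  set (f := fun t => if Rle_dec t v then true else false).
  rewrite <- (filter_length f zs), plus_INR, Rmult_plus_distr_r.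
  apply Rplus_le_compat; [apply (H1 E c)|apply (H2 E c)]; try lia; try assumption; try now apply NoDup_filter.
  - intros t Ht. apply filter_In in Ht as [Ht Hf]. destruct (Hz t Ht). unfold f in Hf.
    destruct (Rle_dec t v); [split; [lra|assumption]|discriminate].
  - intros t Ht. apply filter_In in Ht as [Ht Hf]. destruct (Hz t Ht). unfold f in Hf.
    destruct (Rle_dec t v); [discriminate|split; [lra|assumption]].
Qed.

(** Compactness cuts [a, b] into finitely many short intervals, each of which contains a curved
    subarc; the thresholds and constants of the pieces add up. *)
Lemma few_zeros_on_curve (a b : R) (g1 g2 : R -> R) :
  analytic_regular_curve a b g1 g2 -> ~ is_geodesic (in_Sigma a b g1 g2) -> few_zeros g1 g2 a b.
Proof.
  intros Hr Ng. assert (Hr' := Hr). destruct Hr' as (ab & An & _).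
  destruct (lebesgue_number a b (fun t0 rho => forall u v l0 u0 : R,
    t0 - rho <= u -> v <= t0 + rho -> u <= l0 -> l0 < u0 -> u0 <= v -> curved_arc l0 u0 g1 g2 ->
    few_zeros g1 g2 u v)) as (d & d0 & Hd).
  { intros t Ht. destruct (An t Ht). now apply interval_zero_bound. }
  assert (short : forall u v, a <= u -> u < v -> v <= b -> v <= u + d -> few_zeros g1 g2 u v).
  { intros u v au uv vb vd. destruct (Hd u) as (t & rho & HP & L1 & L2); [lra|].
    destruct (curved_subarc a b u v g1 g2 Hr Ng au uv vb) as (l0 & u0 & C1 & C2 & C3 & C4).
    apply (HP u v l0 u0); try assumption; lra. }
  assert (step : forall n v, a < v <= b -> v <= a + INR n * d -> few_zeros g1 g2 a v).
  { induction n as [|n IH]; intros v Hv Hn; [simpl in Hn; lra|]. rewrite S_INR in Hn.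
    destruct (Rle_or_lt v (a + d)) as [s|s]; [apply short; lra|].
    apply few_zeros_union with (v - d); [apply IH; lra|apply short; lra]. }
  destruct (INR_unbounded ((b - a) / d)) as [N HN]. apply (step N); [lra|].
  apply (Rmult_lt_compat_r d) in HN; [|assumption]. unfold Rdiv in HN.
  rewrite Rmult_assoc, Rinv_l, Rmult_1_r in HN by lra. lra.
Qed.

(** * From zeros in the parameter to points of the torus *)

Lemma frac_part_eq (x y : R) : frac_part x = frac_part y -> Rabs (x - y) < 1 -> x = y.
Proof.
  unfold frac_part. intros e lt.
  assert (E : x - y = IZR (Int_part x - Int_part y)) by (rewrite minus_IZR; lra).
  rewrite E in lt. rewrite <- abs_IZR in lt. apply lt_IZR in lt.
  replace (Int_part x - Int_part y)%Z with 0%Z in E by lia. lra.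
Qed.

(** On a parameter interval of length at most 1 / K the coordinate g1 varies by less than 1, and its
    derivative never vanishes, so it is injective modulo 1. Distinct zeros of the lower bound
    thereby give distinct points of the torus. *)
Lemma curved_graph_injective (l u : R) (g1 g2 : R -> R) : l < u -> curved_graph l u g1 g2 ->
  exists u', l < u' <= u /\ curved_graph l u' g1 g2 /\
    forall t t', l < t < u' -> l < t' < u' -> frac_part (g1 t) = frac_part (g1 t') -> t = t'.
Proof.
  intros lu (p & s & dp & ds & mu & K & kap & sg & mu0 & kap0 & Hsg & H).
  assert (K0 : 0 < K). { destruct (H ((l + u) / 2)) as (_ & _ & _ & _ & B & _); lra. }
  set (u' := Rmin u (l + / K)). assert (iK : 0 < / K) by now apply Rinv_0_lt_compat.
  assert (u1 : u' <= u) by apply Rmin_l. assert (u2 : u' <= l + / K) by apply Rmin_r.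
  exists u'. split; [split; [apply Rmin_glb_lt; lra|assumption]|]. split.
  { exists p, s, dp, ds, mu, K, kap, sg. repeat (split; [assumption|]). intros t Ht. apply H. lra. }
  assert (W : forall t t', l < t -> t < t' -> t' < u' -> frac_part (g1 t) = frac_part (g1 t') -> False).
  { intros t t' lt tt tu e. destruct (MVT_gen g1 t t' p) as [c [Hc Ec]].
    - intros x Hx. rewrite Rmin_left, Rmax_right in Hx by lra. apply H. lra.
    - intros x Hx. rewrite Rmin_left, Rmax_right in Hx by lra. apply continuity_pt_filterlim.
      apply (@ex_derive_continuous R_AbsRing R_NormedModule). exists (p x). apply H. lra.
    - rewrite Rmin_left, Rmax_right in Hc by lra. destruct (H c) as (_ & _ & _ & _ & [B1 B2] & _); [lra|].
      assert (E : g1 t = g1 t').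
      { apply frac_part_eq; [assumption|]. rewrite <- Rabs_Ropp.
        replace (- (g1 t - g1 t')) with (p c * (t' - t)) by lra. rewrite Rabs_mult, (Rabs_pos_eq (t' - t)) by lra.
        apply Rle_lt_trans with (K * (t' - t)); [apply Rmult_le_compat_r; lra|].
        rewrite <- (Rinv_r K) by lra. apply Rmult_lt_compat_l; lra. }
      rewrite E in Ec. assert (Z : p c * (t' - t) = 0) by lra.
      apply Rmult_integral in Z as [Z|Z]; [|lra]. rewrite Z, Rabs_R0 in B1. lra. }
  intros t t' Ht Ht' e. destruct (Rtotal_order t t') as [lt|[->|gt]]; [|reflexivity|]; exfalso.
  - now apply (W t t'); lra || assumption.
  - apply (W t' t); lra || (symmetry; assumption).
Qed.

Lemma curved_arc_injective (l u : R) (g1 g2 : R -> R) : l < u -> curved_arc l u g1 g2 ->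
  exists u', l < u' <= u /\ curved_arc l u' g1 g2 /\
    forall t t', l < t < u' -> l < t' < u' -> red (g1 t, g2 t) = red (g1 t', g2 t') -> t = t'.
Proof.
  intros lu [H|H]; destruct (curved_graph_injective l u _ _ lu H) as (u' & Hu & Hc & Hi);
    exists u'; (split; [assumption|split; [now (left + right)|]]);
    intros t t' Ht Ht' e; unfold red in e; injection e as e1 e2; now apply Hi.
Qed.

(** A list is extended by a missing element as long as there is one; the length bound B stops the
    process, so finiteness of the intersection follows from the upper bound alone. *)
Lemma finite_enumeration {A : Type} (P : A -> Prop) (B : nat) :
  (forall L : list A, NoDup L -> (forall p, In p L -> P p) -> (length L <= B)%nat) ->
  exists L : list A, NoDup L /\ forall p, In p L <-> P p.
Proof.
  intros HB.
  assert (ext : forall n (L : list A), (B <= length L + n)%nat -> NoDup L -> (forall p, In p L -> P p) ->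
    exists L' : list A, NoDup L' /\ forall p, In p L' <-> P p).
  { induction n as [|n IH]; intros L Hn nd HL;
      (destruct (classic (forall p, P p -> In p L)) as [full|nf];
       [exists L; split; [assumption|intros p; split; [apply HL|apply full]]|]);
      apply not_all_ex_not in nf as [p nf]; apply imply_to_and in nf as [Pp np].
    - assert (C : (length (p :: L) <= B)%nat).
      { apply HB; [now constructor|]. intros q [<-|Hq]; [assumption|now apply HL]. }
      simpl in C. lia.
    - apply (IH (p :: L)); [simpl; lia|now constructor|]. intros q [<-|Hq]; [assumption|now apply HL]. }
  apply (ext B nil); [simpl; lia|constructor|intros p []].
Qed.

Lemma lift_to_parameters {A B : Type} (P : A -> Prop) (f : A -> B) (L : list B) :
  (forall q, In q L -> exists t, P t /\ f t = q) -> exists ts, map f ts = L /\ forall t, In t ts -> P t.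
Proof.
  induction L as [|q L IH]; intros H.
  - exists nil. split; [reflexivity|intros t []].
  - destruct (H q (or_introl eq_refl)) as (t & Pt & ft).
    destruct IH as (ts & E & Hts); [intros r Hr; apply H; now right|].
    exists (t :: ts). split; [simpl; congruence|]. intros s [<-|Hs]; [assumption|now apply Hts].
Qed.

Lemma phi_red_curve (E : nat) (c : Z * Z -> C) (g1 g2 : R -> R) (t : R) :
  phi E c (red (g1 t, g2 t)) = re_sum (lattice_pts E) g1 g2 c t.
Proof. unfold phi. rewrite eigen_sum_red, eigen_sum_curve. reflexivity. Qed.

Theorem theorem10p8 (a b : R) (g1 g2 : R -> R) :
  analytic_regular_curve a b g1 g2 ->
  ~ is_geodesic (in_Sigma a b g1 g2) ->
  exists (E0 : nat) (Cst : R), 0 < Cst /\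
    forall eps : R, 0 < eps ->
    exists c_eps : R, 0 < c_eps /\
      forall (E : nat) (coef : Z * Z -> C),
        (0 < E)%nat -> (E0 <= E)%nat ->
        is_eigenfunction E coef ->
        (* the points of N ∩ Σ (as representatives in [0,1)^2) form the finite list L *)
        exists L : list (R * R),
          NoDup L /\
          (forall p, In p L <-> (in_Sigma a b g1 g2 p /\ phi E coef p = 0)) /\
          c_eps * Rpower (INR E) (1/2 - eps) < INR (length L) /\
          INR (length L) < Cst * Rpower (INR E) (1/2).
Proof.
  intros Hr Ng. assert (ab := proj1 Hr).
  destruct (few_zeros_on_curve a b g1 g2 Hr Ng) as (E1 & K & E10 & K0 & Up).
  destruct (curved_subarc a b a b g1 g2 Hr Ng) as (l & u1 & al & lu1 & ub & Hc1); try lra.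
  destruct (curved_arc_injective l u1 g1 g2 lu1 Hc1) as (u & [lu uu1] & Hc & Inj).
  (* At eps = 1/2 the lower bound is a positive constant, so at least one zero exists beyond a
     threshold that does not depend on the eps of the statement. *)
  destruct (many_sign_changes l u g1 g2 (1 / 2) lu Hc) as (k1 & E2 & k10 & E20 & Lo1); [lra|].
  exists (E1 + E2)%nat, (K + 1). split; [lra|]. intros eps eps0.
  destruct (many_sign_changes l u g1 g2 eps lu Hc eps0) as (k & E3 & k0 & E30 & Lo).
  assert (M0 : 0 < Rpower (INR E3 + 1) (1 / 2)) by apply exp_pos.
  (* The first entry serves E >= E3, halved for strictness. The second serves E < E3, where E^(1/2 -
     eps) <= (E3 + 1)^(1/2) and one point is known: the product is at most 1/2. *)
  exists (Rmin (k / 2) (/ (2 * Rpower (INR E3 + 1) (1 / 2)))). split.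
  { apply Rmin_glb_lt; [lra|apply Rinv_0_lt_compat; lra]. }
  intros E coef Epos HE Heig.
  assert (EI : 1 <= INR E) by (apply (le_INR 1); lia).
  assert (sq : sqrt (INR E) = Rpower (INR E) (1 / 2)).
  { rewrite <- Rpower_sqrt by lra. f_equal. lra. }
  assert (sq0 : 0 < Rpower (INR E) (1 / 2)) by apply exp_pos.
  set (P := fun p => in_Sigma a b g1 g2 p /\ phi E coef p = 0).
  assert (Bd : forall L : list (R * R), NoDup L -> (forall p, In p L -> P p) ->
    INR (length L) <= K * Rpower (INR E) (1 / 2)).
  { intros L nd HL.
    destruct (lift_to_parameters (fun t => a <= t <= b /\ re_sum (lattice_pts E) g1 g2 coef t = 0)
      (fun t => red (g1 t, g2 t)) L) as (ts & Ets & Hts).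
    { intros q Hq. destruct (HL q Hq) as [(t & Ht & Et) Z]. exists t. split; [|exact Et].
      split; [assumption|]. rewrite <- phi_red_curve, Et. exact Z. }
    rewrite <- Ets, length_map, <- sq. apply (Up E coef); [lia|assumption| |assumption].
    apply (NoDup_map_inv (fun t => red (g1 t, g2 t))). now rewrite Ets. }
  assert (Low : forall zs, NoDup zs ->
    (forall z, In z zs -> l < z < u /\ re_sum (lattice_pts E) g1 g2 coef z = 0) ->
    forall L : list (R * R), (forall p, In p L <-> P p) -> INR (length zs) <= INR (length L)).
  { intros zs nd Hz L HL. rewrite <- (length_map (fun t => red (g1 t, g2 t))). apply le_INR.
    apply NoDup_incl_length.
    - apply NoDup_map_NoDup_ForallPairs; [|assumption].
      intros x y Hx Hy e. apply Inj; [now apply Hz|now apply Hz|exact e].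
    - intros p Hp. apply in_map_iff in Hp as (t & <- & Ht). destruct (Hz t Ht) as [Z1 Z2].
      apply HL. split; [exists t; split; [lra|reflexivity]|]. now rewrite phi_red_curve. }
  destruct (INR_unbounded (K * Rpower (INR E) (1 / 2))) as [B HB].
  destruct (finite_enumeration P B) as (L & nd & HL).
  { intros L nd HL. apply INR_le. specialize (Bd L nd HL). lra. }
  exists L. split; [assumption|]. split; [exact HL|].
  assert (one : 1 <= INR (length L)).
  { destruct (Lo1 E coef) as (zs & nz & Hz & Hl); [lia|assumption|].
    specialize (Low zs nz Hz L HL). pose proof (exp_pos ((1 / 2 - 1 / 2) * ln (INR E))) as X.
    fold (Rpower (INR E) (1 / 2 - 1 / 2)) in X.
    assert (Y : 0 < k1 * Rpower (INR E) (1 / 2 - 1 / 2)) by now apply Rmult_lt_0_compat.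
    assert (Z : 0 < INR (length L)) by lra.
    apply (INR_lt 0) in Z. apply (le_INR 1). lia. }
  split.
  - assert (q0 : 0 < Rpower (INR E) (1 / 2 - eps)) by apply exp_pos.
    destruct (Nat.le_gt_cases E3 E) as [big|small].
    + destruct (Lo E coef big Heig) as (zs & nz & Hz & Hl). specialize (Low zs nz Hz L HL).
      apply Rlt_le_trans with (k * Rpower (INR E) (1 / 2 - eps)); [|lra].
      apply Rmult_lt_compat_r; [assumption|]. eapply Rle_lt_trans; [apply Rmin_l|lra].
    + apply Rle_lt_trans with (/ (2 * Rpower (INR E3 + 1) (1 / 2)) * Rpower (INR E3 + 1) (1 / 2)).
      * apply Rmult_le_compat; [apply Rmin_glb; [lra|left; apply Rinv_0_lt_compat; lra]|lra|apply Rmin_r|].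
        apply Rle_trans with (Rpower (INR E) (1 / 2)); [apply Rle_Rpower; lra|].
        apply Rle_Rpower_l; [lra|]. apply lt_INR in small. lra.
      * replace (/ (2 * Rpower (INR E3 + 1) (1 / 2)) * Rpower (INR E3 + 1) (1 / 2)) with (/ 2) by (field; lra). lra.
  - specialize (Bd L nd (fun p Hp => proj1 (HL p) Hp)). lra.
Qed.
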